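(* Let $d\ge1$, let $n\in\{1,\ldots,d\}$, and let $h>0$ be irrational. For each $\beta$ let $Q=Q(\beta)\subset\mathbb Z^d$ be a box with $\lim_{\beta\to\infty}\frac{\ln|Q|}{\ln\beta}=0$, and let $\mathcal D=\mathcal D(\beta)\subset\{-1,+1\}^Q$ be a set of configurations such that: (a) there exists $v_{\mathcal D}$, independent of $\beta$, such that $|\sigma|\le v_{\mathcal D}$ for any $\sigma\in\mathcal D$; (b) if $\sigma\in\mathcal D$ and $C$ is a connected component of $\sigma$, then $H^{n\pm}_Q(C)>H^{n\pm}_Q(-\mathbf 1)$; (c) if $\sigma\in\mathcal D$ and $\eta$ is such that $\eta\subset\sigma$ and $H_Q^{n\pm}(\eta)\le H_Q^{n\pm}(\sigma)$, then $\eta\in\mathcal D$. Then for any $K>0$ there exists a value $D$ which depends only on $v_{\mathcal D}$ and $K$ such that, for $\beta$ large enough, $$\forall\alpha\in\mathcal D\qquad P\Bigl(\operatorname{diam}_\infty\mathrm{STC}\bigl(\sigma^{\alpha,n\pm}_{Q,t},\,0\le t\le\tau(\mathcal D)\bigr)\ge D\Bigr)\le\exp(-\beta K).$$ (Here $d,n,h$ are fixed.)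
   Context: Configurations. A configuration in a finite box $\Lambda\subset\mathbb Z^d$ is an element of $\{-1,+1\}^\Lambda$, identified with its set of plus sites; $|\sigma|$ is the number of pluses, $-\mathbf 1$ is the all-minus configuration, and $\eta\subset\sigma$ is inclusion of plus sets. A connected component of $\sigma$ is a maximal subset of its plus sites connected for nearest-neighbour adjacency; a set $C$ is also seen as the configuration whose plus set is $C$. For a boundary condition $\zeta\in\{-1,+1\}^{\mathbb Z^d\setminus\Lambda}$, $$H^\zeta_\Lambda(\sigma)=-\tfrac12\sum_{\{x,y\}\subset\Lambda,|x-y|=1}\sigma(x)\sigma(y)-\tfrac h2\sum_{x\in\Lambda}\sigma(x)-\tfrac12\sum_{x\in\Lambda,y\notin\Lambda,|x-y|=1}\sigma(x)\zeta(y)+c^\zeta_\Lambda,$$ the constant being chosen so that $H^\zeta_\Lambda(-\mathbf 1)=0$. The $n\pm$ boundary condition on a parallelepiped puts minuses on the exterior faces orthogonal to the first $n$ axes and pluses on the exterior faces orthogonal to the other $d-n$ axes; $H^{n\pm}_\Lambda$ is the corresponding Hamiltonian. Dynamics. $(\sigma^{\alpha,n\pm}_{Q,t})_{t\ge0}$ is the continuous-time Markov process on $\{-1,+1\}^Q$ started from $\alpha$ in which the spin at $x\in Q$ flips at rate $\exp(-\beta\max(0,H^{n\pm}_Q(\sigma^x)-H^{n\pm}_Q(\sigma)))$, $\sigma^x$ being $\sigma$ with the spin at $x$ flipped. $\tau(\mathcal D)=\inf\{t\ge0:\sigma^{\alpha,n\pm}_{Q,t}\notin\mathcal D\}$. Space–time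 clusters. For a trajectory $(\sigma_t)_{s\le t\le u}$ in $\{-1,+1\}^Q$, two space–time points $(x,t),(y,r)\in Q\times[s,u]$ with $\sigma_t(x)=\sigma_r(y)=+1$ are linked if either $t=r$ and $|x-y|\le1$, or $x=y$ and $\sigma_v(x)=+1$ for all $v\in[\min(t,r),\max(t,r)]$. A space–time cluster is a maximal connected component for this relation; $\mathrm{STC}(\sigma_t,s\le t\le u)$, or $\mathrm{STC}(s,u)$, is the set of these clusters. The diameter of a cluster $\mathcal C$ is $\operatorname{diam}_\infty\mathcal C=\sup\{|x-y|_\infty:(x,t),(y,r)\in\mathcal C\}$ with $|\cdot|_\infty$ the supremum norm. For the whole set of clusters one defines $$\operatorname{diam}_\infty\mathrm{STC}(s,u)=\max\Bigl(\sum_{\mathcal C\cap(Q\times\{s,u\})\ne\varnothing}\operatorname{diam}_\infty\mathcal C,\ \max_{\mathcal C\cap(Q\times\{s,u\})=\varnothing}\operatorname{diam}_\infty\mathcal C\Bigr),$$ where $\mathcal C$ ranges over $\mathrm{STC}(s,u)$ and empty sums and maxima are $0$. *)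

(* Defs.v *)
From mathcomp Require Import all_boot all_order all_algebra finmap.
From mathcomp Require Import all_classical all_reals all_analysis.
From Stdlib Require Import Relation_Operators.

Set Implicit Arguments.
Unset Strict Implicit.
Unset Printing Implicit Defensive.

Import Order.TTheory GRing.Theory Num.Theory.
Import numFieldNormedType.Exports.

Local Open Scope classical_set_scope.
Local Open Scope ring_scope.

(* Sites of Z^d are integer row vectors. *)

Definition dist1 (d : nat) (x y : 'rV[int]_d) : nat :=
  (\sum_(i < d) `|x 0%R i - y 0%R i|)%N.

Definition dist_sup (d : nat) (x y : 'rV[int]_d) : nat :=
  (\max_(i < d) `|x 0%R i - y 0%R i|)%N.

Definition is_box (d : nat) (Q : {fset 'rV[int]_d}) : Prop :=
  exists lo hi : 'rV[int]_d,
    (forall i, lo 0 i <= hi 0 i) /\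
    (forall x : 'rV[int]_d, x \in Q <-> forall i, lo 0 i <= x 0 i <= hi 0 i).

(* A configuration is identified with its set of plus sites: inclusion of
   configurations is \subset, |sigma| is #|sigma|, and all-minus is set0. *)
Definition config (d : nat) (Q : {fset 'rV[int]_d}) : finType := {set Q}.

Definition spin (R : realType) (b : bool) : R := if b then 1 else -1.

(* In the first term every unordered pair {x, y} is visited twice, whence 1/4
   where the Hamiltonian has 1/2.  Only the values of zeta outside Q matter. *)
Definition raw_energy (R : realType) (d : nat) (h : R) (Q : {fset 'rV[int]_d})
    (zeta : 'rV[int]_d -> bool) (sigma : config Q) : R :=
  - 4^-1 * (\sum_(x : Q) \sum_(y : Q | dist1 (val x) (val y) == 1%N)
              spin R (x \in sigma) * spin R (y \in sigma))
  - h / 2 * (\sum_(x : Q) spin R (x \in sigma))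
  - 2^-1 * (\sum_(x : Q)
              \sum_(y \in [set y : 'rV[int]_d |
                            (y \notin Q) && (dist1 (val x) y == 1%N)])
                spin R (x \in sigma) * spin R (zeta y)).

Definition hamiltonian (R : realType) (d : nat) (h : R) (Q : {fset 'rV[int]_d})
    (zeta : 'rV[int]_d -> bool) (sigma : config Q) : R :=
  raw_energy h zeta sigma - raw_energy h zeta (finset.set0 : config Q).

Definition on_exterior_face (d : nat) (Q : {fset 'rV[int]_d}) (i : 'I_d)
    (y : 'rV[int]_d) : bool :=
  (y \notin Q) &&
  [exists x : Q, (y == val x + delta_mx 0 i) || (y == val x - delta_mx 0 i)].

(* Every y outside a box Q with a neighbour in Q is on an exterior face
   orthogonal to exactly one axis. *)
Definition npm_bc (d n : nat) (Q : {fset 'rV[int]_d}) (y : 'rV[int]_d) : bool :=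
  ~~ [exists i : 'I_d, (i < n)%N && on_exterior_face Q i y].

Definition H_npm (R : realType) (d n : nat) (h : R) (Q : {fset 'rV[int]_d}) :
    config Q -> R :=
  hamiltonian h (npm_bc n Q).

Definition nn_connected (d : nat) (Q : {fset 'rV[int]_d}) (A : {set Q}) : bool :=
  [forall x in A, forall y in A,
     connect [rel a b : Q | [&& a \in A, b \in A & dist1 (val a) (val b) == 1%N]]
       x y].

Definition is_component (d : nat) (Q : {fset 'rV[int]_d})
    (sigma C : config Q) : bool :=
  (C != finset.set0) &&
  maxset (fun A : {set Q} => (A \subset sigma) && nn_connected A) C.

Definition flip (d : nat) (Q : {fset 'rV[int]_d}) (sigma : config Q) (x : Q) :
    config Q :=
  if x \in sigma then (sigma :\ x)%SET else (x |: sigma)%SET.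

Definition flip_rate (R : realType) (d n : nat) (h beta : R)
    (Q : {fset 'rV[int]_d}) (sigma : config Q) (x : Q) : R :=
  expR (- beta * Num.max 0 (H_npm n h (flip sigma x) - H_npm n h sigma)).

Definition jump_rate (R : realType) (d n : nat) (h beta : R)
    (Q : {fset 'rV[int]_d}) (sigma eta : config Q) : R :=
  \sum_(x : Q | flip sigma x == eta) flip_rate n h beta sigma x.

(* X is a right-continuous Markov jump process on the finite space S, started
   from a, with rates q s s' for s != s' (the diagonal of q must vanish and
   every total rate must be positive): the successive states Y k form a Markov
   chain with transition probabilities q s s' / \sum_s' q s s', and given Y the
   holding times T k are independent, T k being exponential with parameter the
   total rate out of Y k.  The last clause is the joint law of (Y, T). *)
Definition markov_jump_process (R : realType) (S : finType) (q : S -> S -> R)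
    (a : S) (disp : measure_display) (Omega : measurableType disp)
    (P : probability Omega R) (X : R -> Omega -> S) : Prop :=
  exists (Y : nat -> Omega -> S) (T : nat -> Omega -> R),
    let J k w := \sum_(j < k) T j w in
    let total s := \sum_(s' : S) q s s' in
    [/\ forall k s, measurable [set w | Y k w = s],
        forall k, measurable_fun [set: Omega] (T k),
        forall w, (forall k, 0 < T k w) /\ J k w @[k --> \oo] --> +oo,
        forall w k t, J k w <= t < J k.+1 w -> X t w = Y k w &
        forall (m : nat) (y : nat -> S) (u : nat -> R), (forall k, 0 <= u k) ->
          P [set w | forall k, (k <= m)%N -> Y k w = y k /\ u k < T k w] =
          ((y 0%N == a)%:R *
           (\prod_(k < m) (q (y k) (y k.+1) / total (y k))) *
           (\prod_(k < m.+1) expR (- total (y k) * u k)))%:E].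

Definition glauber_process (R : realType) (d n : nat) (h beta : R)
    (Q : {fset 'rV[int]_d}) (alpha : config Q) (disp : measure_display)
    (Omega : measurableType disp) (P : probability Omega R)
    (X : R -> Omega -> config Q) : Prop :=
  markov_jump_process (@jump_rate R d n h beta Q) alpha P X.

(* +oo when the trajectory never leaves calD. *)
Definition exit_time (R : realType) (S : finType) (calD : {set S})
    (traj : R -> S) : \bar R :=
  ereal_inf [set t%:E | t in [set t : R | 0 <= t /\ traj t \notin calD]].

(* The plus space-time points of a trajectory on [s, u]; when u = +oo the time
   interval is [s, +oo[ and there is no final time slice. *)
Definition plus_point (R : realType) (d : nat) (Q : {fset 'rV[int]_d})
    (traj : R -> config Q) (s : R) (u : \bar R) (p : Q * R) : Prop :=
  [/\ s <= p.2, (p.2%:E <= u)%E & p.1 \in traj p.2].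

Definition linked (R : realType) (d : nat) (Q : {fset 'rV[int]_d})
    (traj : R -> config Q) (s : R) (u : \bar R) (p q : Q * R) : Prop :=
  [/\ plus_point traj s u p, plus_point traj s u q &
      (p.2 = q.2 /\ (dist1 (val p.1) (val q.1) <= 1)%N) \/
      (p.1 = q.1 /\ forall v : R, Num.min p.2 q.2 <= v <= Num.max p.2 q.2 ->
                      p.1 \in traj v)].

Definition STC (R : realType) (d : nat) (Q : {fset 'rV[int]_d})
    (traj : R -> config Q) (s : R) (u : \bar R) : set (set (Q * R)) :=
  [set C | exists2 p, plus_point traj s u p &
           C = [set q | clos_refl_trans (Q * R) (linked traj s u) p q]].

Definition diam_cluster (R : realType) (d : nat) (Q : {fset 'rV[int]_d})
    (C : set (Q * R)) : \bar R :=
  ereal_sup [set e | exists p q, [/\ C p, C q &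
                       e = ((dist_sup (val p.1) (val q.1))%:R : R)%:E]].

Definition meets_ends (R : realType) (d : nat) (Q : {fset 'rV[int]_d})
    (s : R) (u : \bar R) (C : set (Q * R)) : Prop :=
  exists2 p, C p & p.2 = s \/ p.2%:E = u.

(* 0 is adjoined so that the supremum over no cluster is 0. *)
Definition diam_STC (R : realType) (d : nat) (Q : {fset 'rV[int]_d})
    (traj : R -> config Q) (s : R) (u : \bar R) : \bar R :=
  maxe (esum (STC traj s u `&` meets_ends s u) (@diam_cluster R d Q))
       (ereal_sup (0%E |`
          (@diam_cluster R d Q @` (STC traj s u `\` meets_ends s u)))).

(* Main.v *)
(** Call a configuration safe if it has at most v pluses and each of its nonempty
   subsets has positive energy; (a), (b), (c) force calD to consist of safe
   configurations.  For a lazy discrete version of the dynamics, driven by a noise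
   common to all volumes and all initial states, one shows by induction on v that,
   up to probability exp(-beta K), clusters have bounded diameter as long as the
   trajectory remains safe.
   - Outside the empty and the unsafe configurations, the energy rarely exceeds the
     communication height: by reversibility a hitting probability has Dirichlet form
     at most exp(-beta (E + delta)), hence varies little along the edges of a path of
     energy at most E.  Up to exponentially small probability there are fewer than m
     such violations, m being fixed.
   - Between violations, the height does not increase, and irrationality of h makes
     each plateau a bounded union of intervals on which the configuration keeps
     meeting a fixed set A, the bottom of a well.
   - While the configuration meets A, the pluses which A has not contaminated follow
     the dynamics in the complement of A with at most v - 1 pluses, so the induction
     hypothesis bounds their clusters.
   The estimate passes to the jump chain, since repeating a configuration does not
   change the spatial extent of clusters, and the continuous-time event is expressed
   through the jump chain alone. *)

(* The exit from the safe configurations may take a time exponential in beta, so a cluster has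
   exponentially many occasions to grow. This dictates the order of quantifiers in [tame]: every K
   is allowed at each level, so that the exponent 2 * C1 of the number of steps can be added to K at
   the level below and can be beaten by the number m of violations. Powers of #|V| are harmless
   because #|V| <= beta.

   The chain is lazy because comparing the chains in L and in L :\: A requires that both try the
   same site at the same step, whatever was accepted before. Safety is closed under inclusion, as it
   must be, since the uncontaminated pluses may form any subset of the configuration; hypothesis (c)
   gives this only for subsets of no larger energy.

   Irrationality of h acts in one form: configurations of equal energy have equal cardinality. So a
   flip always changes the energy, and an inclusion between configurations of equal energy is an
   equality; this settles the trajectories which touch the top level of a plateau exactly. *)
Require Import Defs.
From mathcomp Require Import all_boot all_order all_algebra finmap.
From mathcomp Require Import all_classical all_reals all_analysis.
From mathcomp Require Import ring lra zify.
From Stdlib Require Import Relation_Operators Operators_Properties.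

Set Implicit Arguments.
Unset Strict Implicit.
Unset Printing Implicit Defensive.

Import Order.TTheory GRing.Theory Num.Theory.
Import numFieldNormedType.Exports.

Local Open Scope classical_set_scope.
Local Open Scope ring_scope.

(* A finite box with its boundary condition: when h = 0, an isolated plus at x
   costs field x. *)
Record lattice (c : nat) := Lattice {
  site :> finType;
  adj : rel site;
  dist : site -> site -> nat;
  field : site -> int;
  adjC : symmetric adj;
  adjxx : irreflexive adj;
  adj_deg : forall x, (#|[set y | adj x y]%SET| <= c)%N;
  field_le : forall x, (`|field x| <= c)%N;
  distC : forall x y, dist x y = dist y x;
  distxx : forall x, dist x x = 0%N;
  dist_tri : forall x y z, (dist x z <= dist x y + dist y z)%N;
  adj_dist : forall x y, adj x y -> (dist x y <= 1)%N }.

(** * Energy of a configuration *)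

Section Energy.
(* Here and below, so that set0, setUC, etc. denote the notions of finset rather
   than those of classical_sets. *)
Import mathcomp.boot.fintype mathcomp.boot.finset.
Context (R : realType) (h : R) (c : nat) (V : lattice c).
Implicit Types (s t : {set V}) (x y : V).

Definition nbr s x := #|[set y in s | adj x y]%SET|.
(** Ordered pairs are counted, so an edge contributes 2: this is what two adjacent pluses save
    compared with two isolated ones. *)
Definition bonds s := (\sum_(x in s) nbr s x)%N.
Definition bulk s : int := \sum_(x in s) field x - (bonds s)%:Z.
Definition energy s : R := (bulk s)%:~R - h * #|s|%:R.
Definition gap s x : R := (field x)%:~R - h - 2 * (nbr s x)%:R.
Definition flipx s x := if x \in s then (s :\ x)%SET else (x |: s)%SET.

Lemma nbrS s t x : s \subset t -> (nbr s x <= nbr t x)%N.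
Proof.
move=> st; apply: subset_leq_card; apply/subsetP => y; rewrite !inE => /andP[ys ->].
by rewrite (subsetP st).
Qed.

Lemma nbr_le s x : (nbr s x <= c)%N.
Proof.
apply: leq_trans (adj_deg x); apply: subset_leq_card; apply/subsetP => y.
by rewrite !inE => /andP[_ ->].
Qed.

Lemma nbrU1 s x : nbr (x |: s)%SET x = nbr s x.
Proof.
apply: eq_card => y; rewrite !inE; case: eqP => [->|//].
by rewrite adjxx !andbF.
Qed.

Lemma nbrE s x : nbr s x = (\sum_y ((y \in s) && adj x y))%N.
Proof.
rewrite /nbr -sum1_card big_mkcond /=; apply: eq_bigr => y _.
by rewrite !inE; case: (_ && _).
Qed.

Lemma bondsE s : bonds s = (\sum_x \sum_y [&& x \in s, y \in s & adj x y])%N.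
Proof.
rewrite /bonds big_mkcond /=; apply: eq_bigr => x _; rewrite nbrE.
by case: (x \in s) => //; rewrite big1.
Qed.

Lemma bondsU1 s x : x \notin s -> (bonds (x |: s)%SET = bonds s + 2 * nbr s x)%N.
Proof.
move=> xs; rewrite /bonds big_setU1 //= nbrU1 mul2n -addnn addnA [RHS]addnC; congr addn.
have -> : nbr s x = (\sum_(y in s) adj x y)%N.
  by rewrite nbrE [RHS]big_mkcond; apply: eq_bigr => y _; case: (y \in s).
rewrite -big_split /=; apply: eq_bigr => y ys.
rewrite !nbrE (bigD1 x) //= [in RHS](bigD1 x) //= (negPf xs) add0n setU11 /= addnC adjC.
congr addn; apply: eq_bigr => z zx; by rewrite !inE (negPf zx).
Qed.

Lemma energyU1 s x : x \notin s -> energy (x |: s)%SET = energy s + gap s x.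
Proof.
move=> xs; rewrite /energy /gap /bulk bondsU1 // big_setU1 //= cardsU1 xs.
rewrite !(rmorphB, rmorphD, rmorphM, natrD, natrM, PoszD, PoszM) /=.
ring.
Qed.

Lemma gapU1 s x : gap (x |: s)%SET x = gap s x.
Proof. by rewrite /gap nbrU1. Qed.

Lemma gapD1 s x : gap (s :\ x)%SET x = gap s x.
Proof.
case: (boolP (x \in s)) => xs; last by congr gap; apply/setDidPl; rewrite disjoint_sym disjoints1.
by rewrite -{2}(setD1K xs) gapU1.
Qed.

Lemma energyD1 s x : x \in s -> energy (s :\ x)%SET = energy s - gap s x.
Proof.
move=> xs; rewrite -{2}(setD1K xs) energyU1 ?setD11 // gapD1; ring.
Qed.

Lemma energy_flip s x :
  energy (flipx s x) = energy s + (if x \in s then - gap s x else gap s x).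
Proof.
rewrite /flipx; case: ifPn => xs; first exact: energyD1.
exact: energyU1.
Qed.

Lemma flipxK x : involutive (flipx^~ x).
Proof.
move=> s; rewrite /flipx; case: (boolP (x \in s)) => xs; first by rewrite setD11 setD1K.
by rewrite setU11 setU1K.
Qed.

Lemma energy0 : energy set0 = 0.
Proof. by rewrite /energy /bulk /bonds !big_set0 cards0 mulr0 !subr0. Qed.

(** The interaction is ferromagnetic. Fields and cardinalities are modular; a pair contained in s or
    in t is contained in the union, and in the intersection as well if it is contained in both. *)
Lemma energy_submod s t :
  energy (s :&: t)%SET + energy (s :|: t)%SET <= energy s + energy t.
Proof.
have Hf : \sum_(x in (s :&: t)%SET) field x + \sum_(x in (s :|: t)%SET) field x =
  \sum_(x in s) field x + \sum_(x in t) field x :> int.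
  rewrite !(big_mkcond (fun x => x \in _)) /= -!big_split /=; apply: eq_bigr => x _.
  by rewrite !inE; case: (x \in s); case: (x \in t); rewrite ?addr0 ?add0r.
have Hc : #|(s :&: t)%SET|%:R + #|(s :|: t)%SET|%:R = #|s|%:R + #|t|%:R :> R.
  by rewrite -!natrD addnC cardsUI.
have Hb : (bonds s + bonds t <= bonds (s :&: t)%SET + bonds (s :|: t)%SET)%N.
  rewrite !bondsE -!big_split /=; apply: leq_sum => x _.
  rewrite -!big_split /=; apply: leq_sum => y _; rewrite !inE.
  by case: (x \in s); case: (x \in t); case: (y \in s); case: (y \in t); case: (adj x y).
have Hi : bulk (s :&: t)%SET + bulk (s :|: t)%SET <= bulk s + bulk t.
  by rewrite /bulk; lia.
have : (bulk (s :&: t)%SET)%:~R + (bulk (s :|: t)%SET)%:~R <=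
       (bulk s)%:~R + (bulk t)%:~R :> R by rewrite -!rmorphD ler_int.
rewrite /energy; have := congr1 (fun z => h * z) Hc; rewrite /= !mulrDr; lra.
Qed.

Lemma bulk_le s n : (#|s| <= n)%N -> (`|bulk s| <= 2 * c * n)%N.
Proof.
move=> sn.
have H1 : (absz (\sum_(x in s) field x)%R <= c * n)%N.
  apply: (@leq_trans (\sum_(x in s) c)%N); last by rewrite sum_nat_const mulnC leq_mul2l sn orbT.
  apply: (big_ind2 (fun (u : int) (w : nat) => (`|u| <= w)%N)) => //; last by move=> x _; exact: field_le.
  by move=> x1 x2 y1 y2 H1 H2; lia.
have H2 : (bonds s <= c * n)%N.
  apply: (@leq_trans (\sum_(x in s) c)%N); last by rewrite sum_nat_const mulnC leq_mul2l sn orbT.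
  by apply: leq_sum => x _; exact: nbr_le.
by rewrite /bulk; lia.
Qed.

Lemma irr_lin (a b : int) : irrational h -> a%:~R = h * b%:~R -> b = 0.
Proof.
move=> hi e; apply/eqP/negPn/negP => b0; apply: hi.
rewrite /rational /=; exists (a%:Q / b%:Q) => //.
by rewrite fmorph_div /= !ratr_int e mulfK // intr_eq0.
Qed.

(** Otherwise h would be the quotient of the difference of the integers [bulk] by the difference of
    the cardinalities. *)
Lemma energy_card s t : irrational h -> energy s = energy t -> #|s| = #|t|.
Proof.
move=> hi; rewrite /energy => e.
have : (#|s|%:Z - #|t|%:Z)%R = 0.
  apply: (@irr_lin (bulk s - bulk t)) => //.
  by move: (bulk s) (bulk t) e => cs ct e; rewrite !rmorphB /= -!pmulrn; lra.
by move/eqP; rewrite subr_eq0 => /eqP [].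
Qed.

Lemma flip_energy_neq s x : irrational h -> energy (flipx s x) <> energy s.
Proof.
move=> hi /(energy_card hi); rewrite /flipx; case: ifPn => xs.
  by rewrite (cardsD1 x s) xs; lia.
by rewrite cardsU1 xs; lia.
Qed.

End Energy.

(** Only finitely many values occur; [delta] is the least nonzero modulus among them, capped by 1.
    It depends on h and n alone, so one value serves all volumes. *)
Lemma energy_gap (R : realType) (h : R) (n : nat) :
  exists2 delta : R, 0 < delta & forall a b : int, (`|a| <= n)%N -> (`|b| <= n)%N ->
    a%:~R - h * b%:~R <> 0 -> delta <= `|a%:~R - h * b%:~R|.
Proof.
pose f (p : 'I_(n.*2.+1) * 'I_(n.*2.+1)) : R :=
  (p.1%:Z - n%:Z)%:~R - h * (p.2%:Z - n%:Z)%:~R.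
pose d := \big[Num.min/1]_(p | f p != 0) `|f p|.
exists d.
  rewrite /d; elim/big_ind: _ => // [x y x0 y0|p p0]; first by rewrite lt_min x0.
  by rewrite normr_gt0.
move=> a b an bn /eqP ab0.
have Ha : (absz (a + n%:Z)%R < n.*2.+1)%N by lia.
have Hb : (absz (b + n%:Z)%R < n.*2.+1)%N by lia.
have fE : f (Ordinal Ha, Ordinal Hb) = a%:~R - h * b%:~R.
  rewrite /f /=; congr (_%:~R - h * _%:~R); lia.
rewrite -fE /d; apply: bigmin_le_cond; by rewrite fE.
Qed.

(* A finite probability space carrying, for every i, an event of probability p i,
   these events being nested. *)
Record coin (R : realType) (I : finType) (p : I -> R) := Coin {
  face :> finType;
  fw : face -> R;
  hit : face -> I -> bool;
  fw_ge0 : forall u, 0 <= fw u;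
  fw_sum : \sum_u fw u = 1;
  fw_hit : forall i, \sum_(u | hit u i) fw u = p i;
  hit_mono : forall u i j, p i <= p j -> hit u i -> hit u j }.

(** A uniform variable on [0, 1] is discretised: the faces are the intervals between consecutive
    values among 0, 1 and the p i, weighted by their lengths, and a face hits i when it lies below p
    i. Nestedness is then automatic. *)
Lemma coin_exists (R : realType) (I : finType) (p : I -> R) :
  (forall i, 0 <= p i <= 1) -> exists _ : coin p, True.
Proof.
move=> hp.
pose r : seq R := sort <=%R (undup [:: 0, 1 & [seq p i | i <- enum I]]).
have r_sorted : sorted <%R r.
  rewrite lt_sorted_uniq_le sort_uniq undup_uniq /=; exact: sort_le_sorted.
have memr z : (z \in r) = (z \in [:: 0, 1 & [seq p i | i <- enum I]]).
  by rewrite mem_sort mem_undup.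
have rle z : z \in r -> 0 <= z <= 1.
  rewrite memr !inE => /or3P[/eqP ->|/eqP ->|/mapP[i _ ->]] //.
  - by rewrite lexx ler01.
  - by rewrite lexx ler01.
have lt_nth i j : (i < size r)%N -> (j < size r)%N -> (r`_i < r`_j) = (i < j)%N.
  by move=> ir jr; rewrite lt_sorted_ltn_nth.
have r0 : r`_0 = 0.
  have H0 : (0 : R) \in r by rewrite memr !inE eqxx.
  have sr : (0 < size r)%N by case: (r) H0 => //; rewrite in_nil.
  apply/eqP; rewrite eq_le; have /andP[-> _] := rle _ (mem_nth 0 sr).
  have i0 : (index (0 : R)%R r < size r)%N by rewrite index_mem.
  rewrite -[leRHS](nth_index 0 H0) leNgt lt_nth //.
have tele i : (i < size r)%N -> \sum_(j < i) (r`_j.+1 - r`_j) = r`_i.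
  move=> ir; rewrite -(big_mkord xpredT (fun j => r`_j.+1 - r`_j)).
  by rewrite telescope_sumr // r0 subr0.
pose n := (size r).-1.
have nS : size r = n.+1 by rewrite /n; case: (r) (memr 0) => //=; rewrite in_nil !inE eqxx.
have hitE z : z \in r -> \sum_(j < n | r`_j < z) (r`_j.+1 - r`_j) = z.
  move=> zr; have iz : (index z r < n.+1)%N by rewrite -nS index_mem.
  rewrite -{2}(nth_index 0 zr) -(tele (index z r)) ?nS //.
  rewrite (big_ord_widen_cond n xpredT (fun j => r`_j.+1 - r`_j)) //.
  apply: eq_bigl => j /=; rewrite -{1}(nth_index 0 zr) lt_nth // ?nS //.
  by rewrite ltnW // ltnS.
unshelve eexists; last by [].
refine (@Coin R I p 'I_n (fun j => r`_j.+1 - r`_j) (fun j i => r`_j < p i) _ _ _ _).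
- move=> j; rewrite subr_ge0 ltW // lt_nth // nS; first by rewrite ltnW // ltnS.
  by rewrite ltnS.
- have H1 : (1 : R) \in r by rewrite memr !inE eqxx orbT.
  rewrite -[RHS](hitE _ H1); apply: esym; apply: eq_bigl => j.
  have jr : (j.+1 < size r)%N by rewrite nS ltnS.
  apply: (@lt_le_trans _ _ r`_j.+1); first by rewrite lt_nth // ltnW.
  by have /andP[] := rle _ (mem_nth 0 jr).
- move=> i; apply: hitE; rewrite memr !inE; apply/orP; right; apply/orP; right.
  by apply: map_f; rewrite mem_enum.
- by move=> u i j pij /lt_le_trans; apply.
Qed.

(** * The lazy chain and its coupling *)

Section Noise.
Import mathcomp.boot.fintype mathcomp.boot.finset.
Context (R : realType) (h beta : R) (c : nat) (V : lattice c).
Implicit Types (s t L : {set V}) (x y : V).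

(** The proposal i.2 at i.1.2 has an acceptance probability even if the spin already has this value:
    the coupling compares one proposal in two configurations which may differ at that site. *)
Definition accept (i : {set V} * V * bool) : R :=
  expR (- beta * Num.max 0 (if i.2 then gap h i.1.1 i.1.2 else - gap h i.1.1 i.1.2)).

Definition rate s x : R :=
  expR (- beta * Num.max 0 (energy h (flipx s x) - energy h s)).

Lemma accept_rate s x : accept (s, x, x \notin s) = rate s x.
Proof.
rewrite /accept /rate energy_flip /=; case: (x \in s) => /=; congr (expR (_ * Num.max _ _)); ring.
Qed.

Context (u0 : coin accept).

(* One step of the lazy chain: a site, a proposed spin (true for plus) and a coin;
   proposals outside L are ignored.  The noise does not depend on L, which couples
   the chains in all volumes. *)
Definition noise : finType := (V * bool * u0)%type.
Definition weight (v : noise) : R := fw v.2 / (2 * #|V|%:R).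
Definition step L (v : noise) s : {set V} :=
  if (v.1.1 \in L) && hit v.2 (s, v.1.1, v.1.2) then
    if v.1.2 then (v.1.1 |: s)%SET else (s :\ v.1.1)%SET
  else s.

Lemma weight_ge0 v : 0 <= weight v.
Proof. by rewrite /weight divr_ge0 ?fw_ge0 // mulr_ge0. Qed.

(** The second term is (2 * #|V|)^-1 times the generator of the continuous-time dynamics in L: the
    lazy chain is its uniformisation, each pair of a site and a spin being proposed with probability
    (2 * #|V|)^-1. *)
Lemma step_mean L s (f : {set V} -> R) : (0 < #|V|)%N ->
  \sum_v weight v * f (step L v s) =
  f s + (2 * #|V|%:R)^-1 * \sum_(x in L) rate s x * (f (flipx s x) - f s).
Proof.
move=> V0; have q0 : (2 * #|V|%:R : R) != 0 by rewrite mulf_neq0 ?pnatr_eq0 // -lt0n.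
transitivity (\sum_x \sum_b \sum_u weight (x, b, u) * f (step L (x, b, u) s)).
  rewrite pair_big /= pair_big /=; apply: eq_bigr => -[[x b] u] _ //.
transitivity (\sum_(x : V) (f s *+ 2 +
     (if x \in L then rate s x * (f (flipx s x) - f s) else 0)) / (2 * #|V|%:R)).
  apply: eq_bigr => x _.
  (* Of the two proposals at x, the present spin changes nothing and the other one attempts the
     flip. *)
  have -> (G : bool -> R) : \sum_b G b = G (x \in s) + G (x \notin s).
    by rewrite big_bool; case: (x \in s); rewrite //= addrC.
  rewrite (eq_bigr (fun u => fw u * (f s / (2 * #|V|%:R)))) => [|u _]; last first.
    rewrite /weight /step /=; have -> : (if x \in s then (x |: s)%SET else (s :\ x)%SET) = s.
      case: ifPn => xs; first by apply/setUidPr; rewrite sub1set.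
      by apply/setDidPl; rewrite disjoint_sym disjoints1.
    by rewrite if_same mulrAC -mulrA.
  rewrite -mulr_suml fw_sum mul1r.
  have flipE : (if x \notin s then (x |: s)%SET else (s :\ x)%SET) = flipx s x.
    by rewrite /flipx; case: (x \in s).
  rewrite (eq_bigr (fun u => fw u * (f s / (2 * #|V|%:R)) +
     (if (x \in L) && hit u (s, x, x \notin s) then fw u else 0) *
       ((f (flipx s x) - f s) / (2 * #|V|%:R)))) => [|u _]; last first.
    rewrite /weight /step /= flipE; case: ifP => _; by ring.
  rewrite big_split /= -!mulr_suml fw_sum mul1r -big_mkcond /=.
  case: ifP => xL; last by rewrite big_pred0_eq; ring.
  by rewrite /= fw_hit accept_rate; ring.
rewrite -mulr_suml big_split /= -big_mkcond /= sumr_const.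
have -> : f s *+ 2 *+ #|[pred _ : V | true]| = f s * (2 * #|V|%:R).
  by rewrite -mulrnA -[LHS]mulr_natr natrM.
by rewrite mulrDl mulfK // [X in _ + X]mulrC.
Qed.

Lemma weight_sum : (0 < #|V|)%N -> \sum_v weight v = 1.
Proof.
move=> V0; have := step_mean finset.set0 finset.set0 (fun _ => 1) V0.
rewrite big_set0 mulr0 addr0 => <-; by apply: eq_bigr => v _; rewrite mulr1.
Qed.

End Noise.

(** * Finite sequences of independent noises *)

Section Sequences.
Context (R : realType) (N : finType) (w : N -> R).
Hypotheses (w_ge0 : forall v, 0 <= w v) (w_sum : \sum_v w v = 1).

Fixpoint mean k (F : seq N -> R) : R :=
  if k is k'.+1 then \sum_v w v * mean k' (fun s => F (v :: s)) else F [::].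

Definition prob k (E : seq N -> Prop) : R := mean k (fun s => (`[< E s >])%:R).

Lemma mean_le k (F G : seq N -> R) :
  (forall s, size s = k -> F s <= G s) -> mean k F <= mean k G.
Proof.
elim: k F G => [|k IH] F G FG /=; first exact: FG.
apply: ler_sum => v _; rewrite ler_wpM2l //; apply: IH => s sk.
by apply: FG; rewrite /= sk.
Qed.

Lemma mean_cst k a : mean k (fun=> a) = a.
Proof. by elim: k => [//|k IH] /=; rewrite IH -mulr_suml w_sum mul1r. Qed.

Lemma mean_sum k (I : Type) (r : seq I) (F : I -> seq N -> R) :
  mean k (fun s => \sum_(i <- r) F i s) = \sum_(i <- r) mean k (F i).
Proof.
elim: k F => [//|k IH] F /=.
under eq_bigr do rewrite IH mulr_sumr.
by rewrite exchange_big.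
Qed.

Lemma prob_le k (E E' : seq N -> Prop) :
  (forall s, size s = k -> E s -> E' s) -> prob k E <= prob k E'.
Proof.
move=> EE; apply: mean_le => s sk; case: asboolP => [/(EE _ sk) Es|]; last by [].
by rewrite asboolT.
Qed.

Lemma prob_ge0 k E : 0 <= prob k E.
Proof. by rewrite -(mean_cst k 0); apply: mean_le. Qed.

Lemma prob_le1 k E : prob k E <= 1.
Proof. by rewrite -(mean_cst k 1); apply: mean_le => s _; case: asbool. Qed.

Lemma prob0 k (E : seq N -> Prop) : (forall s, size s = k -> ~ E s) -> prob k E = 0.
Proof.
move=> nE; apply/eqP; rewrite eq_le prob_ge0 andbT -(mean_cst k 0).
by apply: mean_le => s sk; rewrite asboolF //; exact: nE.
Qed.

Lemma prob_union k (I : eqType) (r : seq I) (E : seq N -> Prop) (F : I -> seq N -> Prop) :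
  (forall s, size s = k -> E s -> exists2 i, i \in r & F i s) ->
  prob k E <= \sum_(i <- r) prob k (F i).
Proof.
move=> EF; rewrite /prob -(mean_sum k r (fun i s => (`[< F i s >])%:R)).
apply: mean_le => s sk; case: asboolP => [/(EF _ sk)[i ir Fi]|_]; last exact: sumr_ge0.
rewrite (big_rem i) //= asboolT // -{1}[1]addr0 lerD2l.
exact: sumr_ge0.
Qed.

Lemma prob_or k (E E1 E2 : seq N -> Prop) :
  (forall s, size s = k -> E s -> E1 s \/ E2 s) ->
  prob k E <= prob k E1 + prob k E2.
Proof.
move=> EE; have := @prob_union k bool [:: true; false] E (fun b => if b then E1 else E2).
rewrite !big_cons big_nil addr0; apply => s sk /(EE _ sk) [Es|Es].
  by exists true.
by exists false.
Qed.

Context (S : Type) (f : N -> S -> S).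

Definition traj (a : S) (s : seq N) (i : nat) : S := foldl (fun t v => f v t) a (take i s).

Lemma traj0 a s : traj a s 0 = a.
Proof. by rewrite /traj take0. Qed.

Lemma trajS v a s i : traj a (v :: s) i.+1 = traj (f v a) s i.
Proof. by []. Qed.

Lemma traj_drop a s i j : traj a s (i + j) = traj (traj a s i) (drop i s) j.
Proof.
elim: i a s => [|i IH] a s; first by rewrite traj0 drop0.
case: s => [|v s]; last by rewrite addSn !trajS IH.
by rewrite /traj !take_oversize.
Qed.

Lemma traj_take a s i j : (i <= j)%N -> traj a (take j s) i = traj a s i.
Proof. by move=> ij; rewrite /traj take_takel. Qed.

Lemma traj_step a s i : (i < size s)%N -> exists v, traj a s i.+1 = f v (traj a s i).
Proof.
move=> si; have v0 : N by case: s si => [|v s].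
exists (nth v0 s i); rewrite /traj (take_nth v0) // -cats1 foldl_cat //.
Qed.

Lemma prob_markov (P : S -> seq N -> Prop) e i k a :
  (forall b, prob k (P b) <= e) ->
  prob (i + k) (fun s => P (traj a s i) (drop i s)) <= e.
Proof.
move=> Pe; elim: i a => [|i IH] a.
  apply: le_trans (Pe a); apply: prob_le => s _; by rewrite traj0 drop0.
rewrite addSn /prob /=; apply: (@le_trans _ _ (\sum_v w v * e)).
  by apply: ler_sum => v _; rewrite ler_wpM2l //; apply: le_trans (IH (f v a)).
by rewrite -mulr_suml w_sum mul1r.
Qed.

Lemma mean_take i k (F : seq N -> R) :
  mean (i + k) (fun s => F (take i s)) = mean i F.
Proof.
elim: i F => [|i IH] F; first by under eq_fun do rewrite take0; rewrite mean_cst.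
by rewrite addSn /=; apply: eq_bigr => v _; rewrite -IH.
Qed.

Lemma prob_take i k (E : seq N -> Prop) :
  (i <= k)%N -> prob k (fun s => E (take i s)) = prob i E.
Proof. by move=> ik; rewrite -(subnKC ik) /prob -(mean_take i (k - i)). Qed.

End Sequences.

(** * Space-time clusters in discrete time *)

Section SpaceTime.
Import mathcomp.boot.fintype mathcomp.boot.finset.
Context (c : nat) (V : lattice c).
Implicit Types (om : nat -> {set V}) (p q r : V * nat) (A : {set V}).

Definition pt a b om p := [&& (a <= p.2)%N, (p.2 <= b)%N & p.1 \in om p.2].

Definition link a b om p q :=
  [&& pt a b om p, pt a b om q &
    ((p.2 == q.2) && adj p.1 q.1) ||
    ((p.1 == q.1) && ((q.2 == p.2.+1) || (p.2 == q.2.+1)))].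

Inductive conn a b om p : V * nat -> Prop :=
| conn_refl : pt a b om p -> conn a b om p p
| conn_step q r : conn a b om p q -> link a b om q r -> conn a b om p r.

Lemma link_sym a b om p q : link a b om p q = link a b om q p.
Proof.
rewrite /link; case: (pt a b om p) => //=; last by rewrite andbF.
case: (pt a b om q) => //=.
by rewrite (eq_sym p.2 q.2) (eq_sym p.1) adjC [X in _ || (_ && X)]orbC.
Qed.

Lemma link_dist a b om p q : link a b om p q -> (dist p.1 q.1 <= 1)%N.
Proof.
case/and3P => _ _ /orP[/andP[_ /adj_dist //]|/andP[/eqP -> _]].
by rewrite distxx.
Qed.

Lemma conn_ptr a b om p q : conn a b om p q -> pt a b om q.
Proof. by case => // q' r _ /and3P[]. Qed.

Lemma conn_trans a b om p q r : conn a b om p q -> conn a b om q r -> conn a b om p r.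
Proof. by move=> pq; elim=> // q' r' _ IH; exact: conn_step. Qed.

Lemma conn_sym a b om p q : conn a b om p q -> conn a b om q p.
Proof.
elim=> [pp|q' r pq IH qr]; first exact: conn_refl.
have /and3P[_ rr _] := qr.
apply: conn_trans IH; apply: (conn_step (conn_refl rr)); by rewrite link_sym.
Qed.

Lemma conn_ptl a b om p q : conn a b om p q -> pt a b om p.
Proof. by move/conn_sym/conn_ptr. Qed.

Lemma link_sub a b a' b' om om' p q :
  pt a' b' om' p -> pt a' b' om' q -> link a b om p q -> link a' b' om' p q.
Proof. by move=> pp qq /and3P[_ _ pq]; apply/and3P. Qed.

Lemma conn_sub a b a' b' om om' p q :
  (forall r, pt a b om r -> pt a' b' om' r) -> conn a b om p q -> conn a' b' om' p q.
Proof.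
move=> sub; elim=> [pp|q' r pq IH qr]; first exact: conn_refl (sub _ pp).
have /and3P[Hq Hr _] := qr.
by apply: (conn_step IH); apply: link_sub qr; exact: sub.
Qed.

Definition bounded l a b om := forall p q, conn a b om p q -> (dist p.1 q.1 <= l)%N.

Lemma bounded_le l l' a b om : (l <= l')%N -> bounded l a b om -> bounded l' a b om.
Proof. by move=> ll bl p q /bl /leq_trans; apply. Qed.

Lemma bounded_sub l a b a' b' om om' :
  (forall r, pt a b om r -> pt a' b' om' r) -> bounded l a' b' om' -> bounded l a b om.
Proof. by move=> sub bl p q /(conn_sub sub) /bl. Qed.

(* Following a cluster, one moves between sites of A at mutual distance at most
   2 l + 1; a self-avoiding such walk makes fewer than n moves. *)
Lemma conn_net A n l a b om p q : (#|A| <= n)%N ->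
  (forall r, conn a b om p r -> exists2 z, z \in A & (dist r.1 z <= l)%N) ->
  conn a b om p q -> (dist p.1 q.1 <= n * (2 * l + 1))%N.
Proof.
move=> An near pq.
pose e := [rel z z' : V | [&& z \in A, z' \in A & (dist z z' <= 2 * l + 1)%N]].
have [z0 z0A pz0] := near _ (conn_refl (conn_ptl pq)).
have H r : conn a b om p r -> forall z, z \in A -> (dist r.1 z <= l)%N -> connect e z0 z.
  elim=> [_ z zA pz|r' r'' pr' IH r'r'' z zA r''z].
    apply: connect1; rewrite /= z0A zA /=.
    by have := dist_tri z0 p.1 z; rewrite (distC z0 p.1); lia.
  have [z' z'A r'z'] := near _ pr'.
  apply: (connect_trans (IH _ z'A r'z')); apply: connect1; rewrite /= z'A zA /=.
  have := dist_tri z' r'.1 z; rewrite (distC z' r'.1); have := dist_tri r'.1 r''.1 z.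
  have := link_dist r'r''; lia.
have [z zA qz] := near _ pq.
have /connectP[s0 es0 zE] := H _ pq _ zA qz.
case/shortenP: es0 zE => s es us _ zE.
have sA : (size s < n)%N.
  apply: leq_trans An; have -> : (size s).+1 = size (z0 :: s) by [].
  rewrite cardE; apply: uniq_leq_size => // y; rewrite inE mem_enum => /orP[/eqP -> //|ys].
  by case/splitPr: ys es => s1 s2; rewrite cat_path => /and3P[_ /and3P[_ yA _] _].
have ds : (dist z0 (last z0 s) <= size s * (2 * l + 1))%N.
  elim: s (z0) es {us sA zE} => [|y s IH] x /=; first by rewrite distxx.
  case/andP=> /and3P[_ _ xy] /IH ys; have := dist_tri x y (last y s).
  by rewrite mulSn => H1; rewrite (leq_trans H1) // leq_add.
rewrite -zE in ds.
have := dist_tri p.1 z0 q.1; have := dist_tri z0 z q.1; rewrite (distC z q.1).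
have : (size s * (2 * l + 1) + (2 * l + 1) <= n * (2 * l + 1))%N by rewrite -mulSnr leq_mul2r sA orbT.
lia.
Qed.

(** A cluster not contained in one side crosses from time k to k.+1 at a site of [om k]. Each of its
    points either lies on one side with such a crossing, hence within l of [om k], or is on the same
    side as both p and q; [conn_net] applies with the net [om k]. *)
Lemma bounded_glue l n a b k om : bounded l a k om -> bounded l k.+1 b om ->
  (#|om k| <= n)%N -> bounded (n * (2 * l + 1) + l) a b om.
Proof.
move=> b1 b2 omn p q pq.
pose side p q := conn a k om p q \/ conn k.+1 b om p q.
have side_dist p' q' : side p' q' -> (dist p'.1 q'.1 <= l)%N by case=> [/b1|/b2].
have side_sym p' q' : side p' q' -> side q' p' by case=> /conn_sym; [left|right].
have side_trans p' q' r' : side p' q' -> side q' r' -> side p' r'.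
  case=> [pq1|pq1] [qr1|qr1]; [left|exfalso|exfalso|right]; try exact: conn_trans qr1.
    by case/and3P: (conn_ptr pq1) => *; case/and3P: (conn_ptl qr1) => *; lia.
  by case/and3P: (conn_ptr pq1) => *; case/and3P: (conn_ptl qr1) => *; lia.
have pt_side r : pt a b om r -> side r r.
  case/and3P=> ar rb rr; case: (leqP r.2 k) => rk; [left|right]; apply: conn_refl; exact/and3P.
have lk r1 r2 : link a b om r1 r2 -> side r1 r2 \/ r1.1 \in om k.
  move=> r12; have /and3P[H1 H2 H3] := r12.
  have /and3P[a1 b1' m1] := H1; have /and3P[a2 b2' m2] := H2.
  case: (leqP r1.2 k) => k1; case: (leqP r2.2 k) => k2.
  - have P1 : pt a k om r1 by exact/and3P.
    left; left; apply: (conn_step (conn_refl P1)); apply: link_sub r12 => //; exact/and3P.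
  - right; case/orP: H3 => /andP[/eqP e1 H3]; first by lia.
    by have <- : r1.2 = k by lia.
  - right; case/orP: H3 => /andP[/eqP e1 H3]; first by lia.
    by rewrite e1; have <- : r2.2 = k by lia.
  - have P1 : pt k.+1 b om r1 by exact/and3P.
    left; right; apply: (conn_step (conn_refl P1)); apply: link_sub r12 => //; exact/and3P.
have cross r r' : conn a b om r r' ->
    side r r' \/ exists2 z, z \in om k & (dist r.1 z <= l)%N.
  elim=> [/pt_side|r1 r2 _ [IH|IH] r12]; [by left| |by right].
  case: (lk _ _ r12) => H; first by left; exact: side_trans H.
  by right; exists r1.1 => //; exact: side_dist.
case: (cross _ _ pq) => [/side_dist H|_]; first by rewrite (leq_trans H) // leq_addl.
have [spq|nspq] := pselect (side p q); first by rewrite (leq_trans (side_dist _ _ spq)) // leq_addl.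
apply: (@leq_trans (n * (2 * l + 1))); last exact: leq_addr.
apply: (conn_net omn _ pq) => r pr.
case: (cross _ _ (conn_sym pr)) => // rp.
case: (cross _ _ (conn_trans (conn_sym pr) pq)) => // rq.
by case: nspq; apply: side_trans rq; exact: side_sym.
Qed.

(* Contamination by A from time a on, transmitted within a time slice and
   forward in time only: what is not contaminated has evolved independently of A. *)
Inductive tainted A om a : V -> nat -> Prop :=
| taint_src x i : (a <= i)%N -> x \in A -> x \in om i -> tainted A om a x i
| taint_adj x y i : tainted A om a x i -> y \in om i -> adj x y -> tainted A om a y i
| taint_next x i : tainted A om a x i -> x \in om i.+1 -> tainted A om a x i.+1.

Lemma tainted_ge A om a x i : tainted A om a x i -> (a <= i)%N.
Proof. by elim=> // *; exact: leqW. Qed.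

Lemma tainted_mem A om a x i : tainted A om a x i -> x \in om i.
Proof. by case. Qed.

Section Anchor.
Context (A : {set V}) (n l a b : nat) (om : nat -> {set V}) (th : nat -> nat -> {set V}).
Hypotheses (omn : forall i, (a <= i <= b)%N -> (#|om i| <= n)%N) (An : (#|A| <= n)%N).
Hypothesis pure : forall s x i, (a <= s <= i)%N -> (i <= b)%N -> x \in om i ->
  ~ tainted A om s x i -> x \in th s i.
Hypothesis th_bounded : forall s, (a <= s <= b)%N -> bounded l s b (th s).

Lemma slice_dist i p q : (a <= i <= b)%N -> conn i i om p q -> (dist p.1 q.1 <= n)%N.
Proof.
move=> iab pq; have -> : n = (n * (2 * 0 + 1))%N by rewrite muln0 add0n muln1.
apply: (conn_net (omn iab) _ pq) => r /conn_ptr /and3P[ir ri ror].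
by exists r.1; rewrite ?distxx //; have <- : r.2 = i by apply/eqP; rewrite eqn_leq ri.
Qed.

(** A point which is no longer contaminated when the starting time moves from s to s.+1 was reached
    from A inside the slice s, and afterwards only through points which are pure from s.+1 on, hence
    inside a single cluster of [th s.+1]. *)
Lemma taint_split s x i : (a <= s)%N -> (i <= b)%N -> tainted A om s x i ->
  tainted A om s.+1 x i \/ exists z0 z, [/\ z0 \in A, conn s s om (z0, s) (z, s) &
    (x, i) = (z, s) \/ conn s.+1 b (th s.+1) (z, s.+1) (x, i)].
Proof.
move=> as_ + tx; have pure' y j : (s < j)%N -> (j <= b)%N -> y \in om j ->
    ~ tainted A om s.+1 y j -> pt s.+1 b (th s.+1) (y, j).
  move=> sj jb yj nt; apply/and3P; split => //=; apply: pure => //.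
  by rewrite sj leqW.
have ptS y : y \in om s -> pt s s om (y, s) by move=> ys; rewrite /pt /= leqnn ys.
elim: tx => {x i} [x i si xA xi|x y i tx IH yi xy|x i tx IH xi] ib.
- move: si; rewrite leq_eqVlt => /orP[/eqP e|si]; last by left; exact: taint_src.
  by right; exists x, x; subst i; split => //; [exact: conn_refl (ptS _ xi)|left].
- have [|ny] := pselect (tainted A om s.+1 y i); first by left.
  case: (IH ib) => [H|[z0 [z [z0A c1 H]]]]; first by left; exact: taint_adj xy.
  right; case: H => [[? ?]|H]; subst.
    exists z0, y; split => //; last by left.
    apply: (conn_step c1); rewrite /link /= (ptS _ (tainted_mem tx)) (ptS _ yi) /= eqxx xy //.
  have si : (s < i)%N by case/and3P: (conn_ptr H).
  exists z0, z; split => //; right; apply: (conn_step H).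
  rewrite /link (conn_ptr H) pure' //= eqxx xy //.
- have [|nx] := pselect (tainted A om s.+1 x i.+1); first by left.
  case: (IH (ltnW ib)) => [H|[z0 [z [z0A c1 H]]]]; first by left; exact: taint_next.
  right; case: H => [[? ?]|H]; subst.
    by exists z0, z; split => //; right; apply: conn_refl; exact: pure'.
  have si : (s < i)%N by case/and3P: (conn_ptr H).
  exists z0, z; split => //; right; apply: (conn_step H).
  by rewrite /link (conn_ptr H) pure' //= ?eqxx ?orbT // leqW.
Qed.

(* Look at the last time of contamination. *)
Lemma tainted_near x i : (i <= b)%N -> tainted A om a x i ->
  exists2 z, z \in A & (dist x z <= l + n)%N.
Proof.
move=> ib tx.
have ex : exists s, `[< (a <= s)%N /\ tainted A om s x i >] by exists a; exact/asboolP.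
have ub s : `[< (a <= s)%N /\ tainted A om s x i >] -> (s <= i)%N.
  by move/asboolP => [_ /tainted_ge].
case: (ex_maxnP ex ub) => s /asboolP[as_ ts] smax.
case: (taint_split as_ ib ts) => [ts1|[z0 [z [z0A zz H]]]].
  by have := smax s.+1; rewrite ltnn; have -> : `[< (a <= s.+1)%N /\ tainted A om s.+1 x i >];
     [apply/asboolP; rewrite leqW | move/(_ isT)].
have si := tainted_ge ts.
exists z0 => //.
have := slice_dist _ zz; rewrite as_ (leq_trans si ib) => /(_ isT) /= d1.
case: H => [[-> _]|H]; first by rewrite distC; lia.
have := th_bounded _ H; case/and3P: (conn_ptr H) => /= sS _ _.
rewrite (leq_trans sS ib) (leqW as_) => /(_ isT) /= d2.
by have := dist_tri x z z0; rewrite (distC x z) (distC z z0); lia.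
Qed.

(** Follow a cluster until its first contaminated point. Before it, one stays in a cluster of
    [th a], of diameter at most l; the next link costs 1 and [tainted_near] costs l + n. So either p
    and q lie in one cluster of [th a], or every point is within 2 * l + n + 1 of A and [conn_net]
    applies. *)
Lemma bounded_anchor : bounded (n * (2 * (2 * l + n + 1) + 1) + l) a b om.
Proof.
move=> p q pq.
have Y r r' : conn a b om r r' -> conn a b (th a) r r' \/
    exists2 z, z \in A & (dist r.1 z <= 2 * l + n + 1)%N.
  have pt_th t : pt a b om t -> ~ tainted A om a t.1 t.2 -> pt a b (th a) t.
    by case/and3P=> at_ tb tt nt; apply/and3P; split => //; apply: pure; rewrite ?leqnn.
  move=> rr; have /and3P[ar rb rr0] := conn_ptl rr.
  have ab : (a <= a <= b)%N by rewrite leqnn (leq_trans ar).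
  have [tr|nr] := pselect (tainted A om a r.1 r.2).
    by right; have [z zA zd] := tainted_near rb tr; exists z => //; lia.
  elim: rr => [H|r1 r2 _ [IH|IH] r12]; [|  |by right].
    by left; apply: conn_refl; exact: pt_th.
  have [t2|n2] := pselect (tainted A om a r2.1 r2.2).
    right; have /and3P[_ /and3P[_ r2b _] _] := r12.
    have [z zA zd] := tainted_near r2b t2; exists z => //.
    have := th_bounded ab IH; have := link_dist r12.
    by have := dist_tri r.1 r1.1 z; have := dist_tri r1.1 r2.1 z; lia.
  left; apply: (conn_step IH); apply: (link_sub _ _ r12); first exact: conn_ptr IH.
  by apply: pt_th => //; have /and3P[] := r12.
have /and3P[ap pb _] := conn_ptl pq.
have ab : (a <= a <= b)%N by rewrite leqnn (leq_trans ap).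
have [spq|nspq] := pselect (conn a b (th a) p q).
  by rewrite (leq_trans (th_bounded ab spq)) // leq_addl.
apply: (@leq_trans (n * (2 * (2 * l + n + 1) + 1))); last exact: leq_addr.
apply: (conn_net An _ pq) => r pr.
case: (Y _ _ (conn_sym pr)) => // rp.
case: (Y _ _ (conn_trans (conn_sym pr) pq)) => // rq.
by case: nspq; apply: conn_trans rq; exact: conn_sym.
Qed.

End Anchor.
End SpaceTime.

(** * The energy landscape of safe configurations *)

Section Landscape.
Import mathcomp.boot.fintype mathcomp.boot.finset.
Context (R : realType) (h : R) (c : nat) (V : lattice c) (n : nat).
Implicit Types (s t w A : {set V}) (x y z : V) (E : R).

Definition safe s := (#|s| <= n)%N &&
  [forall t : {set V}, (t \subset s) && (t != set0) ==> (0 < energy h t)].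
Definition alive s := safe s && (s != set0).

Lemma safe_card s : safe s -> (#|s| <= n)%N.
Proof. by case/andP. Qed.

Lemma safe_sub s t : t \subset s -> safe s -> safe t.
Proof.
move=> ts /andP[sn /forallP sp]; apply/andP; split.
  exact: leq_trans (subset_leq_card ts) sn.
apply/forallP => r; apply/implyP => /andP[rt r0]; have /implyP := sp r; apply.
by rewrite r0 (subset_trans rt).
Qed.

Lemma alive_safe s : alive s -> safe s. Proof. by case/andP. Qed.
Lemma alive_neq0 s : alive s -> s != set0. Proof. by case/andP. Qed.
Lemma alive_gt0 s : alive s -> 0 < energy h s.
Proof. by case/andP=> /andP[_ /forallP /(_ s)]; rewrite subxx /= => /implyP. Qed.
Lemma alive_card s : alive s -> (#|s| <= n.+1)%N.
Proof. by move/alive_safe/safe_card/leqW. Qed.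

Lemma flipx_card s x m : (#|s| <= m)%N -> (#|flipx s x| <= m.+1)%N.
Proof.
rewrite /flipx => sm; case: ifP => xs; last by rewrite cardsU1 xs.
by rewrite leqW // (leq_trans _ sm) // subset_leq_card // subsetDl.
Qed.

Context (L : {set V}).

Definition nb s t := [exists x in L, t == flipx s x].

Lemma nbP s t : reflect (exists2 x, x \in L & t = flipx s x) (nb s t).
Proof.
apply: (iffP existsP) => [[x /andP[xL /eqP ->]]|[x xL ->]]; exists x => //.
by rewrite xL eqxx.
Qed.

Lemma nb_sym s t : nb s t = nb t s.
Proof. by apply/nbP/nbP => -[x xL ->]; exists x; rewrite ?flipxK. Qed.

Lemma nb_sub s t : nb s t -> s \subset L -> t \subset L.
Proof.
case/nbP => x xL -> sL; rewrite /flipx; case: ifP => _.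
  by rewrite (subset_trans _ sL) // subsetDl.
by rewrite subUset sL sub1set xL.
Qed.

(** Only the source must be alive, so that a path may end at a dead configuration, empty or
    unsafe. *)
Definition hop E := [rel s t | [&& alive s, nb s t, energy h s <= E & energy h t <= E]].
Definition reach E s := (energy h s <= E) && [exists t, ~~ alive t && connect (hop E) s t].

Lemma reach_energy E s : reach E s -> energy h s <= E. Proof. by case/andP. Qed.

Lemma reach_dead E s : ~~ alive s -> energy h s <= E -> reach E s.
Proof. by move=> ds sE; rewrite /reach sE; apply/existsP; exists s; rewrite ds connect0. Qed.

Lemma reach_hop E s t : alive s -> nb s t -> energy h s <= E -> reach E t -> reach E s.
Proof.
move=> als st sE /andP[tE /existsP[r /andP[dr tr]]]; rewrite /reach sE.
apply/existsP; exists r; rewrite dr; apply: connect_trans tr; apply: connect1.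
by rewrite /= als st sE.
Qed.

Lemma reach_le E E' s : E <= E' -> reach E s -> reach E' s.
Proof.
move=> EE /andP[sE /existsP[t /andP[dt st]]]; rewrite /reach (le_trans sE EE).
apply/existsP; exists t; rewrite dt /=; apply: connect_sub st => x y /= /and4P[ax xy xE yE].
by apply: connect1; rewrite /= ax xy (le_trans xE EE) (le_trans yE EE).
Qed.

Definition highest : {set V} := [arg max_(t > set0 | (#|t| <= n.+1)%N) energy h t]%O.

Lemma highestP t : (#|t| <= n.+1)%N -> energy h t <= energy h highest.
Proof.
rewrite /highest; case: Order.TotalTheory.arg_maxP => [|s _ smax tn]; first by rewrite cards0.
exact: smax.
Qed.

Lemma highest_card : (#|highest| <= n.+1)%N.
Proof. by rewrite /highest; case: Order.TotalTheory.arg_maxP => //; rewrite cards0. Qed.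

(** Pluses are removed one by one until the configuration is dead; no configuration met has more
    than n.+1 pluses. *)
Lemma reach_highest s : s \subset L -> (#|s| <= n.+1)%N -> reach (energy h highest) s.
Proof.
have [m] := ubnP #|s|; elim: m s => // m IH s sm sL sn.
case: (boolP (alive s)) => als; last by apply: reach_dead als _; exact: highestP.
have /set0Pn[x xs] := alive_neq0 als.
have cs : (#|(s :\ x)%SET| < #|s|)%N by rewrite [ltnRHS](cardsD1 x) xs.
apply: (@reach_hop _ _ (s :\ x)%SET) => //; last 2 first.
- exact: highestP.
- apply: IH; first by rewrite (leq_trans cs).
    by rewrite (subset_trans _ sL) // subsetDl.
  by rewrite (leq_trans _ sn) // ltnW.
by apply/nbP; exists x; [exact: (subsetP sL)|rewrite /flipx xs].
Qed.

(* Communication height between s and the configurations which are not alive. *)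
Definition height s : R :=
  energy h [arg min_(t < highest | (#|t| <= n.+1)%N && reach (energy h t) s) energy h t]%O.

(** The minimum runs over the energies of configurations with at most n.+1 pluses, so heights
    inherit the separation of these energies. The bound is n.+1 because a flip of a safe
    configuration may add a plus. *)
Lemma heightP s : s \subset L -> (#|s| <= n.+1)%N ->
  [/\ reach (height s) s, exists2 t : {set V}, (#|t| <= n.+1)%N & height s = energy h t &
      forall t, (#|t| <= n.+1)%N -> reach (energy h t) s -> height s <= energy h t].
Proof.
move=> sL sn; rewrite /height; case: Order.TotalTheory.arg_minP => [|t /andP[tn tr] tmin].
  by rewrite highest_card reach_highest.
split=> //; first by exists t.
by move=> r rn rr; apply: tmin; rewrite rn.
Qed.

Lemma height_hop s t : s \subset L -> alive s -> alive t -> nb s t ->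
  energy h t <= height s -> height t <= height s.
Proof.
move=> sL als alt st te; have tL := nb_sub st sL.
have [rs [r rn hr] _] := heightP sL (alive_card als).
have [_ _ tmin] := heightP tL (alive_card alt).
rewrite hr; apply: tmin => //; rewrite -hr; apply: (@reach_hop _ _ s) => //.
by rewrite nb_sym.
Qed.

Section Level.
Context (E : R).

Definition low := [rel s t | [&& alive s, alive t, nb s t, energy h s < E & energy h t < E]].

(** The well of s below E consists of what [low] connects to s. It gives no access to a dead
    configuration below E, and its bottom has energy at least a. *)
Definition good (a : R) s := [&& alive s, s \subset L, energy h s < E, E <= height s &
  [forall t, connect low s t ==> (a <= energy h t)]].

Lemma good_ge a s : good a s -> a <= energy h s.
Proof. by case/and5P=> _ _ _ _ /forallP/(_ s); rewrite connect0. Qed.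

Lemma good_alive a s : good a s -> alive s. Proof. by case/and5P. Qed.

(** Since [height s] is at least E, nothing dead is reached from s strictly below E. A neighbour t
    below E is therefore alive, has height at least E, and shares the well of s. *)
Lemma good_nb a s t : good a s -> nb s t -> energy h t < E -> good a t.
Proof.
case/and5P=> als sL sE Es /forallP smin st tE.
have tL := nb_sub st sL.
have [rs _ sm] := heightP sL (alive_card als).
have tn : (#|t| <= n.+1)%N.
  by case/nbP: st => x _ ->; apply: flipx_card; exact: safe_card (alive_safe als).
have nreach E' : E' < E -> energy h s <= E' -> (exists2 r : {set V}, (#|r| <= n.+1)%N & E' = energy h r) ->
    ~ reach E' t.
  move=> E'E sE' [r rn e] rt; have := sm r rn; rewrite -e => /(_ (reach_hop als st sE' rt)).
  by rewrite leNgt (lt_le_trans E'E).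
have alt : alive t.
  apply/negPn/negP => dt.
  (* The level to be contradicted is the maximum of the energies of s and t, and [heightP] speaks
     only of levels which are energies; hence the two cases. *)
  case: (leP (energy h s) (energy h t)) => hst.
    by apply: (nreach (energy h t)) => //; [exists t|exact: reach_dead].
  apply: (nreach (energy h s)) => //; first by exists s => //; exact: alive_card.
  by apply: reach_dead => //; exact: ltW.
apply/and5P; split=> //.
  rewrite leNgt; apply/negP => tE'; have [rt [r rn e] _] := heightP tL tn.
  case: (leP (energy h s) (height t)) => hst.
    by apply: (nreach (height t)) => //; exists r.
  apply: (nreach (energy h s)) => //; first by exists s => //; exact: alive_card.
  by apply: reach_le rt; exact: ltW.
apply/forallP => r; apply/implyP => tr; have /implyP := smin r; apply.
by apply: connect_trans tr; apply: connect1; rewrite /= als alt st sE.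
Qed.

Lemma good_connect a s t : good a s -> connect low s t -> good a t.
Proof.
move=> gs /connectP[p]; elim: p s gs => [|r p IH] s gs /=; first by move=> _ ->.
case/andP=> /and5P[_ _ sr _ rE] pr; exact: IH (good_nb gs sr rE) pr.
Qed.

Lemma low_sym s t : connect low s t = connect low t s.
Proof.
rewrite sym_connect_sym // => x y /=; rewrite nb_sym.
by case: (alive x); case: (alive y); case: (nb y x); rewrite //= andbC.
Qed.

Lemma good_ex s : alive s -> s \subset L -> energy h s < E -> E <= height s ->
  exists A, [/\ connect low A s, good (energy h A) s & good (energy h A) A].
Proof.
move=> als sL sE Es.
pose A := [arg min_(t < s | connect low s t) energy h t]%O.
have [sA Amin] : connect low s A /\ forall t, connect low s t -> energy h A <= energy h t.
  by rewrite /A; case: Order.TotalTheory.arg_minP => //; rewrite connect0.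
have gA : good (energy h A) s.
  by apply/and5P; split=> //; apply/forallP => t; apply/implyP; exact: Amin.
exists A; split=> //; last exact: good_connect sA.
by rewrite low_sym.
Qed.

Hypothesis h_irr : irrational h.

(** By [energy_submod], the energies of the union and of the intersection sum to at most energy w +
    energy A, and both are at least energy A. So if one of the two reaches E, then so does w: below
    E, w stays pinned. *)
Definition pinned A w := good (energy h A) (w :|: A)%SET && good (energy h A) (w :&: A)%SET.

(* A is the bottom of its well below level E; when w passes the level E exactly,
   irrationality of h forces it to be comparable with A. *)
Definition anchor A w := good (energy h A) A &&
  (pinned A w || ((energy h w == E) && ((A \subset w) || (w \subset A)))).

Lemma anchor_meets A w : alive w -> anchor A w -> (w :&: A)%SET != set0.
Proof.
move=> aw /andP[gA /orP[/andP[_ /good_alive/alive_neq0 //]|/andP[_ /orP[Aw|wA]]]].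
  by rewrite (setIidPr Aw); exact: alive_neq0 (good_alive gA).
by rewrite (setIidPl wA); exact: alive_neq0.
Qed.

Lemma sub_energy_eq s t : s \subset t -> energy h s = energy h t -> s = t.
Proof. by move=> st e; apply/eqP; rewrite eqEcard st /= (energy_card h_irr e) leqnn. Qed.

Lemma flipxU_in A w x : x \in A -> (flipx w x :|: A = w :|: A)%SET.
Proof.
move=> xA; apply/setP => y; rewrite /flipx; case: ifP => xw; rewrite !inE;
  by case: eqVneq => [->|//]; rewrite xA ?orbT.
Qed.

Lemma flipxI_in A w x : x \in A -> (flipx w x :&: A = flipx (w :&: A) x)%SET.
Proof.
move=> xA; apply/setP => y; rewrite /flipx !inE xA andbT; case: ifP => xw; rewrite !inE;
  by case: eqVneq => [->|//]; rewrite ?xA ?andbT.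
Qed.

Lemma flipxI_out A w x : x \notin A -> (flipx w x :&: A = w :&: A)%SET.
Proof.
move=> /negPf xA; apply/setP => y; rewrite /flipx; case: ifP => xw; rewrite !inE;
  by case: eqVneq => [->|//]; rewrite xA ?andbF.
Qed.

Lemma flipxU_out A w x : x \notin A -> (flipx w x :|: A = flipx (w :|: A) x)%SET.
Proof.
move=> /negPf xA; apply/setP => y; rewrite /flipx !inE xA orbF; case: ifP => xw; rewrite !inE;
  by case: eqVneq => [->|//]; rewrite ?xA ?orbF.
Qed.

(** A flip changes only the intersection if x is in A, only the union otherwise. If the changed set
    stays below E it remains good. If not, submodularity forces w after the flip to have energy E
    exactly and the other set to have the energy of A, hence to equal A: this is comparability. *)
Lemma pinned_flip A w x : x \in L -> good (energy h A) A -> pinned A w ->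
  energy h (flipx w x) <= E -> anchor A (flipx w x).
Proof.
move=> xL gA /andP[gU gI] wE; rewrite /anchor gA /=.
have aU := good_ge gU; have aI := good_ge gI.
have := energy_submod h (flipx w x) A; case: (boolP (x \in A)) => xA.
  rewrite flipxU_in // flipxI_in // /pinned flipxU_in // flipxI_in // gU => sm.
  have [lt|ge] := ltP (energy h (flipx (w :&: A)%SET x)) E.
    by rewrite (good_nb gI) //; apply/nbP; exists x.
  have eU : energy h A = energy h (w :|: A)%SET by lra.
  have eE : energy h (flipx w x) = E by lra.
  rewrite eE eqxx /=; have /setUidPr wA := esym (sub_energy_eq (subsetUr w A) eU).
  apply/orP; right; apply/orP; right; rewrite /flipx; case: ifP => _.
    by rewrite (subset_trans _ wA) // subsetDl.
  by rewrite subUset wA sub1set xA.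
rewrite flipxU_out // flipxI_out // /pinned flipxU_out // flipxI_out // gI andbT => sm.
have [lt|ge] := ltP (energy h (flipx (w :|: A)%SET x)) E.
  by rewrite (good_nb gU) //; apply/nbP; exists x.
have eI : energy h (w :&: A)%SET = energy h A by lra.
have eE : energy h (flipx w x) = E by lra.
rewrite eE eqxx /=; have /setIidPr Aw := sub_energy_eq (subsetIr w A) eI.
apply/orP; right; apply/orP; left; rewrite /flipx; case: ifP => _.
  by rewrite subsetD1 Aw.
by rewrite (subset_trans Aw) // subsetUr.
Qed.

Lemma anchor_connect A w : good (energy h A) A -> connect low A w -> anchor A w.
Proof.
move=> gA; suff H s : pinned A s -> connect low s w -> pinned A w.
  move=> Aw; rewrite /anchor gA (H A) //; by rewrite /pinned setUid setIid gA.
move=> ps /connectP[p]; elim: p s ps => [|r p IH] s ps /=; first by move=> _ ->.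
case/andP=> /and5P[_ _ /nbP[x xL ->] _ rE] pr; apply: IH => //.
have /andP[_ /orP[//|/andP[/eqP rE']]] := pinned_flip xL gA ps (ltW rE).
by rewrite rE' ltxx in rE.
Qed.

(** The new case is w at level E. The flip then goes strictly below E, into a well with bottom B. If
    B is not lower than A, then A stays an anchor provided that comparability survives the flip. *)
Lemma anchor_flip A w x : x \in L -> w \subset L -> alive w -> alive (flipx w x) ->
  energy h (flipx w x) <= E -> E <= height (flipx w x) -> anchor A w ->
  anchor A (flipx w x) \/ exists2 B, anchor B (flipx w x) & energy h B < energy h A.
Proof.
move=> xL wL aw af fE Ef /andP[gA /orP[pw|/andP[/eqP wE cmp]]].
  by left; exact: pinned_flip.
have fL : flipx w x \subset L by apply: nb_sub wL; apply/nbP; exists x.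
have flt : energy h (flipx w x) < E.
  by rewrite lt_neqAle fE andbT -wE; apply/eqP; exact: flip_energy_neq.
have [B [Bw gB gBB]] := good_ex af fL flt Ef.
have [BA|AB] := ltP (energy h B) (energy h A).
  by right; exists B => //; exact: anchor_connect.
left; have gf : good (energy h A) (flipx w x).
  case/and5P: gB => g1 g2 g3 g4 /forallP g5; apply/and5P; split => //.
  apply/forallP => t; apply/implyP => ft; apply: le_trans AB _.
  by have /implyP := g5 t; apply.
rewrite /anchor gA /= /pinned.
have sm := energy_submod h (flipx w x) A.
have AE : energy h A < E by case/and5P: gA.
(* If the flip destroyed comparability, submodularity would make flipping A itself at x lower the
   energy of A, although A is the bottom of its well. *)
have bad : energy h (flipx A x) < energy h A -> False.
  move=> lt; have /good_ge : good (energy h A) (flipx A x).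
    by apply: (good_nb gA); [apply/nbP; exists x|exact: lt_trans AE].
  by rewrite leNgt lt.
case/orP: cmp => cmp; case: (boolP (x \in A)) => xA.
- exfalso; apply: bad; have xw := subsetP cmp _ xA.
  move: sm; rewrite flipxU_in // flipxI_in // (setIidPr cmp) (setUidPl cmp); lra.
- have xf : (A \subset flipx w x).
    rewrite /flipx; case: ifP => _; first by rewrite subsetD1 cmp.
    by rewrite (subset_trans cmp) // subsetUr.
  by rewrite (setIidPr xf) (setUidPl xf) gf gA.
- have xf : (flipx w x \subset A).
    rewrite /flipx; case: ifP => _; first by rewrite (subset_trans _ cmp) // subsetDl.
    by rewrite subUset cmp sub1set xA.
  by rewrite (setIidPl xf) (setUidPr xf) gf gA.
- exfalso; apply: bad.
  move: sm; rewrite flipxU_out // flipxI_out // (setIidPl cmp) (setUidPr cmp); lra.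
Qed.

End Level.

Lemma first_fail (P : nat -> Prop) a b : P a ->
  (forall i, (a <= i <= b)%N -> P i) \/
  exists m, [/\ (a <= m < b)%N, forall i, (a <= i <= m)%N -> P i & ~ P m.+1].
Proof.
move=> Pa; have [all|nall] := pselect (forall i, (a <= i <= b)%N -> P i); [by left|right].
have ex : exists i, `[< (a <= i <= b)%N /\ ~ P i >].
  by move/existsNP: nall => [i /not_implyP Hi]; exists i; apply/asboolP.
case: (ex_minnP ex) => m /asboolP[/andP[am mb] nPm] mmin.
have ltam : (a < m)%N by rewrite ltn_neqAle am andbT; apply: contra_notN nPm => /eqP <-.
exists m.-1; rewrite prednK ?(leq_trans _ ltam) //; split=> //.
  by rewrite -ltnS prednK ?(leq_trans _ ltam) // ltam mb.
move=> i /andP[ai im]; apply: contrapT => nPi.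
have := mmin i; have -> : `[< (a <= i <= b)%N /\ ~ P i >].
  by apply/asboolP; split=> //; rewrite ai /= (leq_trans im) // (leq_trans (leq_pred _)).
by move/(_ isT); lia.
Qed.

(* [a, b] splits into at most k intervals, on each of which om meets a fixed set. *)
Fixpoint covered k (om : nat -> {set V}) a b : Prop := (b < a)%N \/
  if k is k'.+1 then exists A m, [/\ (#|A| <= n)%N, (a <= m <= b)%N,
    forall i, (a <= i <= m)%N -> (om i :&: A)%SET != set0 & covered k' om m.+1 b]
  else False.

Lemma covered_nil k om a b : (b < a)%N -> covered k om a b.
Proof. by case: k => [|k]; left. Qed.

Lemma coveredS k om a b : covered k om a b -> covered k.+1 om a b.
Proof.
elim: k a => [|k IH] a [|] //; try by left.
by case=> A [m [An am H /IH]]; right; exists A, m.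
Qed.

Lemma covered_le k k' om a b : (k <= k')%N -> covered k om a b -> covered k' om a b.
Proof. by move=> kk; rewrite -(subnKC kk); elim: (k' - k)%N => [|j IH]; rewrite ?addn0 ?addnS // => /IH/coveredS. Qed.

Lemma covered_tail k om a a' b : (a <= a')%N -> covered k om a b -> covered k om a' b.
Proof.
elim: k a => [|k IH] a aa [ba|]; try by left; rewrite (leq_trans ba).
  by [].
case=> A [m [An /andP[am mb] mA cov]]; case: (leqP a' m) => am'.
  right; exists A, m; split=> //; first by rewrite am'.
  by move=> i /andP[ai im]; apply: mA; rewrite (leq_trans aa).
by apply: coveredS; exact: IH cov.
Qed.

Lemma covered_cat k k' om a m b : (m <= b)%N -> covered k om a m -> covered k' om m.+1 b ->
  covered (k + k') om a b.
Proof.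
move=> mb + c2; elim: k a => [|k IH] a [ma|]; try by [].
- exact: covered_tail c2.
- by apply: (covered_le (leq_addl _ _)); exact: covered_tail c2.
case=> A [j [An /andP[aj jm] jA cov]]; right; exists A, j; split=> //.
  by rewrite aj (leq_trans jm).
exact: IH.
Qed.

Lemma covered1 om a b A : (#|A| <= n)%N -> (forall i, (a <= i <= b)%N -> (om i :&: A)%SET != set0) ->
  covered 1 om a b.
Proof.
move=> An H; have [ab|ba] := leqP a b; last exact: covered_nil.
by right; exists A, b; split=> //; [rewrite ab leqnn|exact: covered_nil].
Qed.

Section Cover.
Context (delta : R) (k0 : nat).
Hypothesis h_irr : irrational h.
Hypothesis delta_gap : forall s t, (#|s| <= n.+1)%N -> (#|t| <= n.+1)%N ->
  energy h s < energy h t -> energy h s + delta <= energy h t.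
Hypothesis k0_top : forall s, (#|s| <= n.+1)%N -> energy h s < k0%:R * delta.

Definition walk om a b := forall i, (a <= i < b)%N ->
  om i.+1 = om i \/ exists2 x, x \in L & om i.+1 = flipx (om i) x.

Definition alive_on om a b := forall i, (a <= i <= b)%N -> alive (om i) /\ om i \subset L.

Lemma walk_sub om a b a' b' : (a <= a')%N -> (b' <= b)%N -> walk om a b -> walk om a' b'.
Proof. by move=> aa bb wk i /andP[ai ib]; apply: wk; rewrite (leq_trans aa) // (leq_trans ib). Qed.

Lemma alive_on_sub om a b a' b' : (a <= a')%N -> (b' <= b)%N -> alive_on om a b -> alive_on om a' b'.
Proof. by move=> aa bb wk i /andP[ai ib]; apply: wk; rewrite (leq_trans aa) // (leq_trans ib). Qed.

(** When the anchor fails, [anchor_flip] supplies another one lower by at least delta. Alive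
    configurations have positive energy, so an anchor below k * delta is replaced fewer than k
    times. *)
Lemma cover_anchor E k A om a b : walk om a b -> alive_on om a b ->
  (forall i, (a <= i <= b)%N -> energy h (om i) <= E <= height (om i)) ->
  anchor E A (om a) -> energy h A < k%:R * delta -> covered k om a b.
Proof.
elim: k A a => [|k IH] A a wk al lev anA Ak.
  by case/andP: anA => /good_alive/alive_gt0; rewrite mul0r in Ak; rewrite ltNge (ltW Ak).
have Aal : alive A by case/andP: anA => /good_alive.
have An : (#|A| <= n)%N by exact: safe_card (alive_safe Aal).
case: (@first_fail (fun i => anchor E A (om i)) a b) => // [anc|[m [/andP[am mb] anc nan]]].
  apply: (@covered_le 1) => //; apply: covered1 An _ => i iab.
  by apply: anchor_meets (anc i iab); case: (al i iab).
have mab : (a <= m <= b)%N by rewrite am ltnW.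
have m1ab : (a <= m.+1 <= b)%N by rewrite leqW.
have [alm mL] := al _ mab; have [alm1 _] := al _ m1ab.
have mlt : (a <= m < b)%N by rewrite am.
have [e|[x xL e]] := wk m mlt; first by case: nan; rewrite e; apply: anc; rewrite am leqnn.
rewrite e in nan alm1.
have := lev _ m1ab; rewrite e => /andP[l1 l2].
have anm : anchor E A (om m) by apply: anc; rewrite am leqnn.
have [/nan //|[B anB BA]] := anchor_flip h_irr xL mL alm alm1 l1 l2 anm.
rewrite -[k.+1]add1n; apply: (@covered_cat _ _ _ _ m); first exact: ltnW.
  apply: covered1 An _ => i /andP[ai im]; apply: anchor_meets (anc i _); last by rewrite ai.
  by case: (al i) => //; rewrite ai (leq_trans im) // ltnW.
apply: (IH B).
- by apply: walk_sub wk => //; exact: leqW.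
- by apply: alive_on_sub al => //; exact: leqW.
- by move=> i /andP[mi ib]; apply: lev; rewrite ib andbT (leq_trans am) // ltnW.
- by rewrite e.
have Bal : alive B by case/andP: anB => /good_alive.
have := delta_gap (alive_card Bal) (alive_card Aal) BA.
by move: Ak; rewrite -natr1 mulrDl mul1r; lra.
Qed.

(** If the trajectory starts at level E, it keeps its initial configuration until its first move,
    which leads strictly below E by irrationality: this first interval is the extra one in k0.+1. *)
Lemma cover_level E om a b : walk om a b -> alive_on om a b ->
  (forall i, (a <= i <= b)%N -> energy h (om i) <= E <= height (om i)) ->
  covered k0.+1 om a b.
Proof.
move=> wk al lev; have [ab|ba] := leqP a b; last exact: covered_nil.
have aab : (a <= a <= b)%N by rewrite leqnn.
have below j : (a <= j <= b)%N -> energy h (om j) < E -> covered k0 om j b.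
  move=> jab jE; have /andP[aj jb] := jab; have [alj jL] := al _ jab; have /andP[_ lj] := lev _ jab.
  have [A [Aj gA gAA]] := good_ex alj jL jE lj.
  apply: (cover_anchor _ _ _ (anchor_connect h_irr gAA Aj)).
  - exact: walk_sub wk.
  - exact: alive_on_sub al.
  - by move=> i /andP[ji ib]; apply: lev; rewrite ib (leq_trans aj).
  - by apply: k0_top; apply: alive_card; exact: good_alive gAA.
have [aE|Ea] := ltP (energy h (om a)) E; first by apply: coveredS; exact: below.
have [ala _] := al _ aab.
have an : (#|om a| <= n)%N by exact: safe_card (alive_safe ala).
case: (@first_fail (fun i => om i = om a) a b) => // [same|[m [/andP[am mb] same nm]]].
  apply: (@covered_le 1) => //; apply: (covered1 an) => i iab.
  by rewrite same // setIid; exact: alive_neq0.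
rewrite -[k0.+1]add1n; apply: (@covered_cat _ _ _ _ m); first exact: ltnW.
  apply: (covered1 an) => i iab.
  by rewrite same // setIid; exact: alive_neq0.
have ma : om m = om a by apply: same; rewrite am leqnn.
have m1ab : (a <= m.+1 <= b)%N by rewrite leqW.
apply: below => //; have /andP[l1 _] := lev _ m1ab.
rewrite lt_neqAle l1 andbT; apply/eqP => e.
have mlt : (a <= m < b)%N by rewrite am.
have [e'|[x xL e']] := wk m mlt; first by apply: nm; rewrite e'.
apply: (@flip_energy_neq _ h _ _ (om a) x h_irr).
rewrite -ma -e' e ma; apply/eqP; rewrite eq_le Ea /=.
by have /andP[] := lev _ aab.
Qed.

(** Without violation the height does not increase, and each drop is at least delta: there are at
    most k plateaus. *)
Lemma cover_calm k om a b : walk om a b -> alive_on om a b ->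
  (forall i, (a <= i < b)%N -> energy h (om i.+1) <= height (om i)) ->
  height (om a) < k%:R * delta -> covered (k * k0.+1) om a b.
Proof.
have [ab|ba] := leqP a b; last by move=> *; exact: covered_nil.
elim: k a ab => [|k IH] a ab wk al calm ak.
  have [ala aL] : alive (om a) /\ om a \subset L by apply: al; rewrite leqnn ab.
  have [/reach_energy ra _ _] := heightP aL (alive_card ala).
  by have := alive_gt0 ala; rewrite mul0r in ak; lra.
have lvl i : (a <= i <= b)%N -> energy h (om i) <= height (om i).
  move=> iab; have [ali iL] := al i iab.
  by have [/reach_energy] := heightP iL (alive_card ali).
case: (@first_fail (fun i => height (om i) = height (om a)) a b) => // [same|[m [/andP[am mb] same nm]]].
  apply: (@covered_le k0.+1); first by rewrite mulSn leq_addr.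
  apply: (@cover_level (height (om a))) => // i iab.
  by rewrite same // lexx andbT -(same i iab) lvl.
have ma : height (om m) = height (om a) by apply: same; rewrite am leqnn.
have mab : (a <= m <= b)%N by rewrite am ltnW.
have m1ab : (a <= m.+1 <= b)%N by rewrite leqW.
have [alm mL] := al _ mab; have [alm1 m1L] := al _ m1ab.
rewrite mulSn; apply: (@covered_cat _ _ _ _ m); first exact: ltnW.
  apply: (@cover_level (height (om a))).
  - by apply: walk_sub wk => //; exact: ltnW.
  - by apply: alive_on_sub al => //; exact: ltnW.
  - move=> i /andP[ai im]; rewrite same ?ai // lexx andbT -(same i) ?ai // lvl //.
    by rewrite ai (leq_trans im) // ltnW.
apply: IH => //.
- by apply: walk_sub wk => //; exact: leqW.
- by apply: alive_on_sub al => //; exact: leqW.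
- by move=> i /andP[mi ib]; apply: calm; rewrite ib andbT (leq_trans am) // ltnW.
have le1 : height (om m.+1) <= height (om m).
  have mlt : (a <= m < b)%N by rewrite am.
  have [e|[x xL e]] := wk m mlt; first by rewrite e.
  rewrite e in alm1 m1L *; apply: height_hop => //; first by apply/nbP; exists x.
  by rewrite -e calm // am mb.
have lt1 : height (om m.+1) < height (om a).
  by rewrite lt_neqAle -{2}ma le1 andbT; apply/eqP.
have [ala aL] : alive (om a) /\ om a \subset L by apply: al; rewrite leqnn ab.
have [_ [s sn hs] _] := heightP m1L (alive_card alm1).
have [_ [t tn ht] _] := heightP aL (alive_card ala).
have := delta_gap sn tn; rewrite -hs -ht => /(_ lt1).
by move: ak; rewrite -natr1 mulrDl mul1r; lra.
Qed.

End Cover.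
End Landscape.

Lemma traj_nth (N : finType) (S : Type) (f : N -> S -> S) v0 a s i :
  (i < size s)%N -> traj f a s i.+1 = f (nth v0 s i) (traj f a s i).
Proof. by move=> si; rewrite /traj (take_nth v0) // -cats1 foldl_cat. Qed.

(** * Attractiveness and the coupling outside a set *)

Section Coupling.
Import mathcomp.boot.fintype mathcomp.boot.finset.
Context (R : realType) (h beta : R) (c : nat) (V : lattice c).
Context (u0 : coin (@accept R h beta c V)).
Hypothesis beta_ge0 : 0 <= beta.
Implicit Types (s t L A : {set V}) (x y : V).

Lemma accept_add s t x : (nbr s x <= nbr t x)%N ->
  accept h beta (s, x, true) <= accept h beta (t, x, true).
Proof.
move=> st; rewrite /accept /= ler_expR !mulNr lerN2 ler_wpM2l //.
by rewrite ge_max !le_max lexx /= /gap lerB ?orbT // ler_wpM2l // ler_nat.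
Qed.

Lemma accept_rem s t x : (nbr s x <= nbr t x)%N ->
  accept h beta (t, x, false) <= accept h beta (s, x, false).
Proof.
move=> st; rewrite /accept /= ler_expR !mulNr lerN2 ler_wpM2l //.
by rewrite ge_max !le_max lexx /= /gap lerN2 lerB ?orbT // ler_wpM2l // ler_nat.
Qed.

Lemma step_sub L (v : noise u0) s : s \subset L -> step L v s \subset L.
Proof.
move=> sL; rewrite /step; case: ifP => // /andP[xL _]; case: ifP => _.
  by rewrite subUset sub1set xL.
by rewrite (subset_trans _ sL) // subsetDl.
Qed.

Lemma step_nb L (v : noise u0) s : step L v s = s \/ exists2 x, x \in L & step L v s = flipx s x.
Proof.
rewrite /step; case: ifP => [/andP[xL _]|_]; last by left.
case: (boolP (v.1.1 \in s)) => xs; case: ifP => _.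
- by left; apply/setUidPr; rewrite sub1set.
- by right; exists v.1.1 => //; rewrite /flipx xs.
- by right; exists v.1.1 => //; rewrite /flipx (negPf xs).
- by left; apply/setDidPl; rewrite disjoint_sym disjoints1.
Qed.

(** More plus neighbours make additions easier and removals harder; the nested events of the coin
    turn these inequalities between probabilities into inclusions. *)
Lemma step_mono L L' (v : noise u0) s t : L' \subset L -> s \subset t -> s \subset L' ->
  step L' v s \subset step L v t.
Proof.
move=> LL st sL; apply/subsetP => y; rewrite /step; case: v => -[x b] u /=.
case: b.
  case: ifP => [/andP[xL' hs]|_].
    rewrite (subsetP LL _ xL') /= (hit_mono (accept_add (nbrS x st)) hs) !inE.
    by case/orP => [->//|/(subsetP st) ->]; rewrite orbT.
  by move/(subsetP st); case: ifP => // _; rewrite !inE => ->; rewrite orbT.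
case: ifP => [_|nr].
  by rewrite !inE => /andP[yx /(subsetP st) yt]; case: ifP => // _; rewrite !inE yx.
move=> ys; case: ifP => [/andP[xL ht]|_]; last exact: (subsetP st).
rewrite !inE (subsetP st) // andbT; apply/eqP => yx; subst y.
by move: nr; rewrite (subsetP sL) //= (hit_mono (accept_rem (nbrS x st)) ht).
Qed.

Section Path.
Context (n : nat) (L A s0 : {set V}) (ns : seq (noise u0)).
Hypothesis s0L : s0 \subset L.

Definition om i := traj (step L) s0 ns i.
Definition th a i := traj (step (L :\: A)%SET) (om a :\: A)%SET (drop a ns) (i - a).

Lemma om_sub i : (i <= size ns)%N -> om i \subset L.
Proof.
elim: i => [|i IH] ins; first by rewrite /om traj0.
by have [v e] := traj_step (step L) s0 ins; rewrite /om e; apply: step_sub; apply: IH; exact: ltnW.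
Qed.

Lemma om_walk a b : (b <= size ns)%N -> walk L om a b.
Proof.
move=> bn i /andP[_ ib]; have [v e] := traj_step (step L) s0 (leq_trans ib bn).
by rewrite /om e; exact: step_nb.
Qed.

Lemma th0 a : th a a = (om a :\: A)%SET.
Proof. by rewrite /th subnn traj0. Qed.

Lemma thS v0 a i : (a <= i)%N -> (i < size ns)%N ->
  th a i.+1 = step (L :\: A)%SET (nth v0 ns i) (th a i).
Proof.
move=> ai ins; rewrite /th subSn // (traj_nth _ v0); last by rewrite size_drop ltn_sub2r // (leq_ltn_trans ai).
by rewrite nth_drop subnKC.
Qed.

Lemma th_sub a i : (a <= i <= size ns)%N -> th a i \subset (om i :\: A)%SET.
Proof.
move=> /andP[ai ins].
suff [H1 H2] : th a i \subset om i /\ th a i \subset (L :\: A)%SET.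
  by move: H2; rewrite !subsetD H1 => /andP[_ ->].
rewrite -(subnKC ai) in ins *; elim: (i - a)%N ins => [|j IH] ins.
  by rewrite addn0 th0 subsetDl; split=> //; rewrite setSD // om_sub // (leq_trans _ ins) // leq_addr.
rewrite addnS in ins *; have [H1 H2] := IH (ltnW ins).
have v0 : noise u0 by case: (ns) ins => [|v ?].
rewrite (thS v0) ?leq_addr // /om (traj_nth _ v0) //; split; last exact: step_sub.
by apply: step_mono => //; exact: subsetDl.
Qed.

(** The inclusion of [th] in [om] gives the wrong monotonicity here. What helps is that the plus
    neighbours of a pure plus are pure, hence present in [th]: there x has at least as many plus
    neighbours as in [om], so it appears when it does in [om] and is not removed while it persists
    in [om]. *)
Lemma pure_coupled a x i : (a <= i)%N -> (i <= size ns)%N -> x \in om i ->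
  ~ tainted A om a x i -> x \in th a i.
Proof.
move=> ai; rewrite -(subnKC ai); elim: (i - a)%N x => [|j IH] x ins xi nt.
  rewrite addn0 th0 inE; rewrite addn0 in xi nt; rewrite xi andbT.
  by apply/negP => xA; apply: nt; exact: taint_src.
rewrite addnS in ins xi nt *; set k := (a + j)%N in IH ins xi nt *.
have ak : (a <= k)%N by exact: leq_addr.
have v0 : noise u0 by case: (ns) ins => [|v ?].
have IH' y : y \in om k -> ~ tainted A om a y k -> y \in th a k by move=> *; apply: IH => //; exact: ltnW.
have xA : x \notin A by apply/negP => xA; apply: nt; apply: taint_src => //; exact: leqW.
(* A contaminated neighbour which survives until k.+1 would contaminate x within the slice k.+1. *)
have nbrs y : adj x y -> y \in om k -> y \in om k.+1 -> y \in th a k.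
  move=> xy yk yk1; apply: IH' => // ty; apply: nt.
  by apply: (@taint_adj _ _ _ _ _ y) => //; [exact: taint_next|rewrite adjC].
have nb_le : om k \subset om k.+1 -> (nbr (om k) x <= nbr (th a k) x)%N.
  move=> sub; apply: subset_leq_card; apply/subsetP => y; rewrite !inE => /andP[yk xy].
  by rewrite xy andbT; apply: nbrs => //; exact: (subsetP sub).
rewrite (thS v0) //.
have e : om k.+1 = step L (nth v0 ns k) (om k) by rewrite /om (traj_nth _ v0).
have kns : (a <= k <= size ns)%N by rewrite ak ltnW.
have omk : om k \subset L by apply: om_sub; exact: ltnW.
have xi0 := xi; rewrite e in xi nb_le; move: xi nb_le; rewrite /step; case: (nth v0 ns k) => -[z b] u /=.
case: (boolP (x \in om k)) => xk; last first.
  case: ifP => [/andP[zL hz]|_]; last by rewrite (negPf xk).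
  case: b hz => hz; last by rewrite !inE (negPf xk) andbF.
  rewrite !inE (negPf xk) orbF => /eqP xz; subst z => /(_ (subsetUr _ _)) nb_le.
  by rewrite xA zL /= (hit_mono (accept_add nb_le) hz) !inE eqxx.
have xth : x \in th a k.
  apply: IH' => // tx; apply: nt; apply: taint_next => //.
have [/andP[zL hz]|nz] := boolP ((z \in L) && hit u (om k, z, b)).
  case: b hz => hz xi nb_le.
    by case: ifP => _ //; rewrite !inE xth orbT.
  case: ifP => _ //; move: xi; rewrite !inE => /andP[-> _]; exact: xth.
move=> _ /(_ (subxx _)) nb_le; case: ifP => // /andP[zLA hz].
case: b nz hz => nz hz; first by rewrite !inE xth orbT.
rewrite !inE xth andbT; apply/eqP => xz; subst z.
by move: nz; rewrite (subsetP omk) //= (hit_mono (accept_rem nb_le) hz).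
Qed.

End Path.

Definition sprawl n l L s0 (ns : seq (noise u0)) := exists b,
  [/\ (b <= size ns)%N, forall i, (i <= b)%N -> safe h n (om L s0 ns i) &
      ~ bounded l 0 b (om L s0 ns)].

Lemma conn_shift (f : nat -> {set V}) a b p q : (a <= b)%N ->
  conn a b (fun i => f (i - a)%N) p q -> conn 0 (b - a) f (p.1, (p.2 - a)%N) (q.1, (q.2 - a)%N).
Proof.
move=> ab.
have ptp r : pt a b (fun i => f (i - a)%N) r -> pt 0 (b - a) f (r.1, (r.2 - a)%N).
  by case/and3P=> ar rb rf; apply/and3P; split=> //=; exact: leq_sub2r.
elim=> [pp|q' r pq IH qr]; first by apply: conn_refl; exact: ptp.
apply: (conn_step IH); have /and3P[Hq Hr H] := qr.
rewrite /link !ptp //=; have /and3P[aq _ _] := Hq; have /and3P[ar _ _] := Hr.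
case/orP: H => /andP[/eqP -> H]; first by rewrite eqxx H.
by apply/orP; right; rewrite eqxx /=; lia.
Qed.

(** This is where the number of pluses decreases: since the configuration meets A, at most n of its
    n.+1 pluses lie outside A, and they form a safe configuration. *)
Lemma anchored_bounded n l L A s0 ns a b : s0 \subset L -> (a <= b <= size ns)%N ->
  (forall i, (a <= i <= b)%N -> safe h n.+1 (om L s0 ns i)) -> (#|A| <= n.+1)%N ->
  (forall i, (a <= i <= b)%N -> (om L s0 ns i :&: A)%SET != set0) ->
  (forall i, (a <= i <= b)%N -> ~ sprawl n l (L :\: A)%SET (om L s0 ns i :\: A)%SET (drop i ns)) ->
  bounded (n.+1 * (2 * (2 * l + n.+1 + 1) + 1) + l) a b (om L s0 ns).
Proof.
move=> s0L /andP[ab bn] sf An omA nsp.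
apply: (@bounded_anchor _ _ A _ _ _ _ _ (th L A s0 ns)) => //.
- by move=> i /sf/safe_card.
- move=> s x i /andP[as_ si] ib; apply: pure_coupled => //; exact: leq_trans bn.
move=> s /andP[as_ sb] p q pq.
rewrite leqNgt; apply/negP => lt; apply: (nsp s); first by rewrite as_.
exists (b - s)%N; split.
- by rewrite size_drop leq_sub2r.
- move=> i ib; have isb : (s + i <= b)%N by lia.
  have := @th_sub L A s0 ns s0L s (s + i)%N; rewrite leq_addr (leq_trans isb bn) => /(_ isT).
  have -> : th L A s0 ns s (s + i) = om (L :\: A)%SET (om L s0 ns s :\: A)%SET (drop s ns) i.
    by rewrite /th /om addKn.
  move=> sub; have sfi := sf (s + i)%N; have aib : (a <= s + i <= b)%N by lia.
  have /andP[c1 c2] := safe_sub (subset_trans sub (subsetDl _ _)) (sfi aib).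
  rewrite /safe c2 andbT; apply: (leq_trans (subset_leq_card sub)).
  have := omA _ aib; rewrite -card_gt0 cardsD.
  by have := safe_card (sfi aib); lia.
move=> bd; have := bd _ _ (@conn_shift _ s b p q sb pq).
by rewrite leqNgt lt.
Qed.

End Coupling.

(** * Hitting probabilities and violations *)

Section Dirichlet.
Import mathcomp.boot.fintype mathcomp.boot.finset.
Context (R : realType) (h beta : R) (c : nat) (V : lattice c) (n : nat) (L : {set V}).
Context (u0 : coin (@accept R h beta c V)).
Hypotheses (beta_ge0 : 0 <= beta) (V0 : (0 < #|V|)%N).
Implicit Types (s t : {set V}) (x y : V) (f g : {set V} -> R).

(* Conductances: exp (- beta * energy h s) * rate s x. *)
Definition kappa s x : R := expR (- beta * Num.max (energy h s) (energy h (flipx s x))).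
Definition lap f s : R := \sum_(x in L) kappa s x * (f (flipx s x) - f s).
Definition dform f g : R :=
  \sum_s \sum_(x in L) kappa s x * ((f (flipx s x) - f s) * (g (flipx s x) - g s)).

Lemma kappa_ge0 s x : 0 <= kappa s x. Proof. exact: expR_ge0. Qed.

Lemma kappa_flip s x : kappa (flipx s x) x = kappa s x.
Proof. by rewrite /kappa flipxK maxC. Qed.

Lemma kappa_rate s x : kappa s x = expR (- beta * energy h s) * rate h beta s x.
Proof.
rewrite /kappa /rate -expRD -mulrDr addr_maxr addr0; congr (expR (_ * Num.max _ _)).
by rewrite addrC subrK.
Qed.

Lemma sum_flip (F : {set V} -> V -> R) :
  \sum_s \sum_(x in L) F s x = \sum_s \sum_(x in L) F (flipx s x) x.
Proof.
rewrite exchange_big [RHS]exchange_big /=; apply: eq_bigr => x _.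
by rewrite (reindex_inj (inv_inj (@flipxK c V x))).
Qed.

(** Summation by parts. Conductances are invariant under the flip, and each edge is seen from both
    ends, whence the factor 2. *)
Lemma dform_parts f g : dform f g = - 2 * \sum_s g s * lap f s.
Proof.
rewrite /dform (eq_bigr (fun s => \sum_(x in L) kappa s x * (f (flipx s x) - f s) * g (flipx s x)
   - \sum_(x in L) kappa s x * (f (flipx s x) - f s) * g s)); last first.
  move=> s _; rewrite -sumrB; apply: eq_bigr => x _; ring.
rewrite sumrB sum_flip (eq_bigr (fun s => - (g s * lap f s))); last first.
  move=> s _; rewrite /lap mulr_sumr -sumrN; apply: eq_bigr => x _.
  rewrite kappa_flip flipxK; ring.
rewrite sumrN [X in _ - X](eq_bigr (fun s => g s * lap f s)); first by ring.
move=> s _; rewrite /lap mulr_sumr; apply: eq_bigr => x _; ring.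
Qed.

Lemma dform_sq_le f (a : R) s x : dform f f <= a -> x \in L ->
  kappa s x * (f (flipx s x) - f s) ^+ 2 <= a.
Proof.
move=> fa xL; apply: le_trans fa; rewrite /dform (bigD1 s) //= (bigD1 x) //= -expr2 -addrA lerDl.
apply: addr_ge0; first by apply: sumr_ge0 => y _; rewrite mulr_ge0 ?kappa_ge0 // -expr2 sqr_ge0.
by apply: sumr_ge0 => t _; apply: sumr_ge0 => y _; rewrite mulr_ge0 ?kappa_ge0 // -expr2 sqr_ge0.
Qed.

Section Hitting.
Context (E delta : R).

Definition above s := alive h n s && (E < energy h s).

(* Probability of exceeding the energy E within k steps, before ceasing to be alive. *)
Fixpoint hitp k s : R :=
  if above s then 1 else
  if k is k'.+1 then
    if alive h n s then \sum_v weight v * hitp k' (step (u0 := u0) L v s) else 0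
  else 0.

Lemma hitp_dead k s : ~~ alive h n s -> hitp k s = 0.
Proof. by move=> /negPf ds; case: k => [|k] /=; rewrite /above ds. Qed.

Lemma hitp_above k s : above s -> hitp k s = 1.
Proof. by move=> As; case: k => [|k] /=; rewrite As. Qed.

Lemma hitp_ge0 k s : 0 <= hitp k s.
Proof.
elim: k s => [|k IH] s /=; first by case: ifP.
case: ifP => // _; case: ifP => // _; apply: sumr_ge0 => v _.
by rewrite mulr_ge0 // weight_ge0.
Qed.

Lemma hitpS k s : hitp k s <= hitp k.+1 s.
Proof.
elim: k s => [|k IH] s.
  case As : (above s); first by rewrite !hitp_above.
  by rewrite {1}/hitp As hitp_ge0.
case As : (above s); first by rewrite !hitp_above.
case al : (alive h n s); last by rewrite !hitp_dead ?al.
rewrite /= As al; apply: ler_sum => v _; rewrite ler_wpM2l ?weight_ge0 //; exact: IH.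
Qed.

(** The increment of the hitting probability from horizon k to k.+1 is a positive multiple of
    [lap (hitp k) s]. *)
Lemma hitp_lap k s : alive h n s -> ~~ above s -> 0 <= lap (hitp k) s.
Proof.
move=> al /negPf nA; have := hitpS k s; rewrite {2}/hitp -/hitp nA al step_mean // => H.
have {}H : 0 <= \sum_(x in L) rate h beta s x * (hitp k (flipx s x) - hitp k s).
  move: H; rewrite lerDl pmulr_rge0 // invr_gt0 mulr_gt0 // ltr0n //.
rewrite /lap (eq_bigr (fun x => expR (- beta * energy h s) *
   (rate h beta s x * (hitp k (flipx s x) - hitp k s)))) => [|x _]; last by rewrite kappa_rate mulrA.
by rewrite -mulr_sumr mulr_ge0 // expR_ge0.
Qed.

Definition smalls := #|[set s : {set V} | (#|s| <= n)%N]|.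

Hypothesis gapE : forall t, alive h n t -> E < energy h t -> E + delta <= energy h t.

(** A Dirichlet principle at finite horizon, with the indicator of [above] as test function: both
    functions are 1 on [above], and elsewhere [hitp] need only be subharmonic or 0. The form of the
    indicator involves only edges touching [above], whose conductances are at most expR (- beta * (E
    + delta)). *)
Lemma dform_hitp k : dform (hitp k) (hitp k) <=
  2 * smalls%:R * #|V|%:R * expR (- beta * (E + delta)).
Proof.
pose f := hitp k; pose b s : R := (above s)%:R.
have H1 : dform f f <= dform f b.
  rewrite !dform_parts !mulNr lerN2 ler_wpM2l //; apply: ler_sum => s _.
  rewrite /b; case As : (above s); first by rewrite /f hitp_above.
  rewrite mul0r; case al : (alive h n s); last by rewrite /f hitp_dead ?al // mul0r.
  by rewrite mulr_ge0 // ?hitp_ge0 // hitp_lap // As.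
have H2 : dform f b <= 2^-1 * dform f f + 2^-1 * dform b b.
  rewrite /dform !mulr_sumr -big_split /=; apply: ler_sum => s _.
  rewrite !mulr_sumr -big_split /=; apply: ler_sum => x _.
  rewrite ![2^-1 * (_ * _)]mulrCA -mulrDr ler_wpM2l ?kappa_ge0 //.
  set u := f _ - f _; set w := b _ - b _.
  have := sqr_ge0 (u - w); lra.
have H3 : dform b b <= 2 * \sum_s \sum_(x in L) kappa s x * b s.
  rewrite mulrDl mul1r {2}sum_flip -big_split /=; apply: ler_sum => s _.
  rewrite -big_split /=; apply: ler_sum => x _; rewrite kappa_flip -mulrDr ler_wpM2l ?kappa_ge0 //.
  rewrite /b; case: (above s); case: (above _); rewrite /=; lra.
have H4 : \sum_s \sum_(x in L) kappa s x * b s <=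
    smalls%:R * #|V|%:R * expR (- beta * (E + delta)).
  rewrite (bigID (fun s => s \in [set s : {set V} | (#|s| <= n)%N])) /= [X in _ + X]big1 ?addr0; last first.
    move=> s; rewrite inE => sn; apply: big1 => x _.
    rewrite /b /above; case al : (alive h n s); last by rewrite mulr0.
    by move: sn; rewrite (safe_card (alive_safe al)).
  rewrite -mulrA mulr_natl -sumr_const; apply: ler_sum => s _.
  apply: (@le_trans _ _ (\sum_(x in L) expR (- beta * (E + delta)))); last first.
    by rewrite sumr_const mulr_natl ler_wpMn2l ?expR_ge0 // max_card.
  apply: ler_sum => x _; rewrite /b; case As : (above s); last by rewrite mulr0 expR_ge0.
  rewrite mulr1 /kappa ler_expR !mulNr lerN2 ler_wpM2l // le_max.
  by case/andP: As => al Es; rewrite gapE.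
have H5 : 0 <= dform f f by rewrite /dform; apply: sumr_ge0 => t _; apply: sumr_ge0 => y _; rewrite mulr_ge0 ?kappa_ge0 // -expr2 sqr_ge0.
by rewrite -/f; lra.
Qed.

(** One factor [smalls] comes from the number of edges in the Dirichlet form, the other from the
    length of a self-avoiding path of alive configurations; the exponent is halved by a square
    root. *)
Definition eps : R := 2 * smalls%:R ^+ 2 * #|V|%:R * expR (- beta * delta / 2).

(** An edge of energy at most E has conductance at least expR (- beta * E), so a term of the
    Dirichlet form bounds the square of the variation by a factor times expR (- beta * delta). *)
Lemma hitp_hop k s t : hop h n L E s t ->
  hitp k s <= hitp k t + 2 * smalls%:R * #|V|%:R * expR (- beta * delta / 2).
Proof.
case/and4P=> als /nbP[x xL ->] sE tE.
have N1 : 1 <= smalls%:R :> R.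
  rewrite ler1n card_gt0; apply/set0Pn; exists set0; by rewrite inE cards0.
have q1 : 1 <= #|V|%:R :> R by rewrite ler1n.
set r := _ * expR _.
have r0 : 0 <= r by rewrite mulr_ge0 ?expR_ge0.
suff H : (hitp k (flipx s x) - hitp k s) ^+ 2 <= r ^+ 2.
  have : `|hitp k (flipx s x) - hitp k s| <= r by rewrite -(ler_pXn2r (n := 2)) ?nnegrE // real_normK // num_real.
  by rewrite ler_norml => /andP[]; lra.
have := dform_sq_le s (dform_hitp k) xL; set D := (_ - _) ^+ 2 => HD.
have kE : expR (- beta * E) <= kappa s x.
  by rewrite /kappa ler_expR !mulNr lerN2 ler_wpM2l // ge_max sE.
have D0 : 0 <= D by exact: sqr_ge0.
have {}HD : D <= 2 * smalls%:R * #|V|%:R * expR (- beta * delta).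
  have e : expR (- beta * (E + delta)) = expR (- beta * E) * expR (- beta * delta).
    by rewrite -expRD; congr expR; ring.
  have : expR (- beta * E) * D <= expR (- beta * E) * (2 * smalls%:R * #|V|%:R * expR (- beta * delta)).
    apply: le_trans (ler_wpM2r D0 kE) _; apply: le_trans HD _; rewrite e.
    by rewrite [leRHS]mulrCA.
  by rewrite ler_pM2l ?expR_gt0.
apply: le_trans HD _.
have e : expR (- beta * delta) = expR (- beta * delta / 2) ^+ 2.
  by rewrite expr2 -expRD; congr expR; field.
rewrite /r exprMn -e ler_wpM2r ?expR_ge0 //.
(* To avoid square roots, 2 * a is bounded by (2 * a) ^+ 2, as a >= 1. *)
rewrite -mulrA; set a := smalls%:R * #|V|%:R; have a1 : 1 <= a by rewrite mulr_ege1.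
rewrite exprMn; have : a <= a ^+ 2 by rewrite expr2 ler_peMr // (le_trans ler01).
lra.
Qed.

Lemma hitp_small k s : reach h n L E s -> hitp k s <= eps.
Proof.
case/andP=> sE /existsP[t /andP[dt /connectP[p0 ep0 te]]].
case/shortenP: ep0 te => p ep up _ te.
set r := 2 * smalls%:R * #|V|%:R * expR (- beta * delta / 2).
have r0 : 0 <= r by rewrite mulr_ge0 ?expR_ge0 // !mulr_ge0.
have H : hitp k s <= hitp k t + (size p)%:R * r.
  rewrite te; elim: p s ep {sE up te} => [|y p IH] s /=; first by rewrite mul0r addr0.
  case/andP=> /(hitp_hop k) sy /IH yp; rewrite -natr1 mulrDl mul1r; rewrite -/r in sy; lra.
have pN : (size p <= smalls)%N.
  have -> : size p = size (belast s p) by rewrite size_belast.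
  rewrite /smalls cardE; apply: uniq_leq_size.
    by move: up; rewrite lastI rcons_uniq => /andP[].
  move=> z; rewrite mem_enum inE => zp.
  have : alive h n z.
    elim: p s ep zp {up te sE H} => [//|y p IH] s /= /andP[/and4P[als _ _ _] yp].
    by rewrite inE => /orP[/eqP -> //|/(IH _ yp)].
  by move/alive_safe/safe_card.
rewrite (hitp_dead k dt) add0r in H; apply: le_trans H _.
apply: (@le_trans _ _ (smalls%:R * r)); first by rewrite ler_wpM2r // ler_nat.
by rewrite le_eqVlt; apply/orP; left; apply/eqP; rewrite /eps /r; ring.
Qed.

End Hitting.
End Dirichlet.

Lemma covered_shift (c : nat) (V : lattice c) n k (f : nat -> {set V}) a b :
  covered n k (fun i => f (a + i)%N) 0 b -> covered n k f a (a + b).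
Proof.
suff H j : covered n k (fun i => f (a + i)%N) j b -> covered n k f (a + j) (a + b).
  by move/H; rewrite addn0.
elim: k j => [|k IH] j [jb|] //; try by left; rewrite ltn_add2l.
case=> A [m [An /andP[jm mb] mA cov]]; right; exists A, (a + m)%N; split=> //.
- by rewrite !leq_add2l jm.
- move=> i /andP[ji im]; have := mA (i - a)%N; rewrite subnKC; last by rewrite (leq_trans _ ji) // leq_addr.
  by apply; lia.
by rewrite -addnS; exact: IH.
Qed.

(** * Probability of many violations *)

Section Excursions.
Import mathcomp.boot.fintype mathcomp.boot.finset.
Context (R : realType) (h beta : R) (c : nat) (V : lattice c) (n : nat) (L : {set V}).
Context (u0 : coin (@accept R h beta c V)) (delta : R).
Hypotheses (beta_ge0 : 0 <= beta) (V0 : (0 < #|V|)%N).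
Hypothesis delta_gap : forall s t : {set V}, (#|s| <= n.+1)%N -> (#|t| <= n.+1)%N ->
  energy h s < energy h t -> energy h s + delta <= energy h t.
Implicit Types (s t : {set V}) (x y : V).

Local Notation w := (@weight R h beta c V u0).
Local Notation stp := (step (u0 := u0) L).
Local Notation eps := (eps beta V n delta).
Local Notation height := (height h n L).

Definition viol s t := height s < energy h t.

(** A level below the current height is charged the a priori bound [eps], any other level its true
    hitting probability. As the height does not increase between violations, a level may pass from
    the first regime to the second but never back, which makes [escape] a supersolution. *)
Definition jump_at (E : R) k s : R :=
  if alive h n s then if E < height s then eps else hitp n L u0 E k s else 0.

Definition escape k s : R :=
  \sum_(t in [set t : {set V} | (#|t| <= n.+1)%N]) jump_at (energy h t) k s.

Definition smalls1 := #|[set s : {set V} | (#|s| <= n.+1)%N]|.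

Lemma eps_ge0 : 0 <= eps.
Proof. by rewrite /eps !mulr_ge0 // expR_ge0. Qed.

Lemma hitp_eps (E : {set V}) k s : (#|E| <= n.+1)%N -> alive h n s -> s \subset L ->
  height s <= energy h E -> hitp n L u0 (energy h E) k s <= eps.
Proof.
move=> En al sL sE.
have gE t : alive h n t -> energy h E < energy h t -> energy h E + delta <= energy h t.
  by move=> alt; apply: delta_gap => //; exact: alive_card alt.
apply: (hitp_small u0 beta_ge0 V0 gE).
by have [/(reach_le sE)] := heightP h sL (alive_card al).
Qed.

Lemma jump_at_le (E : {set V}) k s : (#|E| <= n.+1)%N -> s \subset L ->
  0 <= jump_at (energy h E) k s <= eps.
Proof.
move=> En sL; rewrite /jump_at; case al : (alive h n s); last by rewrite lexx eps_ge0.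
have [_|le] := ltP (energy h E) (height s); first by rewrite lexx eps_ge0.
by rewrite hitp_ge0 hitp_eps.
Qed.

Lemma escape_le k s : s \subset L -> 0 <= escape k s <= smalls1%:R * eps.
Proof.
move=> sL; apply/andP; split.
  by apply: sumr_ge0 => t; rewrite inE => tn; have /andP[] := jump_at_le k tn sL.
rewrite /escape /smalls1 mulr_natl -sumr_const; apply: ler_sum => t; rewrite inE => tn.
by have /andP[] := jump_at_le k tn sL.
Qed.

(** A violation is charged to the level [E0] realising the height of s: its reward 1 is the hitting
    probability there, since the new configuration is above [E0]. At the other levels [jump_at]
    dominates its mean after one step. *)
Lemma escape_super k s : alive h n s -> s \subset L ->
  \sum_v w v * (if alive h n (stp v s) then
                  if viol s (stp v s) then 1 else escape k (stp v s) else 0)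
  <= escape k.+1 s.
Proof.
move=> al sL.
have [rs [E0 E0n hE0] _] := heightP h sL (alive_card al).
pose pay (E : {set V}) : R := (E == E0)%:R.
pose part (E : {set V}) v : R := if alive h n (stp v s) then
   if viol s (stp v s) then pay E else jump_at (energy h E) k (stp v s) else 0.
have E0in : E0 \in [set t : {set V} | (#|t| <= n.+1)%N] by rewrite inE.
apply: (@le_trans _ _ (\sum_(E in [set t : {set V} | (#|t| <= n.+1)%N]) \sum_v w v * part E v)).
  rewrite exchange_big /=; apply: ler_sum => v _; rewrite -mulr_sumr ler_wpM2l ?weight_ge0 //.
  rewrite /part; case: ifP => _; last exact: sumr_ge0.
  case: ifP => _ //; rewrite (bigD1 E0) //= /pay eqxx lerDl sumr_ge0 //.
apply: ler_sum => E; rewrite inE => En.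
rewrite [leRHS]/jump_at al.
have stpL v : stp v s \subset L by exact: step_sub.
have [ltE|leE] := ltP (energy h E) (height s).
  rewrite -[leRHS]mul1r -(weight_sum u0 V0) mulr_suml; apply: ler_sum => v _.
  rewrite ler_wpM2l ?weight_ge0 // /part; case: ifP => _; last exact: eps_ge0.
  case: ifP => _; last by have /andP[] := jump_at_le k En (stpL v).
  rewrite /pay; case: eqP => [e|_]; last exact: eps_ge0.
  by rewrite e -hE0 ltxx in ltE.
have nA : above h n (energy h E) s = false.
  by rewrite /above al /= ltNge (le_trans (reach_energy rs) leE).
rewrite /= nA al; apply: ler_sum => v _; rewrite ler_wpM2l ?weight_ge0 // /part.
case al' : (alive h n (stp v s)); last exact: hitp_ge0.
case: ifPn => [vi|nv].
  rewrite /pay; case: eqP => [e|_]; last exact: hitp_ge0.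
  by rewrite hitp_above // /above al' e -hE0.
rewrite /jump_at al' ltNge; have -> // : height (stp v s) <= energy h E.
apply: le_trans leE; rewrite /viol -leNgt in nv.
have [-> //|[x xL e]] := step_nb L v s.
by rewrite e in al' nv *; apply: height_hop => //; apply/nbP; exists x.
Qed.

(* At least m violations occur while the chain stays alive. *)
Fixpoint many (ns : seq (noise u0)) m s {struct ns} : Prop :=
  if m is m'.+1 then
    if ns is v :: ns' then
      alive h n (stp v s) /\
      (if viol s (stp v s) then many ns' m' (stp v s) else many ns' m (stp v s))
    else False
  else True.

(** The first violation costs [escape k s]. After each violation [escape] starts afresh and is again
    at most smalls1 * eps, so every further one costs that factor. *)
Lemma prob_many k m s : alive h n s -> s \subset L ->
  prob w k (fun ns => many ns m s) <= (smalls1%:R * eps) ^+ m.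
Proof.
have wge0 := @weight_ge0 R h beta c V u0; have wsum := weight_sum u0 V0.
move=> al sL; case: m => [|m]; first by rewrite expr0; exact: prob_le1.
suff H : prob w k (fun ns => many ns m.+1 s) <= escape k s * (smalls1%:R * eps) ^+ m.
  apply: le_trans H _; rewrite exprS; have /andP[_ es] := escape_le k sL.
  by rewrite ler_wpM2r // exprn_ge0 // mulr_ge0 // eps_ge0.
set e := smalls1%:R * eps; have e0 : 0 <= e by rewrite mulr_ge0 // eps_ge0.
elim: k m s al sL => [|k IH] m s al sL.
  rewrite prob0 //; last by case=> [|//] _ [].
  by rewrite mulr_ge0 ?exprn_ge0 //; have /andP[] := escape_le 0 sL.
rewrite /prob /= -/(prob _ _ _).
apply: (@le_trans _ _ ((\sum_v w v * (if alive h n (stp v s) then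
     if viol s (stp v s) then 1 else escape k (stp v s) else 0)) * e ^+ m)); last first.
  by rewrite ler_wpM2r ?exprn_ge0 // escape_super.
rewrite mulr_suml; apply: ler_sum => v _; rewrite -mulrA ler_wpM2l ?weight_ge0 //.
have stpL : stp v s \subset L by exact: step_sub.
case al' : (alive h n (stp v s)); last first.
  have p0 : prob w k (fun=> False) = 0 by apply: prob0 => // ns _.
  by rewrite mul0r -p0; apply: (prob_le wge0) => ns _ [].
case: ifP => vi.
  rewrite mul1r; case: m => [|m].
    by rewrite expr0; exact: (prob_le1 wge0 wsum).
  apply: (@le_trans _ _ (prob w k (fun ns => many ns m.+1 (stp v s)))).
    by apply: (prob_le wge0) => ns _ [].
  apply: le_trans (IH m _ al' stpL) _; rewrite exprS ler_wpM2r ?exprn_ge0 //.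
  by have /andP[] := escape_le k stpL.
apply: (@le_trans _ _ (prob w k (fun ns => many ns m.+1 (stp v s)))).
  by apply: (prob_le wge0) => ns _ [].
exact: IH.
Qed.

Lemma many_skip ns m s j : (j < size ns)%N ->
  (forall i, (i <= j.+1)%N -> alive h n (om L s ns i)) ->
  (forall i, (i < j)%N -> ~~ viol (om L s ns i) (om L s ns i.+1)) ->
  viol (om L s ns j) (om L s ns j.+1) ->
  many (drop j.+1 ns) m (om L s ns j.+1) -> many ns m.+1 s.
Proof.
elim: j ns s => [|j IH] [|v ns] s //= jns al calm vi mn.
  have := al 1%N isT; rewrite /om trajS !traj0 => al1; split=> //.
  by move: vi mn; rewrite /om trajS !traj0 drop0 => ->.
have := al 1%N isT; rewrite /om trajS traj0 => al1; split=> //.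
have := calm 0%N isT; rewrite /om trajS !traj0 => /negPf ->.
apply: IH => //.
- by move=> i ij; apply: (al i.+1).
- by move=> i ij; apply: (calm i.+1).
Qed.

(** Fewer than m violations cut the trajectory into at most m calm stretches, each covered by
    [cover_calm]. *)
Lemma few_covered k0 m ns s e : irrational h -> 
  (forall t : {set V}, (#|t| <= n.+1)%N -> energy h t < k0%:R * delta) ->
  s \subset L -> (e <= size ns)%N -> (forall i, (i <= e)%N -> alive h n (om L s ns i)) ->
  ~ many ns m s -> covered n (m * (k0 * k0.+1)) (om L s ns) 0 e.
Proof.
move=> hi top; elim: m ns s e => [|m IH] ns s e sL ens al nm; first by case: nm; case: (ns).
have subL i : (i <= e)%N -> om L s ns i \subset L by move=> ie; apply: om_sub => //; exact: leq_trans ens.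
have aL : alive_on h n L (om L s ns) 0 e by move=> i /andP[_ ie]; split; [exact: al|exact: subL].
pose P i := if i is i'.+1 then ~~ viol (om L s ns i') (om L s ns i) else true.
have lvl j : (j <= e)%N -> (forall i, (0 <= i <= j)%N -> P i) ->
    covered n (k0 * k0.+1) (om L s ns) 0 j.
  move=> je calm; apply: (cover_calm hi delta_gap top).
  - by apply: om_walk; exact: leq_trans ens.
  - by apply: alive_on_sub aL.
  - by move=> i ij; have := calm i.+1 ij; rewrite /P /viol -leNgt.
  have [_ [t tn ->] _] := heightP h (subL 0 isT) (alive_card (al 0 isT)).
  exact: top.
case: (@first_fail P 0 e) => // [calm|[j [/andP[_ je] calm nP]]].
  by apply: (covered_le (k := (k0 * k0.+1)%N)); [rewrite mulSn leq_addr|exact: lvl].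
rewrite mulSn; apply: (covered_cat (m := j)); [exact: ltnW|exact: lvl (ltnW je) calm|].
rewrite -[e](subnKC je); apply: covered_shift.
have e1 i : om L s ns (j.+1 + i) = om L (om L s ns j.+1) (drop j.+1 ns) i by rewrite /om traj_drop.
under eq_fun do rewrite e1.
apply: IH.
- exact: subL.
- by rewrite size_drop leq_sub2r.
- by move=> i ie; rewrite -e1; apply: al; lia.
move=> mn; apply: nm; apply: (@many_skip _ _ _ j) mn => //.
- exact: leq_trans je ens.
- by move=> i ij; apply: al; exact: leq_trans je.
- by move=> i ij; have := calm i.+1 ij.
- by apply/negPn/negP => nv; apply: nP.
Qed.

End Excursions.

Lemma prob_markov2 (R : realType) (N : finType) (w : N -> R) (S : Type) (f : N -> S -> S)
    (P : seq N -> Prop) (Q : S -> seq N -> Prop) e i k a :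
  (forall v, 0 <= w v) -> \sum_v w v = 1 -> (forall b, prob w k (Q b) <= e) -> 0 <= e ->
  prob w (i + k) (fun s => P (take i s) /\ Q (traj f a s i) (drop i s)) <= prob w i P * e.
Proof.
move=> w0 w1 Qe e0; elim: i P a => [|i IH] P a.
  rewrite add0n /prob /= -/(prob _ _ _); case: asboolP => HP.
    rewrite mul1r; apply: le_trans (Qe a); apply: prob_le => // s _ [_].
    by rewrite traj0 drop0.
  rewrite mul0r; have p0 : prob w k (fun=> False) = 0 by apply: prob0 => // s _.
  by rewrite -p0; apply: prob_le => // s _ [+ _]; rewrite take0.
rewrite addSn /prob /= mulr_suml; apply: ler_sum => v _; rewrite -mulrA ler_wpM2l //.
exact: (IH (fun s => P (v :: s)) (f v a)).
Qed.

Lemma poly_exp (R : realType) (C kap : R) j : 0 <= C -> 0 < kap ->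
  exists2 b0 : R, 0 < b0 & forall b, b0 <= b -> C * (b + 1) ^+ j <= expR (kap * b).
Proof.
move=> C0 k0; pose th := kap / (2 * j.+1%:R); have j0 : 0 < j.+1%:R :> R by rewrite ltr0n.
have th0 : 0 < th by rewrite /th divr_gt0 // mulr_gt0.
pose a := th^-1 + 1; have a0 : 0 < a by rewrite addr_gt0 // invr_gt0.
pose b0 := 2 * (C * a ^+ j) / kap + 1.
have CA0 : 0 <= C * a ^+ j by rewrite mulr_ge0 // exprn_ge0 // ltW.
have b00 : 0 < b0 by rewrite ltr_wpDl // divr_ge0 ?(ltW k0) // mulr_ge0.
exists b0 => // b bb; have b_gt0 : 0 < b by exact: lt_le_trans bb.
have H1 : b + 1 <= a * expR (th * b).
  apply: le_trans (_ : a * (1 + th * b) <= _); last by rewrite ler_pM2l // expR_ge1Dx.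
  rewrite /a mulrDl mul1r !mulrDr mulr1 mulKf ?gt_eqF //.
  have := mulr_gt0 th0 b_gt0; have : 0 < th^-1 by rewrite invr_gt0.
  lra.
have H2 : (b + 1) ^+ j <= a ^+ j * expR (kap / 2 * b).
  apply: le_trans (_ : (a * expR (th * b)) ^+ j <= _).
    have B0 : 0 <= b + 1 by rewrite addr_ge0 // ltW.
    by apply: lerXn2r; rewrite ?nnegrE // (le_trans B0).
  rewrite exprMn ler_pM2l ?exprn_gt0 // -expRM_natl ler_expR mulr_natl.
  rewrite -mulrnAl ler_wpM2r ?(ltW b_gt0) // -mulr_natr /th.
  rewrite invfM !mulrA -[leRHS]mulr1 -mulrA ler_wpM2l ?divr_ge0 ?(ltW k0) //.
  by rewrite mulrC ler_pdivrMr // mul1r ler_nat.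
have H3 : C * a ^+ j <= expR (kap / 2 * b).
  apply: le_trans (_ : kap / 2 * b <= _); last by have := expR_ge1Dx (kap / 2 * b); lra.
  have : kap / 2 * b0 <= kap / 2 * b by rewrite ler_wpM2l // divr_ge0 // ltW.
  rewrite /b0 mulrDr mulr1; have -> : kap / 2 * (2 * (C * a ^+ j) / kap) = C * a ^+ j.
    by field; rewrite gt_eqF.
  have : 0 < kap / 2 by rewrite divr_gt0.
  lra.
apply: le_trans (_ : C * (a ^+ j * expR (kap / 2 * b)) <= _); first by rewrite ler_wpM2l.
rewrite mulrA; apply: le_trans (_ : expR (kap / 2 * b) * expR (kap / 2 * b) <= _).
  by rewrite ler_wpM2r // expR_ge0.
by rewrite -expRD -mulrDl ler_expR ler_wpM2r ?(ltW b_gt0) //; lra.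
Qed.

(** A set of at most n sites is the set of values of its enumeration, padded with None to a function
    on 'I_n. *)
Lemma smalls_le (c : nat) (V : lattice c) n : (smalls V n <= #|V|.+1 ^ n)%N.
Proof.
pose F (g : {ffun 'I_n -> option V}) : {set V} := [set x | Some x \in codom g]%SET.
rewrite /smalls; have -> : (#|V|.+1 ^ n = #|{ffun 'I_n -> option V}|)%N.
  by rewrite card_ffun card_option card_ord.
apply: leq_trans (leq_imset_card F _); apply: subset_leq_card; apply/fintype.subsetP => s.
rewrite inE => sn; apply/imsetP.
exists [ffun i : 'I_n => onth (enum s) i] => //; apply/setP => x; rewrite inE.
apply/idP/codomP => [xs|[i]].
  have xi : (index x (enum s) < n)%N.
    by apply: leq_trans sn; rewrite cardE index_mem mem_enum.
  exists (Ordinal xi); rewrite ffunE /= onthE (nth_map x) ?nth_index ?mem_enum //.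
  by rewrite index_mem mem_enum.
rewrite ffunE => e; have : Some x \in map Some (enum s).
  rewrite e onthE; have [lt|ge] := ltnP i (size (enum s)).
    by apply: mem_nth; rewrite size_map.
  by move: e; rewrite onthE nth_default // size_map.
by rewrite mem_map ?mem_enum // => ? ? [].
Qed.

(** * Leaving the safe configurations in exponential time *)

Section NonExit.
Import mathcomp.boot.fintype mathcomp.boot.finset.
Context (R : realType) (h beta : R) (c : nat) (V : lattice c) (n : nat) (L : {set V}).
Context (u0 : coin (@accept R h beta c V)).
Hypotheses (beta_ge0 : 0 <= beta) (V0 : (0 < #|V|)%N) (Ln : (n < #|L|)%N).
Implicit Types (s t : {set V}) (x y : V).

Local Notation w := (@weight R h beta c V u0).
Local Notation stp := (step (u0 := u0) L).

Definition stays s (ns : seq (noise u0)) := forall i, (i <= size ns)%N -> safe h n (om L s ns i).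

Definition add_rate : R := (2 * #|V|%:R)^-1 * expR (- beta * (3 * c%:R + `|h|)).

Lemma add_rate_bounds : 0 <= add_rate <= 1.
Proof.
have q1 : 1 <= #|V|%:R :> R by rewrite ler1n.
have e1 : expR (- beta * (3 * c%:R + `|h|)) <= 1.
  by rewrite -expR0 ler_expR mulNr oppr_le0 mulr_ge0 // addr_ge0 // mulr_ge0.
rewrite /add_rate mulr_ge0 ?invr_ge0 ?mulr_ge0 ?expR_ge0 //=.
apply: mulr_ile1; rewrite ?invr_ge0 ?mulr_ge0 ?expR_ge0 //.
by rewrite invf_le1; lra.
Qed.

Lemma rate_add s x : x \notin s -> expR (- beta * (3 * c%:R + `|h|)) <= rate h beta s x.
Proof.
move=> xs; rewrite /rate ler_expR !mulNr lerN2 ler_wpM2l //.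
rewrite energy_flip (negPf xs) ge_max; apply/andP; split.
  by rewrite addr_ge0 // mulr_ge0.
have f1 : (field x)%:~R <= c%:R :> R.
  rewrite -[c%:R]/((c%:Z)%:~R) ler_int; have := field_le x; lia.
have n1 : 0 <= (nbr s x)%:R :> R by [].
have := ler_norm (- h); rewrite normrN /gap.
have c0 : 0 <= c%:R :> R by [].
lra.
Qed.

Lemma prob_add s x : x \in L -> x \notin s ->
  add_rate <= \sum_(v | stp v s == (x |: s)%SET) w v.
Proof.
move=> xL xs; pose f t : R := (t == (x |: s)%SET)%:R.
have -> : \sum_(v | stp v s == (x |: s)%SET) w v = \sum_v w v * f (stp v s).
  rewrite big_mkcond; apply: eq_bigr => v _; rewrite /f; case: eqP; by rewrite ?mulr1 ?mulr0.
rewrite step_mean //; have fs : f s = 0.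
  rewrite /f; case: eqP => // e; by move: xs; rewrite e setU11.
rewrite fs add0r /add_rate ler_wpM2l ?invr_ge0 ?mulr_ge0 //.
rewrite (bigD1 x) //= subr0; have -> : f (flipx s x) = 1 by rewrite /f /flipx (negPf xs) eqxx.
rewrite mulr1; apply: le_trans (rate_add xs) _; rewrite lerDl; apply: sumr_ge0 => y _.
by rewrite subr0 mulr_ge0 // expR_ge0.
Qed.

Let w0 := @weight_ge0 R h beta c V u0.
Let w1 := weight_sum u0 V0.

Lemma stays_cons s v ns : stays s (v :: ns) -> stays (stp v s) ns.
Proof. by move=> st i ins; have := st i.+1 ins; rewrite /om trajS. Qed.

(** Since L has more than n sites, a free one can be filled at each of j steps, with probability at
    least [add_rate] each; this produces n.+1 pluses and ends safety. *)
Lemma prob_stays_exact j s : s \subset L -> (#|s| + j = n.+1)%N ->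
  prob w j (stays s) <= 1 - add_rate ^+ j.
Proof.
have /andP[r0 r1] := add_rate_bounds.
elim: j s => [|j IH] s sL sj.
  rewrite expr0 subrr prob0 // => ns _ st; have := st 0%N isT; rewrite /om traj0.
  by move/safe_card; rewrite -ltnS -sj addn0 ltnn.
have [x xL xs] : exists2 x, x \in L & x \notin s.
  apply/subsetPn; apply: contraL Ln => Ls; rewrite -leqNgt.
  by apply: leq_trans (subset_leq_card Ls) _; lia.
rewrite /prob /= -/(prob _ _ _).
apply: le_trans (_ : \sum_v (w v - (if stp v s == (x |: s)%SET then w v else 0) * add_rate ^+ j) <= _).
  apply: ler_sum => v _; case: eqP => [e|_].
    rewrite -{2}[w v]mulr1 -mulrBr ler_wpM2l //; apply: le_trans (IH (x |: s)%SET _ _).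
    - by rewrite -e; apply: prob_le => // ns _; exact: stays_cons.
    - by rewrite subUset sub1set xL.
    - by rewrite cardsU1 xs; lia.
  by rewrite mul0r subr0 -{2}[w v]mulr1 ler_wpM2l // prob_le1.
rewrite sumrB w1 -mulr_suml -big_mkcond /= lerD2l lerN2 exprS ler_wpM2r ?exprn_ge0 //.
exact: prob_add.
Qed.

Lemma prob_stays1 s : s \subset L -> prob w n.+1 (stays s) <= 1 - add_rate ^+ n.+1.
Proof.
have /andP[r0 r1] := add_rate_bounds => sL.
have [sn|ns] := leqP #|s| n.+1; last first.
  rewrite prob0 //; first by rewrite subr_ge0 exprn_ile1.
  move=> l _ st; have := st 0%N isT; rewrite /om traj0.
  by move/safe_card; rewrite leqNgt (ltnW ns).
apply: le_trans (_ : prob w (n.+1 - #|s|) (stays s) <= _).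
  rewrite -(prob_take w1 _ (leq_subr #|s| n.+1)); apply: prob_le => // l _ st i.
  by rewrite size_take_min leq_min => /andP[is_ il]; rewrite /om traj_take //; exact: st.
apply: le_trans (prob_stays_exact sL _) _; first by rewrite subnKC.
by rewrite lerD2l lerN2 ler_wiXn2l // leq_subr.
Qed.

Lemma prob_stays k s : s \subset L ->
  prob w (n.+1 * k) (stays s) <= (1 - add_rate ^+ n.+1) ^+ k.
Proof.
have /andP[r0 r1] := add_rate_bounds => sL.
have x0 : 0 <= 1 - add_rate ^+ n.+1 by rewrite subr_ge0 exprn_ile1.
elim: k s sL => [|k IH] s sL; first by rewrite expr0 prob_le1.
pose Q t (ns : seq (noise u0)) := t \subset L /\ stays t ns.
have HQ t : prob w (n.+1 * k) (Q t) <= (1 - add_rate ^+ n.+1) ^+ k.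
  have [tL|ntL] := boolP (t \subset L); last first.
    by rewrite prob0 ?exprn_ge0 // => ns _ []; rewrite (negPf ntL).
  by apply: le_trans (IH t tL); apply: prob_le => // ns _ [].
have := @prob_markov2 R _ w _ (step L) (stays s) Q _ n.+1 _ s w0 w1 HQ (exprn_ge0 _ x0).
rewrite -mulnS => H; rewrite exprS.
apply: le_trans (ler_wpM2r (exprn_ge0 _ x0) (prob_stays1 sL)); apply: le_trans H.
apply: prob_le => // ns nsS st; have nns : (n.+1 <= size ns)%N by rewrite nsS mulnS leq_addr.
split.
  move=> i; rewrite size_takel // => ins; rewrite /om traj_take //.
  by apply: st; exact: leq_trans nns.
split; first exact: om_sub.
move=> i; rewrite size_drop => ins; rewrite /om -traj_drop; apply: st.
by rewrite -leq_subRL.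
Qed.

End NonExit.

(** * Clusters along a covering of time *)

Section Coverings.
Import mathcomp.boot.fintype mathcomp.boot.finset.

Fixpoint reach_radius (n l k : nat) : nat :=
  if k is k'.+1 then let r := reach_radius n l k' in (n * (2 * r + 1) + r)%N else l.

Lemma covered_bounded (c : nat) (V : lattice c) n l k (om : nat -> {set V}) a b :
  covered n k om a b -> (forall i, (a <= i <= b)%N -> (#|om i| <= n)%N) ->
  (forall (A : {set V}) a' b', (a <= a')%N -> (a' <= b' <= b)%N -> (#|A| <= n)%N ->
     (forall i, (a' <= i <= b')%N -> (om i :&: A)%SET != set0) -> bounded l a' b' om) ->
  bounded (reach_radius n l k) a b om.
Proof.
elim: k a => [|k IH] a [ba|] //; try by move=> _ _ p q /conn_ptl /and3P[ap pb _]; have := leq_trans ap pb; rewrite leqNgt ba.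
case=> A [m [An /andP[am mb] mA cov]] omn anc /=.
have rr : (l <= reach_radius n l k)%N.
  by elim: (k) => //= j jh; apply: leq_trans jh _; exact: leq_addl.
apply: (bounded_glue (k := m)).
- by apply: bounded_le rr _; apply: (anc A) => //; rewrite am.
- apply: IH => //.
    by move=> i /andP[mi ib]; apply: omn; rewrite ib andbT (leq_trans am) // ltnW.
  by move=> A' a' b' ma; apply: anc; rewrite (leq_trans am) // ltnW.
- by apply: omn; rewrite am.
Qed.

(** A connection occupies a plus at every time of an interval, so the trajectory is not empty there;
    a safe trajectory is then alive throughout. *)
Lemma conn_lively (c : nat) (V : lattice c) (om : nat -> {set V}) b p q :
  conn 0 b om p q -> exists a e, [/\ (a <= e <= b)%N,
    forall i, (a <= i <= e)%N -> om i != set0 & conn a e om p q].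
Proof.
elim=> [pp|q' r _ [a [e [/andP[ae eb] ne pq]]] qr].
  have /and3P[_ pb pm] := pp; exists p.2, p.2; rewrite leqnn pb; split=> //.
    by move=> i; rewrite -eqn_leq => /eqP <-; apply/set0Pn; exists p.1.
  by apply: conn_refl; rewrite /pt leqnn pm.
have /and3P[_ /and3P[_ rb rm] H] := qr; have /and3P[aq qe qm] := conn_ptr pq.
have tm : (r.2 <= q'.2.+1)%N && (q'.2 <= r.2.+1)%N.
  case/orP: H => /andP[/eqP e1 H1]; first by rewrite e1 leqnSn.
  by case/orP: H1 => /eqP ->; rewrite ?leqnn ?leqnSn //= leqW.
have /andP[t1 t2] := tm.
exists (minn a r.2), (maxn e r.2); split.
- by rewrite geq_max eb rb andbT leq_max geq_min ae.
- move=> i; rewrite geq_min leq_max => /andP[ai ie].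
  have [ii|/negP ni] := boolP (a <= i <= e)%N; first exact: ne.
  have -> : i = r.2 by lia.
  by apply/set0Pn; exists r.1.
have sub t : pt a e om t -> pt (minn a r.2) (maxn e r.2) om t.
  by case/and3P=> at_ te tt; rewrite /pt tt geq_min at_ leq_max te.
apply: (conn_step (conn_sub sub pq)); apply: link_sub qr; first exact: sub (conn_ptr pq).
by rewrite /pt geq_min leq_max leqnn !orbT rm.
Qed.

End Coverings.

Lemma prob_union_le (R : realType) (N : finType) (w : N -> R) k (I : eqType) (r : seq I)
    (E : seq N -> Prop) (F : I -> seq N -> Prop) e :
  (forall v, 0 <= w v) ->
  (forall s, size s = k -> E s -> exists2 i, i \in r & F i s) ->
  (forall i, i \in r -> prob w k (F i) <= e) -> prob w k E <= (size r)%:R * e.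
Proof.
move=> w0 EF Fe; apply: le_trans (prob_union w0 EF) _.
apply: le_trans (_ : \sum_(i <- r) e <= _).
  by rewrite big_seq [leRHS]big_seq; apply: ler_sum.
by rewrite big_const_seq count_predT iter_addr_0 mulr_natl.
Qed.

(** * Induction step on a bounded horizon *)

Section ShortTime.
Import mathcomp.boot.fintype mathcomp.boot.finset.
Context (R : realType) (h beta : R) (c : nat) (V : lattice c) (n : nat).
Context (u0 : coin (@accept R h beta c V)) (delta : R) (k0 m lI : nat) (e1 : R).
Hypotheses (beta_ge0 : 0 <= beta) (V0 : (0 < #|V|)%N) (hi : irrational h).
Hypothesis delta_gap : forall s t : {set V}, (#|s| <= n.+2)%N -> (#|t| <= n.+2)%N ->
  energy h s < energy h t -> energy h s + delta <= energy h t.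
Hypothesis top : forall t : {set V}, (#|t| <= n.+2)%N -> energy h t < k0%:R * delta.

Local Notation w := (@weight R h beta c V u0).

Hypothesis IH : forall (L s : {set V}) k, s \subset L ->
  prob w k (@sprawl R h beta c V u0 n lI L s) <= e1.

Definition anchored_radius := (n.+1 * (2 * (2 * lI + n.+1 + 1) + 1) + lI)%N.
Definition run_radius := reach_radius n.+1 anchored_radius (m * (k0 * k0.+1)).

(** Restrict to the alive interval of the offending connection. With few violations it is covered by
    intervals meeting fixed sets A; if the chain outside each A never sprawls at level n, gluing
    these intervals contradicts the choice of [run_radius]. *)
Lemma sprawl_cases (L s : {set V}) (ns : seq (noise u0)) : s \subset L ->
  sprawl n.+1 run_radius L s ns ->
  (exists2 a, (a <= size ns)%N & [/\ om L s ns a \subset L, alive h n.+1 (om L s ns a) &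
      many n.+1 L (drop a ns) m (om L s ns a)]) \/
  exists2 a, (a <= size ns)%N & exists2 A : {set V}, (#|A| <= n.+1)%N &
    om L s ns a \subset L /\
    sprawl n lI (L :\: A)%SET (om L s ns a :\: A)%SET (drop a ns).
Proof.
move=> sL [b [bns sf nb]].
have [//|no1] := pselect (exists2 a, (a <= size ns)%N &
  [/\ om L s ns a \subset L, alive h n.+1 (om L s ns a) &
      many n.+1 L (drop a ns) m (om L s ns a)]); first by left.
right; apply: contrapT => no2; apply: nb => p q /conn_lively [a [e [/andP[ae eb] ne pq]]].
have ens : (e <= size ns)%N := leq_trans eb bns.
have oL i : (i <= e)%N -> om L s ns i \subset L.
  by move=> ie; apply: om_sub => //; exact: leq_trans ens.
have al i : (a <= i <= e)%N -> alive h n.+1 (om L s ns i).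
  by move=> iae; rewrite /alive ne // andbT sf //; case/andP: iae => _ /leq_trans; apply.
have shift i : om L s ns (a + i) = om L (om L s ns a) (drop a ns) i by rewrite /om traj_drop.
have cov : covered n.+1 (m * (k0 * k0.+1)) (om L s ns) a e.
  rewrite -[e](subnKC ae); apply: covered_shift; under eq_fun do rewrite shift.
  apply: (few_covered beta_ge0 V0 delta_gap hi top).
  - exact: oL.
  - by rewrite size_drop leq_sub2r.
  - by move=> i ie; rewrite -shift; apply: al; lia.
  move=> mn; apply: no1; exists a; first exact: leq_trans ens.
  by split=> //; [exact: oL|apply: al; rewrite leqnn].
apply: (covered_bounded cov _ _ pq).
  by move=> i /al/alive_safe/safe_card.
move=> A a' b' aa /andP[ab' be] An mA.
apply: (anchored_bounded beta_ge0 (A := A)) => //.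
- by rewrite ab' (leq_trans be).
- move=> i /andP[ai ib]; apply/alive_safe/al; rewrite (leq_trans aa ai) (leq_trans ib be) //.
- move=> i /andP[ai ib] sp; apply: no2; exists i; first by rewrite (leq_trans ib) // (leq_trans be).
  by exists A => //; split=> //; apply: oL; rewrite (leq_trans ib).
Qed.

Lemma prob_sprawl_short M (L s : {set V}) : s \subset L ->
  prob w M (sprawl n.+1 run_radius L s) <=
  M.+1%:R * ((smalls1 V n.+1)%:R * eps beta V n.+1 delta) ^+ m +
  M.+1%:R * (smalls V n.+1)%:R * e1.
Proof.
have w0 := @weight_ge0 R h beta c V u0; have w1 := weight_sum u0 V0.
have e10 : 0 <= e1 by apply: le_trans (IH 0 (sub0set set0)); exact: prob_ge0.
have ep0 : 0 <= (smalls1 V n.+1)%:R * eps beta V n.+1 delta by rewrite mulr_ge0 // eps_ge0.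
move=> sL; pose P1 (t : {set V}) (ns : seq (noise u0)) :=
  [/\ t \subset L, alive h n.+1 t & many n.+1 L ns m t].
pose P2 (A t : {set V}) (ns : seq (noise u0)) :=
  t \subset L /\ sprawl n lI (L :\: A)%SET (t :\: A)%SET ns.
have HP1 k t : prob w k (P1 t) <= ((smalls1 V n.+1)%:R * eps beta V n.+1 delta) ^+ m.
  have [/andP[tL al]|no] := boolP ((t \subset L) && alive h n.+1 t).
    apply: le_trans (prob_many u0 beta_ge0 V0 delta_gap k m al tL).
    by apply: prob_le => // ns _ [].
  rewrite prob0 ?exprn_ge0 // => ns _ [tL al _]; by rewrite tL al in no.
have HP2 A k t : prob w k (P2 A t) <= e1.
  have [tL|no] := boolP (t \subset L).
    apply: le_trans (IH k (setSD A tL)); by apply: prob_le => // ns _ [].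
  rewrite prob0 // => ns _ [tL]; by rewrite tL in no.
apply: le_trans (prob_or w0 (fun ns _ => sprawl_cases sL)) _; apply: lerD.
  have -> : M.+1%:R = (size (iota 0 M.+1))%:R :> R by rewrite size_iota.
  apply: (prob_union_le (F := fun a ns => P1 (om L s ns a) (drop a ns)) w0).
    by move=> ns <- [a ans H]; exists a => //; rewrite mem_iota.
  move=> a; rewrite mem_iota /= add0n ltnS => aM; rewrite -(subnKC aM).
  by apply: (prob_markov w0 w1) => t; exact: HP1.
pose r := [seq (a, A) | a <- iota 0 M.+1, A <- enum [set A : {set V} | (#|A| <= n.+1)%N]].
have -> : M.+1%:R * (smalls V n.+1)%:R = (size r)%:R :> R.
  by rewrite size_allpairs size_iota -cardE natrM.
apply: (prob_union_le (F := fun aA ns => P2 aA.2 (om L s ns aA.1) (drop aA.1 ns)) w0).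
  move=> ns nsM [a ans [A An H]]; exists (a, A) => //; rewrite nsM in ans.
  by apply: allpairs_f; rewrite ?mem_iota ?mem_enum ?inE.
move=> _ /allpairsP[[a A] [/= aM _ ->]].
have {}aM : (a <= M)%N by move: aM; rewrite -[_ :: _]/(iota 0 M.+1) mem_iota.
rewrite -(subnKC aM).
by apply: (prob_markov w0 w1) => t; exact: HP2.
Qed.

End ShortTime.

(** * The induction *)

Section Tame.
Import mathcomp.boot.fintype mathcomp.boot.finset.
Context (R : realType) (h : R) (c : nat).
Hypothesis hi : irrational h.

(** All volumes L, starting points and horizons are included: the induction step restarts the chain
    in L :\: A at any time, from whatever lies outside A. *)
Definition tame n := forall K : R, 0 < K -> exists l : nat, exists2 b0 : R, 0 < b0 &
  forall beta : R, b0 <= beta -> forall (V : lattice c) (u0 : coin (@accept R h beta c V)),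
    (0 < #|V|)%N -> #|V|%:R <= beta -> forall (L s : {set V}) k, s \subset L ->
    prob (@weight R h beta c V u0) k (sprawl n l L s) <= expR (- beta * K).

Lemma tame0 : tame 0.
Proof.
move=> K K0; exists 0%N; exists 1 => // beta b1 V u0 V0 _ L s k _.
have w0 := @weight_ge0 R h beta c V u0; have w1 := weight_sum u0 V0.
rewrite prob0 ?expR_ge0 // => ns _ [b [_ sf]]; apply=> p q /conn_ptl /and3P[_ pb pm].
have := safe_card (sf _ pb); rewrite leqn0 cards_eq0 => /eqP e.
by rewrite e inE in pm.
Qed.

Lemma uniform_gap n : exists2 delta : R, 0 < delta & forall (V : lattice c) (s t : {set V}),
  (#|s| <= n)%N -> (#|t| <= n)%N -> energy h s < energy h t -> energy h s + delta <= energy h t.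
Proof.
have [delta d0 H] := energy_gap h (4 * c * n + n); exists delta => // V s t sn tn lt.
have cs := bulk_le sn; have ct := bulk_le tn.
have := H (bulk t - bulk s) (#|t|%:Z - #|s|%:Z).
have -> : (bulk t - bulk s)%:~R - h * (#|t|%:Z - #|s|%:Z)%:~R = energy h t - energy h s.
  by rewrite /energy; move: (bulk t) (bulk s) => a b; rewrite !rmorphB /= -!pmulrn; ring.
rewrite gtr0_norm ?subr_gt0 // => H'.
suff : delta <= energy h t - energy h s by lra.
apply: H'; first by move: (bulk t) (bulk s) cs ct => a b; lia.
  by lia.
by apply/eqP; rewrite gt_eqF // subr_gt0.
Qed.

Lemma energy_top n (V : lattice c) (s : {set V}) : (#|s| <= n)%N ->
  energy h s <= (2 * c * n)%:R + `|h| * n%:R.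
Proof.
move=> sn; rewrite /energy; apply: lerD.
  rewrite -[X in _ <= X]/((2 * c * n)%:Z%:~R) ler_int; have := bulk_le sn.
  move: (bulk s) => a; lia.
rewrite -mulNr; apply: le_trans (_ : `|h| * #|s|%:R <= _).
  by rewrite ler_wpM2r // -normrN ler_norm.
by rewrite ler_wpM2l // ler_nat.
Qed.

Lemma sprawl_take n l (V : lattice c) (beta : R) (u0 : coin (@accept R h beta c V))
    (L s : {set V}) k (ns : seq (noise u0)) : sprawl n l L s (take k ns) -> sprawl n l L s ns.
Proof.
move=> [b [bk sf nb]]; have bk' : (b <= k)%N by apply: leq_trans bk _; rewrite size_take_min geq_minl.
have e i : (i <= b)%N -> om L s (take k ns) i = om L s ns i.
  by move=> ib; rewrite /om traj_take // (leq_trans ib).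
exists b; split.
- by apply: leq_trans bk _; rewrite size_take_min geq_minr.
- by move=> i ib; rewrite -e // sf.
move=> bd; apply: nb; apply: bounded_sub bd => r /and3P[r0 rb rm].
by rewrite /pt rb -e.
Qed.

(** A sprawl first completed after M forces M steps of safety, so every horizon reduces to M. *)
Lemma prob_sprawl_any n l (V : lattice c) (beta : R) (u0 : coin (@accept R h beta c V))
    (L s : {set V}) M k : (0 < #|V|)%N ->
  prob (@weight R h beta c V u0) k (sprawl n l L s) <=
  prob (@weight R h beta c V u0) M (stays n L s) + prob (@weight R h beta c V u0) M (sprawl n l L s).
Proof.
move=> V0; have w0 := @weight_ge0 R h beta c V u0; have w1 := weight_sum u0 V0.
have [kM|Mk] := leqP k M.
  apply: le_trans (_ : prob (@weight R h beta c V u0) M (sprawl n l L s) <= _); last first.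
    by rewrite lerDr prob_ge0.
  rewrite -(prob_take w1 _ kM); apply: prob_le => // ns _; exact: sprawl_take.
rewrite -!(prob_take w1 _ (ltnW Mk)); apply: prob_or => // ns nsk [b [bn sf nb]].
have [Mb|bM] := leqP M b; [left|right].
  move=> i; rewrite size_take_min leq_min => /andP[iM ins]; rewrite /om traj_take //.
  by apply: sf; exact: leq_trans Mb.
have e i : (i <= b)%N -> om L s (take M ns) i = om L s ns i.
  by move=> ib; rewrite /om traj_take // (leq_trans ib) // ltnW.
exists b; split.
- by rewrite size_take_min leq_min bn ltnW.
- by move=> i ib; rewrite e // sf.
move=> bd; apply: nb; apply: bounded_sub bd => r /and3P[r0 rb rm].
by rewrite /pt rb e.
Qed.

Lemma small_no_sprawl n l (V : lattice c) (beta : R) (u0 : coin (@accept R h beta c V))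
    (L s : {set V}) (ns : seq (noise u0)) :
  s \subset L -> (#|L| <= n)%N -> (n <= l)%N -> ~ sprawl n l L s ns.
Proof.
move=> sL Ln nl [b [bn sf]]; apply=> p q pq; apply: leq_trans nl.
have -> : n = (n * (2 * 0 + 1))%N by rewrite muln0 add0n muln1.
apply: (conn_net Ln _ pq) => r /conn_ptr /and3P[_ rb rm]; exists r.1; last by rewrite distxx.
by apply: (subsetP (om_sub sL (leq_trans rb bn))).
Qed.

(** A block of n.+1 steps leaves safety with probability at least expR (- beta * C1), so about expR
    (2 * C1 * beta) blocks are survived with doubly exponentially small probability. The summand 1
    in C1 absorbs the factor (2 * #|V|)^-1 of [add_rate]. *)
Lemma stays_negligible n (K C1 beta : R) (V : lattice c) (u0 : coin (@accept R h beta c V))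
    (L s : {set V}) : 
  C1 = (3 * c%:R + `|h| + 1) * n.+1%:R -> 0 <= beta ->
  2 * (beta + 1) <= expR beta -> (K + 1) * (beta + 1) <= expR (C1 * beta) -> 0 < K ->
  (0 < #|V|)%N -> #|V|%:R <= beta -> (n < #|L|)%N -> s \subset L ->
  exists2 M : nat, M%:R <= 2 * n.+1%:R * expR (2 * C1 * beta) &
    prob (@weight R h beta c V u0) M (stays n L s) <= expR (- beta * (K + 1)).
Proof.
move=> C1E b0 A1 A2 K0 V0 Vb Ln sL.
have q1 : 1 <= #|V|%:R :> R by rewrite ler1n.
have C10 : 0 <= C1 by rewrite C1E mulr_ge0 // !addr_ge0 // mulr_ge0.
pose kk := (Num.truncn (expR (2 * C1 * beta))).+1.
have e1 : 1 <= expR (2 * C1 * beta) by rewrite -expR0 ler_expR !mulr_ge0.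
have kk1 : expR (2 * C1 * beta) <= kk%:R.
  by apply: ltW; rewrite /kk truncnS_gt.
have kk2 : kk%:R <= 2 * expR (2 * C1 * beta).
  rewrite /kk -natr1; have : (Num.truncn (expR (2 * C1 * beta)))%:R <= expR (2 * C1 * beta).
    by rewrite truncn_le // expR_ge0.
  by lra.
exists (n.+1 * kk)%N; first by rewrite natrM -mulrA mulrCA ler_wpM2l.
apply: le_trans (prob_stays u0 b0 V0 Ln kk sL) _.
have r1 : expR (- beta * (3 * c%:R + `|h| + 1)) <= add_rate h beta V.
  rewrite /add_rate mulrDr mulr1 expRD mulrC ler_wpM2r ?expR_ge0 // expRN lef_pV2 ?posrE ?expR_gt0 ?mulr_gt0 //; last by rewrite (lt_le_trans ltr01).
  lra.
have /andP[ar0 ar1] := @add_rate_bounds R h beta c V b0 V0.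
have r2 : expR (- beta * C1) <= add_rate h beta V ^+ n.+1.
  apply: le_trans (_ : expR (- beta * (3 * c%:R + `|h| + 1)) ^+ n.+1 <= _); last first.
    by apply: lerXn2r => //; rewrite nnegrE expR_ge0.
  by rewrite -expRM_natl C1E ler_expR le_eqVlt; apply/orP; left; apply/eqP; ring.
have r3 : 1 - add_rate h beta V ^+ n.+1 <= expR (- expR (- beta * C1)).
  by have := expR_ge1Dx (- expR (- beta * C1)); lra.
apply: le_trans (_ : expR (- expR (- beta * C1)) ^+ kk <= _).
  by apply: lerXn2r => //; rewrite nnegrE ?expR_ge0 // subr_ge0 exprn_ile1.
rewrite -expRM_natl ler_expR mulr_natl -mulr_natr !mulNr lerN2.
apply: le_trans (_ : expR (- beta * C1) * expR (2 * C1 * beta) <= _); last first.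
  by rewrite mulNr ler_wpM2l ?expR_ge0.
rewrite -expRD; have -> : - beta * C1 + 2 * C1 * beta = C1 * beta by ring.
apply: le_trans A2; rewrite mulrC ler_wpM2l //; lra.
Qed.

(** The exponent 3 * n + 5 is n.+2 for [smalls1], twice n.+1 for the square of [smalls], and 1 for
    #|V|; half of the decay of [eps] is spent on this polynomial. *)
Lemma violation_small n (V : lattice c) (delta beta : R) : 0 < beta ->
  (0 < #|V|)%N -> #|V|%:R <= beta ->
  2 * (beta + 1) ^+ (3 * n + 5) <= expR (delta / 4 * beta) ->
  (smalls1 V n.+1)%:R * eps beta V n.+1 delta <= expR (- beta * delta / 4).
Proof.
move=> b0 V0 Vb A.
have b1 : 0 <= beta + 1 by rewrite addr_ge0 // ltW.
have qb : #|V|.+1%:R <= beta + 1 by rewrite -natr1 lerD2r.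
have sm j : (smalls V j)%:R <= (beta + 1) ^+ j.
  apply: le_trans (_ : (#|V|.+1 ^ j)%:R <= _); first by rewrite ler_nat smalls_le.
  by rewrite natrX; apply: lerXn2r; rewrite ?nnegrE.
have sm1 : (smalls1 V n.+1)%:R <= (beta + 1) ^+ n.+2 by exact: sm.
rewrite /eps; set e := expR (- beta * delta / 2); have e0 : 0 <= e by exact: expR_ge0.
apply: le_trans (_ : (beta + 1) ^+ n.+2 * (2 * ((beta + 1) ^+ n.+1) ^+ 2 * (beta + 1) * e) <= _).
  apply: ler_pM => //; first by rewrite !mulr_ge0.
  rewrite ler_wpM2r //; have q2 : #|V|%:R <= beta + 1 by apply: le_trans qb; rewrite ler_nat.
  apply: ler_pM; rewrite ?mulr_ge0 ?exprn_ge0 //.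
  by rewrite ler_wpM2l //; apply: lerXn2r; rewrite ?nnegrE ?exprn_ge0.
have -> : (beta + 1) ^+ n.+2 * (2 * ((beta + 1) ^+ n.+1) ^+ 2 * (beta + 1) * e) =
    2 * (beta + 1) ^+ (3 * n + 5) * e.
  have -> : (3 * n + 5 = n.+2 + (n.+1 * 2 + 1))%N by lia.
  by rewrite !exprD exprM expr1; ring.
apply: le_trans (ler_wpM2r e0 A) _; rewrite /e -expRD ler_expR.
by rewrite le_eqVlt; apply/orP; left; apply/eqP; field.
Qed.

Lemma tameS n : tame n -> tame n.+1.
Proof.
move=> IH K K0.
have [delta d0 dgap] := uniform_gap n.+2.
pose k0 := Num.bound (((2 * c * n.+2)%:R + `|h| * n.+2%:R) / delta).
pose C1 : R := (3 * c%:R + `|h| + 1) * n.+2%:R.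
have C10 : 0 < C1 by rewrite mulr_gt0 // ltr_wpDl // addr_ge0 // mulr_ge0.
(* The probability of m violations is at most expR (- beta * delta / 4) ^+ m; it must outweigh about
   expR (2 * C1 * beta) starting times and leave K + 1 in the exponent. *)
pose m := Num.bound ((K + 2 * C1 + 3) * 4 / delta).
(* The exponent requested at level n also pays for the starting times and for the polynomial number
   of sets A. *)
have K'0 : 0 < K + 2 * C1 + 4 by rewrite !addr_gt0 // mulr_gt0.
have [lI [bI bI0 HI]] := IH _ K'0.
have [b1 b10 A1] := @poly_exp R 2 1 1 (ler0n _ _) ltr01.
have K1 : 0 <= K + 1 by rewrite addr_ge0 // ltW.
have [b2 b20 A2] := poly_exp 1 K1 C10.
have d4 : 0 < delta / 4 by rewrite divr_gt0.
have [b3 b30 A3] := poly_exp (3 * n + 5) (ler0n R 2) d4.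
have [b4 b40 A4] := poly_exp 0 (ler0n R (2 * n.+2 + 1)) ltr01.
have [b5 b50 A5] := poly_exp n.+1 (ler0n R (2 * n.+2 + 1)) (ltr0Sn R 2).
have [b6 b60 A6] := poly_exp 0 (ler0n R 3) ltr01.
exists (maxn n.+1 (run_radius n k0 m lI)); exists (bI + b1 + b2 + b3 + b4 + b5 + b6).
  by rewrite !addr_gt0.
move=> beta bb V u0 V0 Vb L s k sL.
have {A1} A1 := A1 beta _; have {A2} A2 := A2 beta _; have {A3} A3 := A3 beta _.
have {A4} A4 := A4 beta _; have {A5} A5 := A5 beta _; have {A6} A6 := A6 beta _.
have beta0 : 0 < beta by lra.
have w0 := @weight_ge0 R h beta c V u0; have w1 := weight_sum u0 V0.
(* In a volume with at most n.+1 sites the chain may stay safe for ever, but its clusters are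
   confined to L. *)
have [Ls|Ln] := leqP #|L| n.+1.
  rewrite prob0 ?expR_ge0 // => ns _; apply: small_no_sprawl => //; exact: leq_maxl.
have A1' : 2 * (beta + 1) <= expR beta by have := A1; rewrite expr1 mul1r; apply; lra.
have A2' : (K + 1) * (beta + 1) <= expR (C1 * beta) by have := A2; rewrite expr1; apply; lra.
have [M ML PM] := stays_negligible u0 (erefl C1) (ltW beta0) A1' A2' K0 V0 Vb Ln sL.
apply: le_trans (prob_sprawl_any _ _ u0 L s M k V0) _.
have top (t : {set V}) : (#|t| <= n.+2)%N -> energy h t < k0%:R * delta.
  move=> tn; apply: le_lt_trans (energy_top tn) _; rewrite -ltr_pdivrMr //.
  by apply: archi_boundP; rewrite divr_ge0 ?(ltW d0) // addr_ge0 // mulr_ge0.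
have e1P (L' s' : {set V}) k' : s' \subset L' ->
    prob (@weight R h beta c V u0) k' (sprawl n lI L' s') <= expR (- beta * (K + 2 * C1 + 4)).
  by apply: HI => //; lra.
have short := prob_sprawl_short m (ltW beta0) V0 hi (dgap V) top e1P M sL.
(* One unit of exponent absorbs the factor 3 from the three contributions: no exit, many violations,
   a sprawl outside some A. *)
have -> : expR (- beta * K) = expR beta * expR (- beta * (K + 1)).
  by rewrite -expRD; congr expR; ring.
set X := expR (- beta * (K + 1)) in PM *; have X0 : 0 <= X by exact: expR_ge0.
have MX : M.+1%:R <= (2 * n.+2 + 1)%:R * expR (2 * C1 * beta).
  rewrite -natr1 natrD natrM mulrDl mul1r; apply: lerD => //.
  by rewrite -expR0 ler_expR !mulr_ge0 // ltW.
have V3 : (smalls1 V n.+1)%:R * eps beta V n.+1 delta <= expR (- beta * delta / 4).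
  by apply: violation_small => //; apply: A3; lra.
have ep0 : 0 <= (smalls1 V n.+1)%:R * eps beta V n.+1 delta by rewrite mulr_ge0 // eps_ge0.
have T1 : M.+1%:R * ((smalls1 V n.+1)%:R * eps beta V n.+1 delta) ^+ m <= X.
  have H1 : ((smalls1 V n.+1)%:R * eps beta V n.+1 delta) ^+ m <= expR (- beta * (K + 2 * C1 + 3)).
    apply: le_trans (_ : expR (- beta * delta / 4) ^+ m <= _).
      by apply: lerXn2r => //; rewrite nnegrE ?expR_ge0.
    rewrite -expRM_natl ler_expR.
    have mb : K + 2 * C1 + 3 <= m%:R * (delta / 4).
      rewrite -ler_pdivrMr // invf_div mulrA; apply: ltW.
      apply: archi_boundP; rewrite divr_ge0 ?(ltW d0) // mulr_ge0 // !addr_ge0 ?(ltW K0) //.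
      by rewrite mulr_ge0 // ltW.
    have := ler_wpM2l (ltW beta0) mb; lra.
  apply: le_trans (ler_pM _ _ MX H1) _ => //; first exact: exprn_ge0.
  have A4' : (2 * n.+2 + 1)%:R <= expR beta by have := A4; rewrite expr0 mulr1 mul1r; apply; lra.
  apply: le_trans (_ : expR beta * expR (2 * C1 * beta) * expR (- beta * (K + 2 * C1 + 3)) <= _).
    by rewrite !ler_wpM2r ?expR_ge0.
  rewrite -!expRD /X ler_expR; lra.
have T2 : M.+1%:R * (smalls V n.+1)%:R * expR (- beta * (K + 2 * C1 + 4)) <= X.
  have sm : (smalls V n.+1)%:R <= (beta + 1) ^+ n.+1.
    apply: le_trans (_ : (#|V|.+1 ^ n.+1)%:R <= _); first by rewrite ler_nat smalls_le.
    by rewrite natrX; apply: lerXn2r; rewrite ?nnegrE // -?natr1 ?lerD2r // addr_ge0 // ltW.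
  have A5' : (2 * n.+2 + 1)%:R * (beta + 1) ^+ n.+1 <= expR (3 * beta) by apply: A5; lra.
  apply: le_trans (_ : (2 * n.+2 + 1)%:R * expR (2 * C1 * beta) * (beta + 1) ^+ n.+1 *
      expR (- beta * (K + 2 * C1 + 4)) <= _).
    by rewrite ler_wpM2r ?expR_ge0 //; apply: ler_pM.
  apply: le_trans (_ : expR (3 * beta) * expR (2 * C1 * beta) * expR (- beta * (K + 2 * C1 + 4)) <= _).
    by rewrite ler_wpM2r ?expR_ge0 // mulrAC ler_wpM2r ?expR_ge0.
  rewrite -!expRD /X ler_expR; lra.
have A6' : 3 <= expR beta by have := A6; rewrite expr0 mulr1 mul1r; apply; lra.
have sprawl_le : prob (@weight R h beta c V u0) M (sprawl n.+1 (maxn n.+1 (run_radius n k0 m lI)) L s) <=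
    prob (@weight R h beta c V u0) M (sprawl n.+1 (run_radius n k0 m lI) L s).
  apply: prob_le => // ns _ [b [bn sf nb]]; exists b; split=> // bd; apply: nb.
  by apply: bounded_le bd; exact: leq_maxr.
apply: le_trans (_ : 3 * X <= _); last by rewrite ler_wpM2r.
lra.
Qed.

Lemma tame_all n : tame n.
Proof. by elim: n => [|n]; [exact: tame0|exact: tameS]. Qed.

End Tame.

(** * From the lazy chain to the jump chain *)

Section Jumps.
Import mathcomp.boot.fintype mathcomp.boot.finset.
Context (R : realType) (h : R) (c : nat) (V : lattice c) (n l : nat).
Implicit Types (s : {set V}) (p t : seq {set V}) (x : V).

Definition wild t := exists b,
  [/\ (b < size t)%N, forall i, (i <= b)%N -> safe h n (nth set0 t i) &
      ~ bounded l 0 b (nth set0 t)].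

Lemma wild_cat t t' : wild t -> wild (t ++ t').
Proof.
move=> [b [bt sf nb]].
have e i : (i <= b)%N -> nth set0 (t ++ t') i = nth set0 t i.
  by move=> ib; rewrite nth_cat (leq_ltn_trans ib bt).
exists b; split.
- by rewrite size_cat ltn_addr.
- by move=> i ib; rewrite e // sf.
move=> bd; apply: nb; apply: bounded_sub bd => r /and3P[r0 rb rm].
by rewrite /pt rb e.
Qed.

(** A duplicate only stretches time. The map [psi] renumbers times, skipping the index k.+1 of the
    copy; a link from k to k.+1 becomes two links through the copy. *)
Lemma wild_dup p s t : wild (p ++ s :: t) -> wild (p ++ s :: s :: t).
Proof.
move=> [b [bt sf nb]]; set k := size p.
pose u := nth set0 (p ++ s :: t); pose u' := nth set0 (p ++ s :: s :: t).
pose psi i := (i + (k < i))%N.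
have e i : u' (psi i) = u i.
  rewrite /u /u' /psi !nth_cat -/k; case: (ltngtP k i) => ik; rewrite ?addn1 ?addn0.
  - by rewrite ltnNge (leqW (ltnW ik)) /= subSn ?(ltnW ik) // -[(i - k)%N]prednK ?subn_gt0.
  - by rewrite ik.
  - by rewrite -ik ltnn subnn.
have uk : u k = s by rewrite /u nth_cat ltnn subnn.
have u'k : u' k.+1 = s by rewrite /u' nth_cat ltnNge leqW // subSn // subnn.
have psib i : (i <= b)%N -> (psi i <= psi b)%N by rewrite /psi; lia.
exists (psi b); split.
- move: bt; rewrite !size_cat /= /psi; lia.
- move=> i ib; have [ik|ik] := eqVneq i k.+1.
    by rewrite ik in ib *; rewrite -/u' u'k -uk; apply: sf; move: ib; rewrite /psi; lia.
  have -> : i = psi (i - (k < i))%N by rewrite /psi; lia.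
  by rewrite -/u' e; apply: sf; move: ib ik; rewrite /psi; lia.
move=> bd; apply: nb => q r qr.
have ptp z i : pt 0 b u (z, i) -> pt 0 (psi b) u' (z, psi i).
  by case/and3P=> _ ib zi; rewrite /pt /= psib //= e.
suff : conn 0 (psi b) u' (q.1, psi q.2) (r.1, psi r.2) by move/bd.
elim: qr => [qq|r1 r2 _ IH r12]; first by apply: conn_refl; case: (q) qq => *; exact: ptp.
have up z i : pt 0 b u (z, i) -> pt 0 b u (z, i.+1) ->
    conn 0 (psi b) u' (z, psi i) (z, psi i.+1).
  move=> p1 p2; have P1 := ptp _ _ p1; have P2 := ptp _ _ p2.
  have [ik|ik] := eqVneq i k; last first.
    apply: (conn_step (conn_refl P1)); rewrite /link P1 P2 /= eqxx /=.
    by apply/orP; right; apply/orP; left; move: ik; rewrite /psi; lia.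
  have e1 : psi i = k by rewrite ik /psi; lia.
  have e2 : psi i.+1 = k.+2 by rewrite ik /psi; lia.
  rewrite e1 e2 in P1 P2 *.
  have P : pt 0 (psi b) u' (z, k.+1).
    have /and3P[_ _ z1] := p1; have /and3P[_ lb _] := P2.
    by apply/and3P; split => //=; [exact: ltnW|rewrite u'k -uk -ik].
  apply: (@conn_step _ _ _ _ _ _ (z, k.+1)); last by rewrite /link P P2 /= !eqxx orbT.
  by apply: (conn_step (conn_refl P1)); rewrite /link P P1 /= !eqxx orbT.
apply: (conn_trans IH); have /and3P[H1 H2 H3] := r12.
case: r1 H1 H3 {r12 IH} => z1 i1 H1; case: r2 H2 => z2 i2 H2 /=.
case/orP=> /andP[/eqP e1 e2].
  subst i2; have P1 := ptp _ _ H1; have P2 := ptp _ _ H2.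
  by apply: (conn_step (conn_refl P1)); rewrite /link P1 P2 /= eqxx e2.
subst z2; case/orP: e2 => /eqP e2; first by subst i2; exact: up.
by subst i1; apply: conn_sym; exact: up.
Qed.

Context (beta : R) (u0 : coin (@accept R h beta c V)).
Hypotheses (beta_ge0 : 0 <= beta) (V0 : (0 < #|V|)%N).
Local Notation w := (@weight R h beta c V u0).

Fixpoint states s (ns : seq (noise u0)) : seq {set V} :=
  s :: if ns is v :: ns' then states (step [set: V] v s) ns' else [::].

Lemma states_size s ns : size (states s ns) = (size ns).+1.
Proof. by elim: ns s => [//|v ns IH] s /=; rewrite IH. Qed.

Lemma states_nth s ns i : (i <= size ns)%N -> nth set0 (states s ns) i = om [set: V] s ns i.
Proof.
elim: ns s i => [|v ns IH] s [|i] //=; rewrite ?ltnS => ins; rewrite /om ?traj0 // trajS.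
exact: IH.
Qed.

Lemma states_take s ns k : (k < size ns)%N -> exists t, states s ns = states s (take k ns) ++ t.
Proof.
elim: ns s k => [//|v ns IH] s [|k] /=; first by exists (states (step [set: V] v s) ns).
by move=> kn; have [t ->] := IH (step [set: V] v s) k kn; exists t.
Qed.

(* As wild is preserved by repeating a configuration, the lazy chain and its jump
   chain are compared through the probability that, after the history p, the
   sequence becomes wild. *)
Definition lazyp k p s : R := prob w k (fun ns => wild (p ++ states s ns)).

Lemma lazyp_sprawl k s : lazyp k [::] s = prob w k (sprawl n l [set: V] s).
Proof.
have w0 := @weight_ge0 R h beta c V u0.
have H : forall ns, wild (states s ns) <-> sprawl n l [set: V] s ns.
  move=> ns; split=> -[b [bn sf nb]]; rewrite ?states_size ?ltnS in bn.
    exists b; split=> // [i ib|bd]; first by rewrite -states_nth ?(leq_trans ib) // sf.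
    apply: nb; apply: bounded_sub bd => r /and3P[_ rb rm].
    by rewrite /pt rb -states_nth // (leq_trans rb).
  exists b; rewrite states_size ltnS; split=> // [i ib|bd].
    by rewrite states_nth ?(leq_trans ib) // sf.
  apply: nb; apply: bounded_sub bd => r /and3P[_ rb rm].
  by rewrite /pt rb states_nth // (leq_trans rb).
by apply/eqP; rewrite eq_le; apply/andP; split; apply: prob_le => // ns _ /H.
Qed.

Lemma lazyp_bounds k p s : 0 <= lazyp k p s <= 1.
Proof.
have w0 := @weight_ge0 R h beta c V u0; have w1 := weight_sum u0 V0.
by rewrite prob_ge0 // prob_le1.
Qed.

Lemma lazypS k p s : lazyp k p s <= lazyp k.+1 p s.
Proof.
have w0 := @weight_ge0 R h beta c V u0; have w1 := weight_sum u0 V0.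
rewrite /lazyp -(prob_take w1 _ (leqnSn k)); apply: prob_le => // ns nsk.
have [t ->] : exists t, states s ns = states s (take k ns) ++ t by apply: states_take; rewrite nsk.
by rewrite catA; exact: wild_cat.
Qed.

Lemma lazyp_dup k p s : lazyp k p s <= lazyp k (rcons p s) s.
Proof.
have w0 := @weight_ge0 R h beta c V u0.
apply: prob_le => // ns _; rewrite cat_rcons.
by case: ns => [|v ns] /=; exact: wild_dup.
Qed.

Definition total_rate s := \sum_x rate h beta s x.

Lemma total_rate_gt0 s : 0 < total_rate s.
Proof.
have /card_gt0P[x _] := V0.
rewrite /total_rate (bigD1 x) //= ltr_pwDl ?expR_gt0 //; apply: sumr_ge0 => y _; exact: expR_ge0.
Qed.

(** With the first coefficient as probability the lazy chain repeats s, and by [lazyp_dup] the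
    repetition does not lower the probability of becoming wild; otherwise it flips a site. *)
Lemma lazyp_step k p s :
  (1 - total_rate s / (2 * #|V|%:R)) * lazyp k p s +
  (2 * #|V|%:R)^-1 * \sum_x rate h beta s x * lazyp k (rcons p s) (flipx s x) <= lazyp k.+1 p s.
Proof.
have q1 : 1 <= #|V|%:R :> R by rewrite ler1n.
have -> : lazyp k.+1 p s = \sum_v w v * lazyp k (rcons p s) (step [set: V] v s).
  by rewrite /lazyp /prob /=; apply: eq_bigr => v _; under [in RHS]eq_fun do rewrite cat_rcons.
have sT (F : V -> R) : \sum_(x in [set: V]) F x = \sum_x F x.
  by apply: eq_bigl => x; rewrite inE.
rewrite step_mean // sT; under [in leRHS]eq_bigr do rewrite mulrBr.
rewrite sumrB mulrBr -mulr_suml addrA.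
rewrite -/(total_rate s) addrAC lerD2r.
set F := lazyp k (rcons p s) s; set G := lazyp k p s; set q := 2 * #|V|%:R.
have -> : F - q^-1 * (total_rate s * F) = (1 - total_rate s / q) * F by ring.
apply: ler_wpM2l; last exact: lazyp_dup.
rewrite subr_ge0 ler_pdivrMr ?mul1r; last by rewrite /q; lra.
apply: le_trans (_ : \sum_(x : V) (1 : R) <= _).
  apply: ler_sum => x _; rewrite /rate -expR0 ler_expR mulNr oppr_le0 mulr_ge0 //.
  by rewrite le_max lexx.
by rewrite sumr_const /q; have -> : #|[pred _ : V | true]| = #|V| by []; lra.
Qed.

Definition wildp p s : R := limn (fun k => lazyp k p s).

Lemma lazyp_cvg p s : cvgn (fun k => lazyp k p s).
Proof.
apply: nondecreasing_is_cvgn; first by apply/nondecreasing_seqP => k; exact: lazypS.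
by exists 1 => _ [k _ <-]; have /andP[] := lazyp_bounds k p s.
Qed.

Lemma lazyp_le_wildp k p s : lazyp k p s <= wildp p s.
Proof.
apply: nondecreasing_cvgn_le; last exact: lazyp_cvg.
by apply/nondecreasing_seqP => j; exact: lazypS.
Qed.

Lemma wildp_le p s e : (forall k, lazyp k p s <= e) -> wildp p s <= e.
Proof. by move=> H; apply: limr_le; [exact: lazyp_cvg|exact: nearW]. Qed.

(** As the horizon tends to infinity both sides of [lazyp_step] involve the same function, and the
    laziness cancels: what remains are the transition probabilities of the jump chain. *)
Lemma wildp_super p s :
  \sum_x rate h beta s x / total_rate s * wildp (rcons p s) (flipx s x) <= wildp p s.
Proof.
have q1 : 1 <= #|V|%:R :> R by rewrite ler1n.
pose q : R := 2 * #|V|%:R; have q0 : 0 < q by rewrite /q; lra.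
have H : (1 - total_rate s / q) * wildp p s +
    q^-1 * \sum_x rate h beta s x * wildp (rcons p s) (flipx s x) <= wildp p s.
  pose u k := (1 - total_rate s / q) * lazyp k p s +
    q^-1 * \sum_x rate h beta s x * lazyp k (rcons p s) (flipx s x).
  have uc : u @ \oo --> (1 - total_rate s / q) * wildp p s +
     q^-1 * \sum_x rate h beta s x * wildp (rcons p s) (flipx s x).
    apply: cvgD; first by apply: cvgMr; exact: lazyp_cvg.
    apply: cvgMr; elim: (index_enum V) => [|x r IH].
      by under eq_fun do rewrite big_nil; rewrite big_nil; exact: cvg_cst.
    under eq_fun do rewrite big_cons; rewrite big_cons; apply: cvgD IH.
    by apply: cvgMr; exact: lazyp_cvg.
  rewrite -(cvg_lim _ uc) //; apply: limr_le; first by apply/cvg_ex; eexists; exact: uc.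
  by apply: nearW => k; apply: le_trans (lazyp_step k p s) (lazyp_le_wildp _ _ _).
have t0 := total_rate_gt0 s.
rewrite (eq_bigr (fun x => (total_rate s)^-1 *
  (rate h beta s x * wildp (rcons p s) (flipx s x)))) => [|x _]; last by ring.
rewrite -mulr_sumr ler_pdivrMl //; set S := \sum_x _ in H *.
move: H; rewrite mulrBl mul1r; set T := wildp p s => H.
have : q^-1 * S <= q^-1 * (total_rate s * T) by rewrite mulrA [q^-1 * total_rate s]mulrC; lra.
by rewrite ler_pM2l ?invr_gt0.
Qed.

End Jumps.

(** * Boxes of the integer lattice *)

Section Box.
Context (d : nat).
Implicit Types (x y z : 'rV[int]_d).

Lemma dist1C x y : dist1 x y = dist1 y x.
Proof. by apply: eq_bigr => i _; rewrite distnC. Qed.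

Lemma dist1xx x : dist1 x x = 0%N.
Proof. by apply: big1 => i _; rewrite distnn. Qed.

Lemma dist_supC x y : dist_sup x y = dist_sup y x.
Proof. by apply: eq_bigr => i _; rewrite distnC. Qed.

Lemma dist_supxx x : dist_sup x x = 0%N.
Proof. by apply: big1 => i _; rewrite distnn. Qed.

Lemma dist_sup_tri x y z : (dist_sup x z <= dist_sup x y + dist_sup y z)%N.
Proof.
apply/bigmax_leqP => i _; apply: leq_trans (leqD_dist _ (y 0 i) _) _.
by apply: leq_add; apply: leq_bigmax.
Qed.

Lemma dist_sup_dist1 x y : (dist_sup x y <= dist1 x y)%N.
Proof. by apply/bigmax_leqP => i _; rewrite /dist1 (bigD1 i) //= leq_addr. Qed.

Lemma dist1_eq0 x y : dist1 x y = 0%N -> x = y.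
Proof.
move/eqP; rewrite sum_nat_eq0 => /forallP H; apply/rowP => i.
by have := H i; rewrite implyTb; move: (x 0 i) (y 0 i) => a b; rewrite absz_eq0 subr_eq0 => /eqP.
Qed.

Definition neighbours x : seq 'rV[int]_d :=
  [seq x + delta_mx 0 i | i <- enum 'I_d] ++ [seq x - delta_mx 0 i | i <- enum 'I_d].

Lemma size_neighbours x : size (neighbours x) = (2 * d)%N.
Proof. by rewrite size_cat !size_map -enumT size_enum_ord mul2n addnn. Qed.

Lemma dist1_neighbours x y : dist1 x y = 1%N -> y \in neighbours x.
Proof.
move=> xy; have [i xi] : exists i, x 0 i != y 0 i.
  apply: contrapT => /forallNP H.
  have e : x = y by apply/rowP => i; have /negP := H i; rewrite negbK => /eqP.
  by rewrite e dist1xx in xy.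
have [rest xi1] : (\sum_(j < d | j != i) absz (x 0 j - y 0 j)%R = 0)%N /\ absz (x 0 i - y 0 i)%R = 1%N.
  move: xy; rewrite /dist1 (bigD1 i) //=; have : absz (x 0 i - y 0 i)%R != 0%N.
    by rewrite absz_eq0 subr_eq0.
  by set u := absz _; set w := (\sum_(_ | _) _)%N; clear; move: u w => u w; lia.
have {}rest j : j != i -> x 0 j = y 0 j.
  by move=> ji; move/eqP: rest; rewrite sum_nat_eq0 => /forallP/(_ j); rewrite ji /= absz_eq0 subr_eq0 => /eqP.
rewrite mem_cat; have [le|gt] := lerP (x 0 i) (y 0 i); apply/orP; [left|right].
  apply/mapP; exists i; first by rewrite mem_enum.
  apply/rowP => j; rewrite !mxE eqxx /=; have [->|ji] := eqVneq j i; last by rewrite addr0 rest.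
  by move: xi1 le; clear; move: (x 0 i) (y 0 i) => a b; lia.
apply/mapP; exists i; first by rewrite mem_enum.
apply/rowP => j; rewrite !mxE eqxx /=; have [->|ji] := eqVneq j i; last by rewrite subr0 rest.
by move: xi1 gt; clear; move: (x 0 i) (y 0 i) => a b; lia.
Qed.

End Box.

Section BoxLattice.
Context (d n : nat) (Q : {fset 'rV[int]_d}).
Implicit Types x y : Q.

Definition exterior (x : Q) : set 'rV[int]_d :=
  [set y : 'rV[int]_d | (y \notin Q) && (dist1 (val x) y == 1%N)].

Lemma exterior_finite x : finite_set (exterior x).
Proof.
apply: sub_finite_set (finite_seq (neighbours (val x))) => y /= /andP[_ /eqP].
exact: dist1_neighbours.
Qed.

Definition box_adj (x y : Q) := dist1 (val x) (val y) == 1%N.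
Definition box_dist (x y : Q) := dist_sup (val x) (val y).
(** A single plus in the all-minus box disagrees with each neighbour inside, at cost 1; an exterior
    neighbour costs 1 if minus and gives back 1 if plus. *)
Definition box_field (x : Q) : int := #|[set y | box_adj x y]%SET|%:Z -
  \sum_(y <- fset_set (exterior x)) (if npm_bc n Q y then 1 else -1).

Lemma box_adjC : symmetric box_adj.
Proof. by move=> x y; rewrite /box_adj dist1C. Qed.

Lemma box_adjxx : irreflexive box_adj.
Proof. by move=> x; rewrite /box_adj dist1xx. Qed.

Lemma box_deg2 x : (#|[set y | box_adj x y]%SET| <= 2 * d)%N.
Proof.
rewrite cardE -(size_map val) -(size_neighbours (val x)); apply: uniq_leq_size.
  by rewrite map_inj_uniq ?enum_uniq //; exact: val_inj.
move=> _ /mapP[y + ->]; rewrite mem_enum finset.inE => /eqP; exact: dist1_neighbours.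
Qed.

Lemma box_deg x : (#|[set y | box_adj x y]%SET| <= 4 * d)%N.
Proof. by apply: leq_trans (box_deg2 x) _; rewrite leq_mul2r orbT. Qed.

Lemma box_field_le x : (`|box_field x| <= 4 * d)%N.
Proof.
have H1 := box_deg2 x.
have H2 : (absz (\sum_(y <- fset_set (exterior x)) (if npm_bc n Q y then 1 else -1))%R <= 2 * d)%N.
  apply: (@leq_trans (\sum_(y <- fset_set (exterior x)) 1)%N).
    apply: (big_ind2 (fun (u : int) (w : nat) => (`|u| <= w)%N)) => //.
      by move=> x1 x2 y1 y2 h1 h2; lia.
    by move=> y _; case: ifP.
  rewrite sum1_size -(size_neighbours (val x)); apply: uniq_leq_size; first exact: fset_uniq.
  move=> y; rewrite in_fset_set; last exact: exterior_finite.
  by rewrite inE => /andP[_ /eqP]; exact: dist1_neighbours.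
by rewrite /box_field; lia.
Qed.

Lemma box_dist_adj x y : box_adj x y -> (box_dist x y <= 1)%N.
Proof. by move/eqP => xy; rewrite /box_dist (leq_trans (dist_sup_dist1 _ _)) // xy. Qed.

Definition box_lattice : lattice (4 * d) :=
  @Lattice (4 * d) Q box_adj box_dist box_field box_adjC box_adjxx box_deg box_field_le
    (fun x y => dist_supC _ _) (fun x => dist_supxx _) (fun x y z => dist_sup_tri _ _ _) box_dist_adj.

Context (R : realType) (h : R).

Lemma spinE (b : bool) : spin R b = 2 * b%:R - 1.
Proof. by case: b => /=; ring. Qed.

(** With spins written 2 a - 1, each pair gives a quadratic part, which is [bonds], and linear
    parts, which by symmetry of adjacency are the interior contribution to [box_field]. Subtracting
    the all-minus energy removes the constants. *)
Lemma H_npm_energy (s : config Q) : H_npm n h s = energy h (V := box_lattice) s.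
Proof.
pose a x : R := (x \in s)%:R.
have T1 : (\sum_(x : Q) \sum_(y : Q | dist1 (val x) (val y) == 1%N)
      spin R (x \in s) * spin R (y \in s)) -
   (\sum_(x : Q) \sum_(y : Q | dist1 (val x) (val y) == 1%N)
      spin R (x \in (finset.set0 : config Q)) * spin R (y \in (finset.set0 : config Q))) =
   4 * (bonds (V := box_lattice) s)%:R - 4 * \sum_(x in s) #|[set y | box_adj x y]%SET|%:R.
  have e1 : (bonds (V := box_lattice) s)%:R = \sum_(x : Q) \sum_(y : Q | box_adj x y) a x * a y.
    rewrite bondsE natr_sum; apply: eq_bigr => x _; rewrite natr_sum [RHS]big_mkcond.
    apply: eq_bigr => y _ /=; rewrite /a.
    by case: (x \in s); case: (y \in s); rewrite ?mulr1 ?mulr0 //=; case: ifP.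
  have e2 : \sum_(x in s) #|[set y | box_adj x y]%SET|%:R = \sum_(x : Q) \sum_(y : Q | box_adj x y) a x.
    rewrite big_mkcond; apply: eq_bigr => x _; rewrite sumr_const cardsE /a.
    by case: (x \in s); rewrite ?mul0rn.
  have e3 : \sum_(x : Q) \sum_(y : Q | box_adj x y) a x = \sum_(x : Q) \sum_(y : Q | box_adj x y) a y.
    rewrite (exchange_big_dep xpredT) //=; apply: eq_bigr => x _.
    by apply: eq_bigl => y; rewrite box_adjC.
  have -> : 4 * \sum_(x in s) #|[set y | box_adj x y]%SET|%:R =
     2 * (\sum_(x : Q) \sum_(y : Q | box_adj x y) a x) + 2 * (\sum_(x : Q) \sum_(y : Q | box_adj x y) a y).
    by rewrite -e3 e2; ring.
  rewrite e1 !mulr_sumr -!sumrB -big_split -sumrB /=; apply: eq_bigr => x _.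
  rewrite !mulr_sumr -!sumrB -big_split -sumrB /=; apply: eq_bigr => y _.
  rewrite !spinE /a !finset.in_set0 /=; ring.
have T2 : \sum_(x : Q) spin R (x \in s) - \sum_(x : Q) spin R (x \in (finset.set0 : config Q)) = 2 * #|s|%:R.
  rewrite -sumrB -sum1_card natr_sum mulr_sumr [RHS]big_mkcond; apply: eq_bigr => x _.
  by rewrite !spinE finset.in_set0; case: (x \in s) => /=; ring.
pose ez x : R := \sum_(y <- fset_set (exterior x)) (if npm_bc n Q y then 1 else -1).
have T3e (t : config Q) : (\sum_(x : Q) \sum_(y \in [set y : 'rV[int]_d |
      (y \notin Q) && (dist1 (val x) y == 1%N)]) spin R (x \in t) * spin R (npm_bc n Q y)) =
    \sum_(x : Q) spin R (x \in t) * ez x.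
  apply: eq_bigr => x _; rewrite fsbig_finite /=; last exact: exterior_finite.
  by rewrite /ez mulr_sumr.
have T3 : \sum_(x : Q) spin R (x \in s) * ez x -
    \sum_(x : Q) spin R (x \in (finset.set0 : config Q)) * ez x = 2 * \sum_(x in s) ez x.
  rewrite -sumrB mulr_sumr [RHS]big_mkcond; apply: eq_bigr => x _.
  by rewrite !spinE finset.in_set0; case: (x \in s) => /=; ring.
have := congr1 (fun z => h / 2 * z) T2; rewrite mulrBr => {}T2.
have natB (u : int) (b : nat) : (u - b%:Z)%:~R = u%:~R - b%:R :> R by rewrite rmorphB /= -pmulrn.
rewrite /H_npm /hamiltonian /raw_energy !T3e /energy /bulk natB.
have -> : (\sum_(x in s) field (l := box_lattice) x)%:~R =
    \sum_(x in s) #|[set y | box_adj x y]%SET|%:R - \sum_(x in s) ez x :> R.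
  rewrite rmorph_sum -sumrB; apply: eq_bigr => x _; rewrite rmorphB /= -pmulrn; congr (_ - _).
  rewrite rmorph_sum; apply: eq_bigr => y _ /=; by case: ifP; rewrite ?rmorphN.
lra.
Qed.

End BoxLattice.

(** * Metastable configurations are safe *)

Section Metastable.
Import mathcomp.boot.fintype mathcomp.boot.finset.

Lemma energy_disjoint (R : realType) (h : R) (c : nat) (V : lattice c) (s t : {set V}) :
  (s :&: t)%SET = set0 -> (forall x y, x \in s -> y \in t -> ~~ adj x y) ->
  energy h (s :|: t)%SET = energy h s + energy h t.
Proof.
move=> st0 nadj; have st : disjoint (mem s) (mem t) by rewrite -setI_eq0 st0.
have sumU (T : Type) (idx : T) (op : Monoid.com_law idx) (F : V -> T) :
    \big[op/idx]_(x in (s :|: t)%SET) F x = op (\big[op/idx]_(x in s) F x) (\big[op/idx]_(x in t) F x).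
  by rewrite (eq_bigl [predU s & t]) ?bigU // => x; rewrite finset.in_setU.
have e1 x : x \in s -> nbr (s :|: t)%SET x = nbr s x.
  move=> xs; apply: eq_card => y; rewrite !finset.inE; case ys : (y \in s) => //=.
  by case yt : (y \in t) => //=; apply/negbTE; exact: nadj.
have e2 x : x \in t -> nbr (s :|: t)%SET x = nbr t x.
  move=> xt; apply: eq_card => y; rewrite !finset.inE orbC; case yt : (y \in t) => //=.
  by case ys : (y \in s) => //=; apply/negbTE; rewrite adjC; exact: nadj.
have eb : bonds (s :|: t)%SET = (bonds s + bonds t)%N.
  by rewrite /bonds sumU (eq_bigr _ e1) (eq_bigr _ e2).
have ec : #|(s :|: t)%SET| = (#|s| + #|t|)%N.
  by rewrite cardsU st0 cards0 subn0.
rewrite /energy /bulk eb ec sumU natrD PoszD /= !rmorphB !rmorphD /=; ring.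
Qed.

Context (R : realType) (d n : nat) (h : R) (Q : {fset 'rV[int]_d}).
Implicit Types (s t C A : {set Q}) (x y z : Q).

Local Notation VQ := (box_lattice n Q).
Local Notation rel_in A := [rel a b : Q | [&& a \in A, b \in A & dist1 (val a) (val b) == 1%N]].

Lemma rel_in_sym A : symmetric (rel_in A).
Proof. by move=> x y /=; rewrite andbCA dist1C. Qed.

Lemma path_exits A C x y : connect (rel_in A) x y -> x \in C -> y \notin C ->
  exists u v, [/\ u \in C, v \in A, v \notin C & box_adj u v].
Proof.
case/connectP=> p; elim: p x => [|z p IH] x /=; first by move=> _ -> ->.
case/andP=> /and3P[xA zA xz] zp yE xC yC.
have [zC|zC] := boolP (z \in C); first exact: IH zp yE zC yC.
by exists x, z.
Qed.

Lemma component_isolated s C x y : is_component s C -> x \in C -> y \in s -> y \notin C ->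
  ~~ box_adj x y.
Proof.
case/andP=> _ /maxsetP[/andP[Cs Ccon] Cmax] xC ys yC; apply/negP => xy.
have : (y |: C)%SET = C; last by move=> e; rewrite -e setU11 in yC.
apply: Cmax; last exact: subsetUr.
rewrite subUset sub1set ys Cs /=.
have conx z : z \in (y |: C)%SET -> connect (rel_in (y |: C)%SET) x z.
  rewrite inE => /orP[/set1P ->|zC].
    by apply: connect1; rewrite /= !inE xC eqxx orbT.
  have /forall_inP/(_ x xC)/forall_inP/(_ z zC) := Ccon.
  apply: connect_sub => a b /= /and3P[aC bC ab]; apply: connect1.
  by rewrite /= !inE aC bC !orbT.
apply/forall_inP => a aC; apply/forall_inP => b bC.
apply: connect_trans (conx b bC).
by rewrite sym_connect_sym; [exact: conx|exact: rel_in_sym].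
Qed.

Context (v : nat) (calD : {set config Q}).
Hypothesis card_le : forall s, s \in calD -> (#|s| <= v)%N.
Hypothesis comp_pos : forall s C, s \in calD -> is_component s C ->
  H_npm n h C > H_npm n h (finset.set0 : config Q).
Hypothesis down : forall s t, s \in calD -> t \subset s ->
  H_npm n h t <= H_npm n h s -> t \in calD.

(** Let t be a nonempty subset of s of nonpositive energy with fewest sites. It is connected, for
    otherwise energies would add over two separated parts, one of which would be smaller and no
    better. Let C be the component of s containing t; its energy is positive by (b). Replacing C by
    t lowers the energy, so (c) keeps the result in calD; there t is a component, and (b) makes its
    energy positive, a contradiction. *)
Lemma metastable_safe s : s \in calD -> safe (V := VQ) h v s.
Proof.
move=> sD; rewrite /safe card_le //; apply/forallP => t0; apply/implyP => /andP[t0s t00].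
rewrite ltNge; apply/negP => t0neg.
pose bad t := [&& t \subset s, t != set0 & energy h (V := VQ) t <= 0].
have bt0 : bad t0 by apply/and3P.
pose t := [arg min_(t < t0 | bad t) #|t|].
have [/and3P[ts tne tneg] tmin] : bad t /\ forall r, bad r -> (#|t| <= #|r|)%N.
  by rewrite /t; case: arg_minnP.
have split_no t1 : t1 \subset t -> t1 != set0 -> t1 != t ->
    (forall x y, x \in t1 -> y \in (t :\: t1)%SET -> ~~ box_adj x y) -> False.
  move=> t1t t1ne t1neq nadj.
  have tE : t = (t1 :|: (t :\: t1))%SET by rewrite -{1}(setID t t1) (setIidPr t1t).
  have pr : t1 \proper t by rewrite properEneq t1neq.
  have e : energy h (V := VQ) t = energy h (V := VQ) t1 + energy h (V := VQ) (t :\: t1)%SET.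
    rewrite {1}tE; apply: energy_disjoint => //.
    by apply/setP => z; rewrite !inE; case: (z \in t1).
  have [le1|gt1] := leP (energy h (V := VQ) t1) 0.
    have b1 : bad t1 by apply/and3P; split => //; exact: subset_trans ts.
    by have := tmin _ b1; rewrite leqNgt proper_card.
  have b2 : bad (t :\: t1)%SET.
    apply/and3P; split; first by rewrite (subset_trans _ ts) // subsetDl.
      by apply: contraNneq t1neq => /eqP; rewrite setD_eq0 => tt1; rewrite eqEsubset t1t.
    by move: tneg; rewrite e; lra.
  have := tmin _ b2; rewrite cardsD (setIidPr t1t) leqNgt ltn_subrL card_gt0 t1ne /=.
  by rewrite card_gt0 tne.
have tcon : nn_connected t.
  apply/forall_inP => x xt; apply/forall_inP => y yt; apply: contrapT => /negP nxy.
  pose t1 := [set z in t | connect (rel_in t) x z]%SET.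
  apply: (split_no t1).
  - by apply/subsetP => z; rewrite inE => /andP[].
  - by apply/set0Pn; exists x; rewrite inE xt connect0.
  - by apply: contraNneq nxy => e; have := yt; rewrite -{1}e inE => /andP[].
  move=> z w; rewrite !inE => /andP[zt xz] /andP[nw wt]; rewrite wt /= in nw.
  apply: contra nw => zw; apply: connect_trans xz _; apply: connect1.
  by rewrite /= zt wt.
have [|C Cmax tC] := @maxset_exists _ (fun A : {set Q} => (A \subset s) && nn_connected A) t.
  by rewrite ts tcon.
have Ccomp : is_component s C.
  rewrite /is_component Cmax andbT; apply: contraNneq tne => C0.
  by rewrite C0 subset0 in tC.
have Cs : C \subset s by have /andP[] := maxsetp Cmax.
have Cpos : 0 < energy h (V := VQ) C.
  by have := comp_pos sD Ccomp; rewrite !H_npm_energy energy0.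
pose s' := ((s :\: C) :|: t)%SET.
have sE : s = ((s :\: C) :|: C)%SET by rewrite setUC -{1}(setID s C) (setIidPr Cs).
have dsj : ((s :\: C) :&: C)%SET = set0 by apply/setP => z; rewrite !inE; case: (z \in C); rewrite ?andbF.
have nadj x y : x \in (s :\: C)%SET -> y \in C -> ~~ box_adj x y.
  by rewrite inE => /andP[xC xs] yC; rewrite box_adjC; exact: (component_isolated Ccomp).
have es : energy h (V := VQ) s = energy h (V := VQ) (s :\: C)%SET + energy h (V := VQ) C.
  by rewrite {1}sE; apply: energy_disjoint.
have es' : energy h (V := VQ) s' = energy h (V := VQ) (s :\: C)%SET + energy h (V := VQ) t.
  apply: energy_disjoint; first by apply/eqP; rewrite -subset0 -dsj setIS.
  by move=> x y xs /(subsetP tC); exact: nadj.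
have s's : s' \subset s by rewrite subUset subsetDl.
have s'D : s' \in calD by apply: (down sD s's); rewrite !H_npm_energy es es'; lra.
have tcomp : is_component s' t.
  rewrite /is_component tne; apply/maxsetP; split; first by rewrite subsetUr.
  move=> B /andP[Bs' Bcon] tB; apply/eqP; rewrite eqEsubset tB andbT.
  apply/subsetP => z zB; apply: contrapT => /negP zt.
  have /set0Pn[x xt] := tne.
  have zC : z \notin C.
    by have := subsetP Bs' z zB; rewrite !inE (negPf zt) orbF => /andP[].
  have /forall_inP/(_ x (subsetP tB _ xt))/forall_inP/(_ z zB) xz := Bcon.
  have [u [w [uC wB wC uw]]] := path_exits xz (subsetP tC _ xt) zC.
  have ws : w \in s by apply: (subsetP s's); exact: (subsetP Bs').
  by have := component_isolated Ccomp uC ws wC; rewrite uw.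
by have := comp_pos s'D tcomp; rewrite !H_npm_energy energy0 ltNge tneg.
Qed.

End Metastable.

(** * Trajectories in continuous time *)

Section Trajectory.
Context (R : realType) (d n : nat) (Q : {fset 'rV[int]_d}) (calD : {set config Q}).
Context (y : nat -> config Q) (J : nat -> R) (traj : R -> config Q).
Hypotheses (J0 : J 0%N = 0) (J_lt : forall k, J k < J k.+1) (J_oo : J k @[k --> \oo] --> +oo).
Hypothesis trajE : forall t k, J k <= t < J k.+1 -> traj t = y k.
Implicit Types (p q : Q * R) (z : Q * nat) (x : Q) (k b : nat) (t : R).

Local Notation VQ := (box_lattice n Q).
Local Notation tau := (exit_time calD traj).
Local Notation pp := (plus_point traj 0 tau).
Local Notation lnk := (linked traj 0 tau).
Local Notation rt := (clos_refl_trans (Q * R) lnk).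
Local Notation conn := (@conn (4 * d) VQ).

Lemma J_le k k' : (k <= k')%N -> J k <= J k'.
Proof. by move=> kk; rewrite -(subnKC kk); elim: (k' - k)%N => [|j IH]; rewrite ?addn0 ?addnS // (le_trans IH) // ltW. Qed.

Lemma J_ge0 k : 0 <= J k. Proof. by rewrite -J0 J_le. Qed.

Lemma idx_ex t : 0 <= t -> exists k, J k <= t < J k.+1.
Proof.
move=> t0; have : exists k, t < J k.
  have /cvgryPgt/(_ t) [k _ H] := J_oo; exists k; exact: H k (leqnn k).
move=> ex; case: (ex_minnP ex) => -[|k] tk kmin; first by rewrite J0 ltNge t0 in tk.
by exists k; rewrite tk andbT leNgt; apply/negP => /kmin; rewrite ltnn.
Qed.

Lemma idx_le t t' k k' : J k <= t -> t <= t' -> t' < J k'.+1 -> (k <= k')%N.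
Proof.
move=> kt tt tk; rewrite leqNgt; apply/negP => kk.
by have := J_le kk; rewrite leNgt (le_lt_trans kt) // (le_lt_trans tt).
Qed.

(** The configuration of index b itself may lie outside [calD]: the trajectory is observed up to and
    including the exit time. *)
Definition live b := forall j, (j < b)%N -> y j \in calD.

Lemma live_le b b' : (b' <= b)%N -> live b -> live b'.
Proof. by move=> bb lb j jb; apply: lb; exact: leq_trans bb. Qed.

Lemma traj_J k : traj (J k) = y k.
Proof. by apply: trajE; rewrite lexx J_lt. Qed.

Lemma tau_le k : y k \notin calD -> (tau <= (J k)%:E)%E.
Proof.
move=> yk; apply: ereal_inf_lbound; exists (J k) => //; split; first exact: J_ge0.
by rewrite traj_J.
Qed.

Lemma tau_ge k : live k -> ((J k)%:E <= tau)%E.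
Proof.
move=> lk; apply: le_ereal_inf_tmp => _ [t [t0 tD] <-]; rewrite lee_fin.
have [k' /[dup] /trajE tE /andP[k1 k2]] := idx_ex t0; rewrite tE in tD.
apply: le_trans k1; apply: J_le; rewrite leqNgt; apply/negP => kk.
by rewrite (lk _ kk) in tD.
Qed.

Lemma pp_idx p : pp p -> exists k, [/\ J k <= p.2 < J k.+1, live k & p.1 \in y k].
Proof.
case=> p0 ptau pm; have [k pk] := idx_ex p0; exists k; split=> //; last by rewrite -(trajE pk).
move=> j jk; apply: contraT => /tau_le tj; have /andP[k1 _] := pk.
have := le_trans ptau tj; rewrite lee_fin leNgt (lt_le_trans (J_lt j)) //.
by apply: le_trans k1; exact: J_le.
Qed.

Lemma pp_J x k : live k -> x \in y k -> pp (x, J k).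
Proof. by move=> lk xk; split=> /=; [exact: J_ge0|exact: tau_ge|rewrite traj_J]. Qed.

(** The horizon is existential because the trajectory may never exit. *)
Definition joined z z' := exists2 b, live b & conn 0 b y z z'.

Lemma conn_widen b b' z z' : (b <= b')%N -> conn 0 b y z z' -> conn 0 b' y z z'.
Proof.
move=> bb; apply: conn_sub => r /and3P[_ rb rm]; apply/and3P; split=> //.
exact: leq_trans bb.
Qed.

Lemma joined_trans z1 z2 z3 : joined z1 z2 -> joined z2 z3 -> joined z1 z3.
Proof.
move=> [b lb c1] [b' lb' c2]; exists (maxn b b').
  by rewrite /maxn; case: ifP.
by apply: (conn_trans (conn_widen (leq_maxl b b') c1)); exact: conn_widen (leq_maxr b b') c2.
Qed.

Lemma joined_sym z1 z2 : joined z1 z2 -> joined z2 z1.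
Proof. by move=> [b lb /conn_sym c1]; exists b. Qed.

Lemma joined_refl z : live z.2 -> z.1 \in y z.2 -> joined z z.
Proof. by move=> lz zm; exists z.2 => //; apply: conn_refl; rewrite /pt leqnn. Qed.

Lemma joinedl z z' : joined z z' -> live z.2 /\ z.1 \in y z.2.
Proof. by move=> [b lb /conn_ptl/and3P[_ zb zm]]; split=> //; exact: live_le lb. Qed.

Lemma lnk_sym p q : lnk p q -> lnk q p.
Proof.
case=> pp_ pq H; split=> //; case: H => -[e H]; [left|right]; split=> //.
  by rewrite dist1C.
by move=> v vm; rewrite -e; apply: H; rewrite minC maxC.
Qed.

Lemma rt_sym p q : rt p q -> rt q p.
Proof.
elim=> [p' q' /lnk_sym|p'|p1 p2 p3 _ IH1 _ IH2]; [exact: rt_step|exact: rt_refl|].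
exact: rt_trans IH2 IH1.
Qed.

Lemma lnk_joined p q k k' : lnk p q -> J k <= p.2 < J k.+1 -> J k' <= q.2 < J k'.+1 ->
  joined (p.1, k) (q.1, k').
Proof.
wlog: p q k k' / p.2 <= q.2 => [WL lpq pk qk|le].
  have [|/ltW] := leP p.2 q.2; first by move/WL; apply.
  by move/WL=> H; apply: joined_sym; apply: H => //; exact: lnk_sym.
case=> P1 P2 H /andP[pk1 pk2] /andP[qk1 qk2].
have uniq_idx r j j' : J j <= r < J j.+1 -> J j' <= r < J j'.+1 -> j = j'.
  by move=> /andP[a1 a2] /andP[b1 b2]; apply/eqP; rewrite eqn_leq !(@idx_le r r).
have [j [jp lj jm]] := pp_idx P1; have [j' [jq lj' jm']] := pp_idx P2.
have ej : j = k by apply: uniq_idx jp _; rewrite pk1.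
have ej' : j' = k' by apply: uniq_idx jq _; rewrite qk1.
subst j j'; case: H => -[e H].
  have ek : k = k' by apply: uniq_idx jp _; rewrite e.
  subst k'; have [adjpq|nadj] := boolP (box_adj p.1 q.1).
    exists k => //; apply: (@conn_step _ VQ _ _ _ _ (p.1, k)).
      by apply: conn_refl; rewrite /pt leqnn.
    by rewrite /link /pt /= leqnn jm jm' eqxx /= adjpq.
  have d0 : dist1 (val p.1) (val q.1) = 0%N by move: H nadj; rewrite /box_adj; lia.
  have -> : q.1 = p.1 by apply: val_inj; rewrite (dist1_eq0 d0).
  exact: joined_refl.
have kk : (k <= k')%N by exact: idx_le pk1 le qk2.
exists k' => //; rewrite -e.
have mem j : (k <= j <= k')%N -> p.1 \in y j.
  move=> /andP[kj jk]; have [<-|kj'] := eqVneq k j; first exact: jm.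
  rewrite -traj_J; apply: H; rewrite (min_idPl le) (max_idPr le).
  rewrite (le_trans _ qk1) ?J_le // andbT; apply: ltW; apply: lt_le_trans pk2 _.
  by apply: J_le; rewrite ltn_neqAle kj'.
have H1 j : (k <= j <= k')%N -> conn 0 k' y (p.1, k) (p.1, j).
  move=> /andP[kj]; rewrite -(subnKC kj); elim: (j - k)%N => [|i IH] ik.
    by rewrite addn0; apply: conn_refl; apply/and3P; split=> //=; apply: mem; rewrite leqnn kk.
  have ik' : (k + i <= k')%N by rewrite (leq_trans _ ik) // leq_add2l.
  have M1 : p.1 \in y (k + i)%N by apply: mem; rewrite leq_addr.
  have M2 : p.1 \in y (k + i.+1)%N by apply: mem; rewrite leq_addr.
  apply: (conn_step (IH ik')); apply/and3P; split; [exact/and3P|exact/and3P|].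
  by rewrite /= addnS !eqxx orbT.
by apply: H1; rewrite kk leqnn.
Qed.

Lemma rt_joined p q k : rt p q -> pp p -> J k <= p.2 < J k.+1 ->
  exists k', [/\ pp q, J k' <= q.2 < J k'.+1 & joined (p.1, k) (q.1, k')].
Proof.
move=> /clos_rt_rtn1_iff H P pk; elim: H => [|q1 q2 q12 _ [k' [P1 k1 c1]]].
  have [j [jp lj jm]] := pp_idx P; exists k; split=> //.
  have <- : j = k; last exact: joined_refl.
  have /andP[a1 a2] := jp; have /andP[b1 b2] := pk.
  by apply/eqP; rewrite eqn_leq !(@idx_le p.2 p.2).
have P2 : pp q2 by case: q12.
have [k2 [kp2 _ _]] := pp_idx P2; exists k2; split=> //.
exact: joined_trans c1 (lnk_joined q12 k1 kp2).
Qed.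

Lemma conn_rt b z z' : live b -> conn 0 b y z z' -> rt (z.1, J z.2) (z'.1, J z'.2).
Proof.
move=> lb; elim=> [_|z1 z2 _ IH z12]; first exact: rt_refl.
apply: rt_trans IH _; apply: rt_step; have /and3P[/and3P[_ b1 m1] /and3P[_ b2 m2] H] := z12.
split=> /=; [by apply: pp_J => //; exact: live_le lb|by apply: pp_J => //; exact: live_le lb|].
case/orP: H => /andP[/eqP e H]; first by left; rewrite e; split=> //; rewrite (eqP H).
right; split=> // t; rewrite ge_min le_max => /andP[t1 t2].
have stay k : z1.1 \in y k -> z1.1 \in y k.+1 -> J k <= t <= J k.+1 -> z1.1 \in traj t.
  move=> mk mk1 /andP[kt tk]; move: tk; rewrite le_eqVlt => /orP[/eqP ->|tk]; first by rewrite traj_J.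
  by rewrite (@trajE t k) // kt.
rewrite -e in m2.
have between a : (J a <= t) || (J a.+1 <= t) -> (t <= J a) || (t <= J a.+1) -> J a <= t <= J a.+1.
  by move=> o1 o2; have := J_lt a; case/orP: o1 => ?; case/orP: o2 => ? ?; apply/andP; split; lra.
have {}H : z2.2 = z1.2.+1 \/ z1.2 = z2.2.+1 by case/orP: H => /eqP; [left|right].
case: H => h1; rewrite h1 in m1 m2 t1 t2.
  by apply: (stay z1.2) => //; exact: between.
by apply: (stay z2.2) => //; apply: between; rewrite orbC.
Qed.

Lemma joined_rt z z' : joined z z' -> rt (z.1, J z.2) (z'.1, J z'.2).
Proof. by move=> [b lb]; exact: conn_rt. Qed.

Lemma rt_idx p k : pp p -> J k <= p.2 < J k.+1 -> rt p (p.1, J k).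
Proof.
move=> P pk; have [j [jp lj jm]] := pp_idx P.
have ej : j = k.
  have /andP[a1 a2] := jp; have /andP[b1 b2] := pk.
  by apply/eqP; rewrite eqn_leq !(@idx_le p.2 p.2).
subst j; apply: rt_step; split=> //; first exact: pp_J.
right; split=> // t; have /andP[k1 k2] := pk; rewrite /= (min_idPr k1) (max_idPl k1) => /andP[t1 t2].
by rewrite (@trajE t k) // t1 (le_lt_trans t2).
Qed.

Definition cl z : set (Q * R) := [set q | rt (z.1, J z.2) q].

Lemma cl_eq z z' : joined z z' -> cl z = cl z'.
Proof.
move=> /joined_rt zz; apply/seteqP; split=> q /= H; last exact: rt_trans zz H.
exact: rt_trans (rt_sym zz) H.
Qed.

Lemma cl_mem z q : live z.2 -> z.1 \in y z.2 -> cl z q ->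
  exists k, [/\ pp q, J k <= q.2 < J k.+1 & joined z (q.1, k)].
Proof.
move=> lz zm H; have := @rt_joined (z.1, J z.2) q z.2 H (pp_J lz zm).
rewrite /= lexx J_lt => /(_ isT).
by case: z {lz zm H}.
Qed.

Lemma cl_joined z z' : live z.2 -> z.1 \in y z.2 -> cl z (z'.1, J z'.2) -> joined z z'.
Proof.
move=> lz zm /(cl_mem lz zm)[k [_ /andP[k1 k2] c1]].
have <- : (z'.1, k) = z'.
  case: z' k1 k2 {c1} => x' k' /= k1 k2; congr (_, _); apply/eqP; rewrite eqn_leq.
  by rewrite !(@idx_le (J k') (J k')) // J_lt.
exact: c1.
Qed.

Lemma STC_P C : STC traj 0 tau C <-> exists z, [/\ live z.2, z.1 \in y z.2 & C = cl z].
Proof.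
split=> [[p P ->]|[z [lz zm ->]]]; last by exists (z.1, J z.2) => //; exact: pp_J.
have [k [pk lk pm]] := pp_idx P; exists (p.1, k); split=> //=.
have H := rt_idx P pk; apply/seteqP; split=> q /= Hq; last exact: rt_trans H Hq.
exact: rt_trans (rt_sym H) Hq.
Qed.

(** For live k, the second alternative means that J k is the exit time. *)
Definition isend k := (k == 0%N) || (y k \notin calD).

Lemma meets_P z : live z.2 -> z.1 \in y z.2 ->
  meets_ends 0 tau (cl z) <-> exists2 z', joined z z' & isend z'.2.
Proof.
move=> lz zm; split=> [[q Cq H]|[z' zz ez]].
  have [k [P qk c1]] := cl_mem lz zm Cq; exists (q.1, k) => //=; rewrite /isend.
  have /andP[k1 k2] := qk.
  case: H => H.
    by apply/orP; left; rewrite -leqn0; apply: (@idx_le q.2 0) => //; rewrite ?H // -J0 J_lt.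
  apply/orP; right; apply/negP => yk.
  have lk : live k.+1.
    have [_ lk] : True /\ live k by split=> //; have [] := joinedl (joined_sym c1).
    by move=> j; rewrite ltnS leq_eqVlt => /orP[/eqP ->|/lk].
  by have := tau_ge lk; rewrite -H lee_fin leNgt k2.
have [lz' zm'] := joinedl (joined_sym zz).
exists (z'.1, J z'.2); first exact: joined_rt.
case/orP: ez => [/eqP ->|ez]; [by left|right].
by apply/eqP; rewrite eq_le tau_ge // tau_le.
Qed.

Definition span := (\max_(x : Q) \max_(x' : Q) dist_sup (val x) (val x'))%N.

Lemma le_span x x' : (dist_sup (val x) (val x') <= span)%N.
Proof.
by apply: leq_trans (leq_bigmax x); exact: (leq_bigmax (F := fun x' : Q => dist_sup (val x) (val x')) x').
Qed.

(** The distances are natural numbers bounded by the extent of the box, so the supremum is a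
    maximum. *)
Lemma diam_att z : live z.2 -> z.1 \in y z.2 ->
  exists q q' : Q * nat, [/\ joined z q, joined z q' &
    diam_cluster (cl z) = ((dist_sup (val q.1) (val q'.1))%:R : R)%:E].
Proof.
move=> lz zm.
pose P m := `[< exists q q' : Q * nat, [/\ joined z q, joined z q' & m = dist_sup (val q.1) (val q'.1)] >].
have exP : exists m, P m by exists (dist_sup (val z.1) (val z.1)); apply/asboolP; exists z, z; split=> //; exact: joined_refl.
have ubP m : P m -> (m <= span)%N by move/asboolP=> [q [q' [_ _ ->]]]; exact: le_span.
case: (ex_maxnP exP ubP) => m /asboolP[q [q' [zq zq' mE]]] mmax.
exists q, q'; split=> //; apply/eqP; rewrite eq_le; apply/andP; split.
  apply: ge_ereal_sup => _ [p1 [p2 [C1 C2 ->]]]; rewrite lee_fin ler_nat -mE; apply: mmax.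
  have [k1 [_ _ c1]] := cl_mem lz zm C1; have [k2 [_ _ c2]] := cl_mem lz zm C2.
  by apply/asboolP; exists (p1.1, k1), (p2.1, k2).
apply: ereal_sup_ubound; exists (q.1, J q.2), (q'.1, J q'.2); split=> //; exact: joined_rt.
Qed.

Lemma diam_ge z (q q' : Q * nat) : joined z q -> joined z q' ->
  (((dist_sup (val q.1) (val q'.1))%:R : R)%:E <= diam_cluster (cl z))%E.
Proof.
move=> zq zq'; apply: ereal_sup_ubound; exists (q.1, J q.2), (q'.1, J q'.2).
by split=> //; exact: joined_rt.
Qed.

(* An entry (z, q, q') records a cluster which meets one of the end slices at z,
   and two of its points. *)
Definition spread_ends m := exists l : seq ((Q * nat) * (Q * nat) * (Q * nat)),
  [/\ (m <= \sum_(e <- l) dist_sup (val e.1.2.1) (val e.2.1))%N,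
      forall e, e \in l -> [/\ isend e.1.1.2, joined e.1.1 e.1.2 & joined e.1.1 e.2] &
      pairwise (fun e e' => `[< ~ joined e.1.1 e'.1.1 >]) l].

Definition spread_middle m := exists q q' : Q * nat,
  [/\ joined q q', (m <= dist_sup (val q.1) (val q'.1))%N &
      forall z, isend z.2 -> ~ joined q z].

Definition widest (e : (Q * nat) * (Q * nat) * (Q * nat)) := [/\ isend e.1.1.2, joined e.1.1 e.1.2,
  joined e.1.1 e.2 &
  diam_cluster (cl e.1.1) = ((dist_sup (val e.1.2.1) (val e.2.1))%:R : R)%:E].

Lemma widest_list (r : seq (set (Q * R))) :
  (forall C, C \in r -> STC traj 0 tau C /\ meets_ends 0 tau C) ->
  exists l, [seq cl e.1.1 | e <- l] = r /\ forall e, e \in l -> widest e.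
Proof.
elim: r => [|C r IH] H; first by exists [::].
have [l [lr lw]] := IH (fun C' Cr => H C' (mem_behead (s := C :: r) Cr)).
have [/STC_P[z [lz zm CE]] mC] := H C (mem_head _ _).
move: mC; rewrite CE => /(meets_P lz zm)[z' zz ez].
have [lz' zm'] := joinedl (joined_sym zz).
have [q [q' [c1 c2 dE]]] := diam_att lz' zm'.
exists ((z', q, q') :: l); split.
  by rewrite map_cons lr; congr (_ :: _); rewrite -(cl_eq zz).
by move=> e; rewrite inE => /orP[/eqP ->|/lw].
Qed.

(** The diameter is built from suprema of natural numbers: to exceed m.-1 strictly is to reach m,
    and finitely many clusters with two points each witness it. The right-hand side reads the jump
    chain alone and quantifies over countable types, which yields measurability. The adjoined 0 is
    excluded by 0 < m. *)
Lemma diam_STC_P m : (0 < m)%N ->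
  ((m%:R : R)%:E <= diam_STC traj 0 tau)%E <-> spread_ends m \/ spread_middle m.
Proof.
move=> m0; have pm : ((m.-1%:R : R)%:E < (m%:R : R)%:E)%E by rewrite lte_fin ltr_nat prednK.
have gtm k : ((m.-1%:R : R)%:E < (k%:R : R)%:E)%E -> (m <= k)%N.
  by rewrite lte_fin ltr_nat -{2}(prednK m0).
rewrite /diam_STC le_max; split.
  case/orP => le; have {le} := lt_le_trans pm le.
    move=> /ereal_sup_gt[_ [A [Afin AS] <-]]; rewrite fsbig_finite //= => gt; left.
    have [|l [lr lw]] := @widest_list (fset_set A).
      by move=> C; rewrite in_fset_set // inE => /AS[].
    exists l; split.
    - apply: gtm; move: gt; rewrite -lr big_map big_seq.
      rewrite (eq_bigr (fun e => ((dist_sup (val e.1.2.1) (val e.2.1))%:R : R)%:E)); last first.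
        by move=> e /lw[].
      by rewrite -big_seq sumEFin -natr_sum.
    - by move=> e /lw[].
    have := fset_uniq (fset_set A); rewrite -lr uniq_pairwise pairwise_map.
    apply: sub_pairwise => e e' /= ne; apply/asboolP => /cl_eq E.
    by rewrite E eqxx in ne.
  move=> /ereal_sup_gt[e [->|[C [/STC_P[z [lz zm ->]] nC <-]]]].
    by rewrite lte_fin ltrn0.
  have [q [q' [c1 c2 ->]]] := diam_att lz zm => /gtm mq; right.
  exists q, q'; split=> //; first exact: joined_trans (joined_sym c1) c2.
  move=> z' ez' qz'; apply: nC; apply/meets_P => //; exists z' => //.
  exact: joined_trans c1 qz'.
case=> [[l [ml lw lp]]|[q [q' [qq mq nq]]]]; apply/orP; [left|right].
  have ru : uniq [seq cl e.1.1 | e <- l].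
    rewrite uniq_pairwise pairwise_map.
    have sub : {in l &, subrel (fun e e' => `[< ~ joined e.1.1 e'.1.1 >])
        (relpre (fun e : (Q * nat) * (Q * nat) * (Q * nat) => cl e.1.1) (fun C C' => C != C'))}.
      move=> e e' el el' /asboolP nj; apply/eqP => E; apply: nj.
      have [_ j1 _] := lw _ el; have [_ j1' _] := lw _ el'.
      have [l1 m1] := joinedl j1.
      apply: cl_joined => //; rewrite E; exact: rt_refl.
    exact: (sub_in_pairwise sub (allss l)).
  apply: esum_ge; exists [set` [seq cl e.1.1 | e <- l]].
    split; first exact: finite_seq.
    move=> _ /= /mapP[e el ->]; have [ee j1 _] := lw _ el; have [l1 m1] := joinedl j1.
    split; first by apply/STC_P; exists e.1.1.
    by apply/meets_P => //; exists e.1.1 => //; exact: joined_refl.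
  rewrite -fsbig_seq //= big_map; apply: le_trans (_ : (\sum_(e <- l) ((dist_sup (val e.1.2.1) (val e.2.1))%:R : R)%:E <= _)%E).
    by rewrite sumEFin -natr_sum lee_fin ler_nat.
  rewrite big_seq [leRHS]big_seq; apply: lee_sum => e /lw[_ j1 j2]; exact: diam_ge.
have [lq qm] := joinedl qq.
apply: le_trans (_ : diam_cluster (cl q) <= _)%E.
  by apply: le_trans (diam_ge (joined_refl lq qm) qq); rewrite lee_fin ler_nat.
apply: ereal_sup_ubound; right; exists (cl q) => //; split; first by apply/STC_P; exists q.
by move=> /(meets_P lq qm)[z' zz ez]; exact: nq zz.
Qed.

End Trajectory.

(** * From bounded clusters to a bounded total diameter *)

Section SpreadBound.
Context (d n v l : nat) (Q : {fset 'rV[int]_d}) (calD : {set config Q}) (y : nat -> config Q).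
Implicit Types (z : Q * nat) (b k m : nat).
Local Notation VQ := (box_lattice n Q).
Local Notation joined := (joined n calD y).
Local Notation live := (live calD y).
Hypotheses (card_le : forall s, s \in calD -> (#|s| <= v)%N) (y0 : y 0%N \in calD).
Hypothesis flips : forall k, exists x, y k.+1 = flip (y k) x.
Hypotheses (vl : (v < l)%N) (calm : forall b, live b.+1 -> bounded (V := VQ) l 0 b y).

Lemma live_card b : live b -> (#|y b| <= v.+1)%N.
Proof.
case: b => [_|k lk]; first exact: leqW (card_le y0).
have [x ->] := flips k; have := card_le (lk k (leqnn _)).
rewrite /flip; case: ifP => xk; last by rewrite cardsU1 xk.
by rewrite (cardsD1 x) xk /= add1n => /ltnW/leqW.
Qed.

(** [calm] controls the times before the exit. The exit slice, with at most v.+1 <= l pluses, is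
    glued to them through the at most v pluses of the preceding configuration. *)
Definition reach_bound := (v * (2 * l + 1) + l)%N.

Lemma joined_dist z z' : joined z z' -> (dist_sup (val z.1) (val z'.1) <= reach_bound)%N.
Proof.
have slice b : live b -> bounded (V := VQ) l b b y.
  move=> lb p q pq; apply: leq_trans vl.
  apply: (@slice_dist _ VQ v.+1 b b y _ b) => //; last by rewrite leqnn.
  by move=> i /andP[bi ib]; have <- : b = i; [lia|exact: live_card].
case=> [[|k] lb]; first by move/(slice _ lb)/leq_trans; apply; rewrite /reach_bound leq_addl.
exact: (bounded_glue (calm lb) (slice _ lb) (card_le (lb k (leqnn _)))).
Qed.

Lemma end_slice k (l' : seq ((Q * nat) * (Q * nat) * (Q * nat))) :
  (forall e, e \in l' -> e.1.1.2 = k /\ joined e.1.1 e.1.2) ->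
  pairwise (fun e e' => `[< ~ joined e.1.1 e'.1.1 >]) l' -> (size l' <= #|y k|)%N.
Proof.
move=> H pw; rewrite -(size_map (fun e => e.1.1.1)) cardE; apply: uniq_leq_size.
  rewrite uniq_pairwise pairwise_map; apply: (sub_in_pairwise _ (allss l') pw).
  move=> e e' el el' /asboolP nj; apply/eqP => E; apply: nj.
  have [ek ej] := H _ el; have [ek' ej'] := H _ el'.
  have -> : e'.1.1 = e.1.1 by rewrite [LHS]surjective_pairing [RHS]surjective_pairing ek ek' E.
  by have [l1 m1] := joinedl ej; exact: joined_refl.
move=> _ /mapP[e el ->]; rewrite mem_enum; have [<- ej] := H _ el.
by have [_] := joinedl ej.
Qed.

(** Distinct clusters meeting one end slice use distinct sites there: at most v initially and at
    most v.+1 at the exit, whence the factor 2 * v + 1. *)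
Lemma spread_bound m : spread_ends n calD y m \/ spread_middle n calD y m ->
  (m <= (2 * v + 1) * reach_bound)%N.
Proof.
case=> [[l' [ml lw pw]]|[q [q' [qq mq _]]]]; last first.
  by apply: leq_trans mq _; apply: leq_trans (joined_dist qq) _; rewrite leq_pmull // addn1.
apply: leq_trans ml _; apply: (@leq_trans (size l' * reach_bound)).
  rewrite -sum1_size big_distrl /= big_seq [leqRHS]big_seq; apply: leq_sum => e /lw[_ j1 j2].
  by rewrite mul1n; apply: joined_dist; exact: joined_trans (joined_sym j1) j2.
rewrite leq_mul2r; apply/orP; right.
pose P (e : (Q * nat) * (Q * nat) * (Q * nat)) := e.1.1.2 == 0%N.
rewrite -(count_predC P l') -!size_filter.
have sub A : pairwise (fun e e' => `[< ~ joined e.1.1 e'.1.1 >]) (seq.filter A l').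
  by apply: subseq_pairwise pw; exact: filter_subseq.
have H1 : (size (seq.filter P l') <= v)%N.
  apply: leq_trans (card_le y0); apply: end_slice => // e.
  by rewrite mem_filter => /andP[/eqP -> /lw[]].
suff : (size (seq.filter (predC P) l') <= v.+1)%N by lia.
case: (seq.filter (predC P) l') (sub (predC P)) (mem_filter (predC P) ^~ l') => // e r pw' mf.
have W e' : e' \in e :: r -> y e'.1.1.2 \notin calD /\ joined e'.1.1 e'.1.2.
  by rewrite mf => /andP[/negPf /= n0 /lw[ee j1 _]]; move: ee; rewrite /isend -/(P e') n0.
have [_ j0] := W e (mem_head _ _); have [l0 _] := joinedl j0.
apply: leq_trans (live_card l0); apply: end_slice => // e' er; have [n1 j1] := W _ er.
split=> //; have [l1 _] := joinedl j1; have [n0 _] := W e (mem_head _ _).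
(* All exit entries have the same index, since no configuration before a live index is outside
   [calD]. *)
case: (ltngtP e'.1.1.2 e.1.1.2) => // lt; first by rewrite (l0 _ lt) in n1.
by rewrite (l1 _ lt) in n0.
Qed.

End SpreadBound.

(** * Measurability and law of the jump chain *)

Section Events.
Context (disp : measure_display) (Omega : measurableType disp).
Implicit Types (P : Omega -> Prop).

Definition event P := measurable [set w | P w].

Lemma event_ext P P' : (forall w, P w <-> P' w) -> event P -> event P'.
Proof. by move=> PP; rewrite /event; congr measurable; apply/seteqP; split=> w /= /PP. Qed.

Lemma event_const (A : Prop) : event (fun _ => A).
Proof.
have [a|na] := pselect A.
  by apply: (@event_ext (fun _ => True)) => //; exact: measurableT.
by apply: (@event_ext (fun _ => False)) => //; exact: measurable0.
Qed.

Lemma event_not P : event P -> event (fun w => ~ P w).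
Proof. exact: measurableC. Qed.

Lemma event_and P P' : event P -> event P' -> event (fun w => P w /\ P' w).
Proof. exact: measurableI. Qed.

Lemma event_or P P' : event P -> event P' -> event (fun w => P w \/ P' w).
Proof. exact: measurableU. Qed.

Lemma event_ex (I : countType) (F : I -> Omega -> Prop) :
  (forall i, event (F i)) -> event (fun w => exists i, F i w).
Proof.
move=> mF; have := countable_bigcupT_measurable (countableP [set: I]) mF.
by congr measurable; apply/seteqP; split=> w [i]; [move=> _|]; exists i.
Qed.

Lemma event_all (I : countType) (F : I -> Omega -> Prop) :
  (forall i, event (F i)) -> event (fun w => forall i, F i w).
Proof.
move=> mF; have := event_not (event_ex (fun i => event_not (mF i))).
apply: event_ext => w; split=> [H i|H [i]]; last by move=> /(_ (H i)).
by apply: contrapT => nF; apply: H; exists i.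
Qed.

Lemma event_imp (A : Prop) P : (A -> event P) -> event (fun w => A -> P w).
Proof.
have [a /(_ a)|na _] := pselect A; first by apply: event_ext => w; split=> [//|]; exact.
by apply: event_ext (event_const True) => w; split.
Qed.

Lemma event_pairwise (T : countType) (r : T -> T -> Omega -> Prop) (l : seq T) :
  (forall t t', event (r t t')) -> event (fun w => pairwise (fun t t' => `[< r t t' w >]) l).
Proof.
move=> mr; elim: l => [|t l IH] /=; first exact: event_const.
apply: (@event_ext (fun w => (forall t', t' \in l -> r t t' w) /\
    pairwise (fun t t' => `[< r t t' w >]) l)).
  move=> w; split=> [[H ->]|/andP[/allP H ->]].
    by rewrite andbT; apply/allP => t' tl; apply/asboolP; exact: H.
  by split=> // t' /H /asboolP.
by apply: event_and IH; apply: event_all => t'; apply: event_imp.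
Qed.

Context (S : finType) (Y : nat -> Omega -> S).
Hypothesis mY : forall k s, event (fun w => Y k w = s).

Lemma event_prefix m (A : seq S -> Prop) : event (fun w => A (mkseq (Y^~ w) m)).
Proof.
elim: m A => [|m IH] A; first exact: (event_const (A [::])).
apply: (@event_ext (fun w => exists s, Y m w = s /\ A (rcons (mkseq (Y^~ w) m) s))).
  by move=> w; rewrite mkseqS; split=> [[s [-> //]]|H]; exists (Y m w).
by apply: event_ex => s; apply: event_and => //; exact: (IH (fun t => A (rcons t s))).
Qed.

Lemma event_local m (A : (nat -> S) -> Prop) :
  (forall y y', (forall i, (i < m)%N -> y i = y' i) -> A y -> A y') -> event (fun w => A (Y^~ w)).
Proof.
move=> loc; have [s0|nS] := pselect (inhabited S); last first.
  have noS (w : Omega) : False by apply: nS; constructor; exact: Y 0%N w.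
  by apply: event_ext (event_const True) => w; case: (noS w).
case: s0 => s0; apply: event_ext (event_prefix m (fun t => A (nth s0 t))) => w.
by split; apply: loc => i im; rewrite nth_mkseq.
Qed.

End Events.

Section Spread.
Context (disp : measure_display) (Omega : measurableType disp).
Context (d n : nat) (Q : {fset 'rV[int]_d}) (calD : {set config Q}).
Context (Y : nat -> Omega -> config Q).
Hypothesis mY : forall k s, event (fun w => Y k w = s).

Lemma event_joined z z' : event (fun w => joined n calD (Y^~ w) z z').
Proof.
apply: (@event_ext _ _ (fun w => exists b, live calD (Y^~ w) b /\
    conn (V := box_lattice n Q) 0 b (Y^~ w) z z')).
  by move=> w; split=> [[b [lb c]]|[b lb c]]; exists b.
apply: event_ex => b; apply: event_and.
  apply: (@event_local _ _ _ _ mY b (fun y => live calD y b)) => y y' yy H j jb.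
  by rewrite -yy //; exact: H.
apply: (@event_local _ _ _ _ mY b.+1 (fun y => conn (V := box_lattice n Q) 0 b y z z')).
move=> y y' yy; apply: conn_sub => r /and3P[r0 rb rm]; apply/and3P; split=> //.
by rewrite -yy.
Qed.

Lemma event_isend k : event (fun w => isend calD (Y^~ w) k).
Proof.
apply: (@event_local _ _ _ _ mY k.+1 (fun y => isend calD y k)) => y y' yy.
by rewrite /isend yy.
Qed.

Lemma event_spread_ends m : event (fun w => spread_ends n calD (Y^~ w) m).
Proof.
apply: event_ex => l; apply: (@event_ext _ _ (fun w =>
  (m <= \sum_(e <- l) dist_sup (val e.1.2.1) (val e.2.1))%N /\
  ((forall e, e \in l -> isend calD (Y^~ w) e.1.1.2 /\
     (joined n calD (Y^~ w) e.1.1 e.1.2 /\ joined n calD (Y^~ w) e.1.1 e.2)) /\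
  pairwise (fun e e' => `[< ~ joined n calD (Y^~ w) e.1.1 e'.1.1 >]) l))).
  move=> w; split=> [[a [b c]]|[a b c]].
    by split=> // e /b[? []].
  by split=> //; split=> // e /b[].
apply: event_and; first exact: event_const.
apply: event_and; last first.
  by apply: event_pairwise => e e'; apply: event_not; exact: event_joined.
apply: event_all => e; apply: event_imp => _; apply: event_and; first exact: event_isend.
by apply: event_and; exact: event_joined.
Qed.

Lemma event_spread_middle m : event (fun w => spread_middle n calD (Y^~ w) m).
Proof.
apply: event_ex => q; apply: event_ex => q'; apply: (@event_ext _ _ (fun w =>
  joined n calD (Y^~ w) q q' /\ ((m <= dist_sup (val q.1) (val q'.1))%N /\
  forall z, ~ (isend calD (Y^~ w) z.2 /\ joined n calD (Y^~ w) q z)))).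
  move=> w; split=> [[a [b c]]|[a b c]]; split=> //.
    by move=> z ez jz; exact: c z (conj ez jz).
  by split=> // z [/c].
apply: event_and; first exact: event_joined.
apply: event_and; first exact: event_const.
apply: event_all => z; apply: event_not; apply: event_and; first exact: event_isend.
exact: event_joined.
Qed.

End Spread.

(** * Supersolutions along the jump chain *)

Section Chain.
Context (R : realType) (S : finType) (q : S -> S -> R) (a : S).
Context (disp : measure_display) (Omega : measurableType disp) (P : probability Omega R).
Context (Y : nat -> Omega -> S).
Local Notation tot s := (\sum_(s' : S) q s s').
Hypothesis mY : forall k s, event (fun w => Y k w = s).
Hypothesis law : forall (m : nat) (y : nat -> S),
  P [set w | forall k, (k <= m)%N -> Y k w = y k] =
  ((y 0%N == a)%:R * \prod_(k < m) (q (y k) (y k.+1) / tot (y k)))%:E.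
Implicit Types (t p : seq S) (s : S).

Local Notation starts t := [set w | mkseq (Y^~ w) (size t) = t].

Lemma starts_nth s0 t : (0 < size t)%N ->
  starts t = [set w | forall k, (k <= (size t).-1)%N -> Y k w = nth s0 t k].
Proof.
move=> t0; apply/seteqP; split=> w /= H.
  by move=> k; rewrite -ltnS prednK // => kt; rewrite -[in RHS]H nth_mkseq.
apply: (@eq_from_nth _ s0); rewrite size_mkseq // => i it; rewrite nth_mkseq //.
by apply: H; rewrite -ltnS prednK.
Qed.

Lemma starts1 s : P (starts [:: s]) = ((s == a)%:R)%:E.
Proof. by rewrite (@starts_nth s) //= (law 0 (nth s [:: s])) big_ord0 mulr1. Qed.

Lemma starts_rcons p s s' :
  P (starts (rcons (rcons p s) s')) = (P (starts (rcons p s)) * (q s s' / tot s)%:E)%E.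
Proof.
rewrite !(@starts_nth s) ?size_rcons //= (law _ (nth s _)) (law _ (nth s (rcons p s))).
rewrite -EFinM big_ord_recr /= mulrA; congr ((_ * _ * _)%:E).
- by rewrite nth_rcons size_rcons.
- apply: eq_bigr => k _; have kp := ltn_ord k.
  by rewrite !(nth_rcons _ (rcons p s)) !size_rcons !ltnS kp (ltnW kp).
- by rewrite !nth_rcons !size_rcons ltnS leqnn !ltnn !eqxx.
Qed.

Context (A : seq S -> Prop) (W : seq S -> S -> R).
Hypotheses (q_ge0 : forall s s', 0 <= q s s') (W_ge0 : forall p s, 0 <= W p s).
Hypothesis W_ge1 : forall p s, A (rcons p s) -> 1 <= W p s.
Hypothesis W_super : forall p s, \sum_s' q s s' / tot s * W (rcons p s) s' <= W p s.

Lemma measure_sum (F : S -> set Omega) B : measurable B -> (forall s, measurable (F s)) ->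
  B `<=` \bigcup_s F s -> (P B <= \sum_(s : S) P (F s))%E.
Proof.
move=> mB mF BF; have H r : measurable (\big[setU/set0]_(s <- r) F s) /\
    (P (\big[setU/set0]_(s <- r) F s) <= \sum_(s <- r) P (F s))%E.
  elim: r => [|s r [m1 le1]]; first by rewrite !big_nil measure0.
  rewrite !big_cons; split; first exact: measurableU.
  by apply: le_trans (measureU2 _ _ _) _ => //; exact: leeD.
have [m1 le1] := H (index_enum S); apply: le_trans le1; apply: le_measure; rewrite ?inE //.
by move=> w /BF[s _ Fs]; rewrite -bigcup_seq; exists s => //=; rewrite mem_index_enum.
Qed.

(** Induction on the number j of steps left, splitting on the next state: W is at least 1 on A, and
    [W_super] carries the bound back one step. *)
Lemma chain_le_starts j p s :
  (P [set w | mkseq (Y^~ w) (size p).+1 = rcons p s /\ A (mkseq (Y^~ w) ((size p).+1 + j))] <=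
   P (starts (rcons p s)) * (W p s)%:E)%E.
Proof.
have mA m B : measurable [set w | B (mkseq (Y^~ w) m)] by exact: (event_prefix mY).
elim: j p s => [|j IH] p s.
  have [Ap|nA] := pselect (A (rcons p s)); last first.
    rewrite (_ : [set w | _] = set0) ?measure0 ?mule_ge0 ?lee_fin //.
    by apply/seteqP; split=> // w /= [e]; rewrite addn0 e.
  apply: (@le_trans _ _ (P (starts (rcons p s)))).
    apply: le_measure; rewrite ?inE.
    - by apply: event_and; [exact: mA (eq^~ _)|rewrite addn0; exact: mA].
    - exact: mA (eq^~ _).
    - by move=> w [] /=; rewrite size_rcons.
  by rewrite -[leLHS]mule1 lee_wpmul2l ?lee_fin // W_ge1.
apply: (@le_trans _ _ (\sum_(s' : S) P (starts (rcons (rcons p s) s')) * (W (rcons p s) s')%:E)%E); last first.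
  under eq_bigr do rewrite starts_rcons -muleA -EFinM.
  rewrite -ge0_sume_distrr => [|s' _]; last by rewrite lee_fin mulr_ge0 // divr_ge0 // sumr_ge0.
  by rewrite sumEFin lee_wpmul2l // lee_fin.
apply: le_trans (_ : (_ <= \sum_(s' : S) P [set w | mkseq (Y^~ w) (size (rcons p s)).+1 =
    rcons (rcons p s) s' /\ A (mkseq (Y^~ w) ((size (rcons p s)).+1 + j))])%E) _.
  apply: measure_sum.
  - by apply: event_and; [exact: mA (eq^~ _)|exact: mA].
  - by move=> s'; apply: event_and; [exact: mA (eq^~ _)|exact: mA].
  move=> w [/= e Aw]; exists (Y (size p).+1 w) => //=.
  by rewrite size_rcons mkseqS e addSnnS.
by apply: lee_sum => s' _; exact: IH.
Qed.

Lemma chain_le m : (P [set w | A (mkseq (Y^~ w) m.+1)] <= (W [::] a)%:E)%E.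
Proof.
have mA k B : measurable [set w | B (mkseq (Y^~ w) k)] by exact: (event_prefix mY).
apply: (@le_trans _ _ (\sum_(s : S) (((s == a)%:R)%:E * (W [::] s)%:E))%E); last first.
  rewrite (bigD1 a) //= big1 ?adde0 ?eqxx ?mul1e // => s /negPf ->.
  by rewrite mul0e.
apply: le_trans (_ : (_ <= \sum_(s : S) P [set w | mkseq (Y^~ w) 1 = [:: s] /\ A (mkseq (Y^~ w) (1 + m))])%E) _.
  apply: measure_sum => [|s|]; first exact: mA.
    by apply: event_and; [exact: mA (eq^~ _)|exact: mA].
  by move=> w Aw; exists (Y 0%N w).
by apply: lee_sum => s _; rewrite -starts1; exact: (chain_le_starts m [::] s).
Qed.

Lemma chain_ever : (forall t t', A t -> A (t ++ t')) ->
  event (fun w => exists m, A (mkseq (Y^~ w) m)) /\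
  (P [set w | exists m, A (mkseq (Y^~ w) m)] <= (W [::] a)%:E)%E.
Proof.
move=> Acat; have mE : event (fun w => exists m, A (mkseq (Y^~ w) m)).
  by apply: event_ex => m; exact: event_prefix mY _ _.
split=> //; pose F m := [set w | A (mkseq (Y^~ w) m.+1)].
have Amono w k k' : (k <= k')%N -> A (mkseq (Y^~ w) k) -> A (mkseq (Y^~ w) k').
  move=> kk Ak; rewrite -(subnKC kk) /mkseq iotaD map_cat; exact: Acat.
have FE : [set w | exists m, A (mkseq (Y^~ w) m)] = \bigcup_m F m.
  apply/seteqP; split=> w /= [m]; last by move=> _ Am; exists m.+1.
  by move=> Am; exists m => //; apply: Amono Am.
have mF m : measurable (F m) by exact: (event_prefix mY).
have Fcvg : P (F m) @[m --> \oo] --> P (\bigcup_m F m).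
  apply: nondecreasing_cvg_mu => //; first by rewrite -FE.
  by move=> k k' kk; apply/subsetPset => w; apply: Amono.
rewrite FE -(cvg_lim _ Fcvg) //; apply: lime_le; first by apply/cvg_ex; eexists; exact: Fcvg.
by apply: nearW => m; exact: chain_le.
Qed.

End Chain.

Section JumpChain.
Context (R : realType) (d n : nat) (h beta : R) (Q : {fset 'rV[int]_d}) (a : config Q).
Context (v l : nat).
Local Notation VQ := (box_lattice n Q).
Hypotheses (beta_ge0 : 0 <= beta) (V0 : (0 < #|VQ|)%N).
Context (u0 : coin (@accept R h beta (4 * d) VQ)).
Local Notation q := (@jump_rate R d n h beta Q).
Local Notation wildp := (@wildp R h (4 * d) VQ v l beta u0).
Implicit Types (s : config Q) (p t : seq (config Q)) (x : Q).

Lemma flip_rateE s x : flip_rate n h beta s x = rate h beta (V := VQ) s x.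
Proof. by rewrite /flip_rate /rate !H_npm_energy. Qed.

Lemma jump_rate_ge0 s s' : 0 <= q s s'.
Proof. by apply: sumr_ge0 => x _; exact: expR_ge0. Qed.

Lemma jump_rate_sum s (f : config Q -> R) :
  \sum_s' q s s' * f s' = \sum_x rate h beta (V := VQ) s x * f (flip s x).
Proof.
under eq_bigr do rewrite mulr_suml big_mkcond /=.
rewrite exchange_big /=; apply: eq_bigr => x _.
rewrite (bigD1 (flip s x)) //= eqxx flip_rateE big1 ?addr0 // => s' /negPf.
by rewrite eq_sym => ->.
Qed.

Definition legal t := if t is s :: t' then
  (s == a) && path (fun s s' => [exists x : Q, s' == flip s x]) s t' else true.

Lemma legal_rcons p s s' :
  legal (rcons (rcons p s) s') = legal (rcons p s) && [exists x : Q, s' == flip s x].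
Proof.
case: p => [|r p] /=; first by rewrite !andbT.
by rewrite [in LHS]rcons_path last_rcons andbA.
Qed.

Lemma legal_cat t t' : legal (t ++ t') -> legal t.
Proof. by case: t => //= s t; rewrite cat_path => /and3P[-> ->]. Qed.

(** Illegal words have probability 0 but may occur at some sample points. Counting them as escapes
    makes the final argument pointwise; in the supersolution they cost nothing, their transition
    rates being 0. *)
Definition escapes t := ~~ legal t \/ wild h (V := VQ) v l t.

Lemma escapes_cat t t' : escapes t -> escapes (t ++ t').
Proof.
by case=> [nl|w]; [left; apply: contra nl; exact: legal_cat|right; exact: wild_cat].
Qed.

Definition escapep p s := if legal (rcons p s) then wildp p s else 1.

Lemma escapep_ge0 p s : 0 <= escapep p s.
Proof.
rewrite /escapep; case: ifP => // _.
by have := lazyp_le_wildp v l u0 V0 0 p s; apply: le_trans; have /andP[] := lazyp_bounds v l u0 V0 0 p s.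
Qed.

Lemma escapep_ge1 p s : escapes (rcons p s) -> 1 <= escapep p s.
Proof.
rewrite /escapep; case: ifP => // lg [|w]; first by rewrite lg.
have := lazyp_le_wildp v l u0 V0 0 p s; apply: le_trans.
by rewrite /lazyp /prob /= cats1 asboolT.
Qed.

Lemma escapep_super p s :
  \sum_s' q s s' / (\sum_s' q s s') * escapep (rcons p s) s' <= escapep p s.
Proof.
have tE : \sum_s' q s s' = total_rate h (V := VQ) beta s.
  under eq_bigr do rewrite -[q _ _]mulr1.
  by rewrite (jump_rate_sum s (fun _ => 1)); under eq_bigr do rewrite mulr1.
have t0 := @total_rate_gt0 R h (4 * d) VQ beta V0 s.
under eq_bigr do rewrite -mulrA; rewrite jump_rate_sum.
rewrite {2}/escapep; case: ifP => lg.
  apply: le_trans (wildp_super v l u0 beta_ge0 V0 p s).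
  apply: ler_sum => x _; rewrite tE mulrA /escapep legal_rcons lg /=.
  by case: ifP => // /existsP[]; exists x.
under eq_bigr do rewrite /escapep legal_rcons lg /= mulr1.
by rewrite -mulr_suml tE mulfV // gt_eqF.
Qed.

End JumpChain.

(** * The estimate for the continuous-time process *)

Section Assembly.
Context (R : realType) (d n : nat) (h beta : R) (Q : {fset 'rV[int]_d}) (calD : {set config Q}).
Context (v l : nat) (e : R).
Local Notation VQ := (box_lattice n Q).
Context (u0 : coin (@accept R h beta (4 * d) VQ)).
Hypotheses (beta_ge0 : 0 <= beta) (V0 : (0 < #|VQ|)%N) (vl : (v < l)%N).
Hypothesis safe_calD : forall s, s \in calD -> safe (V := VQ) h v s.
Hypothesis small : forall k s, prob (@weight R h beta (4 * d) VQ u0) k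
  (sprawl (h := h) v l [set: VQ]%SET s) <= e.

Lemma safe_le s : s \in calD -> (#|s| <= v)%N.
Proof. by move/safe_calD; exact: safe_card. Qed.

Lemma glauber_diam (D : nat) a disp (Omega : measurableType disp) (P : probability Omega R) X :
  a \in calD -> ((2 * v + 1) * reach_bound v l < D)%N ->
  @glauber_process R d n h beta Q a disp Omega P X ->
  let E := [set w | (D%:R%:E <= diam_STC (X ^~ w) 0 (exit_time calD (X ^~ w)))%E] in
  measurable E /\ (P E <= e%:E)%E.
Proof.
move=> aD Dl [Y [T [mY mT T_oo XY law]]] /=.
have D0 : (0 < D)%N by exact: leq_ltn_trans Dl.
have T0 k w : 0 < T k w by have [] := T_oo w.
have EE w : (D%:R%:E <= diam_STC (X ^~ w) 0 (exit_time calD (X ^~ w)))%E <->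
    spread_ends n calD (Y^~ w) D \/ spread_middle n calD (Y^~ w) D.
  apply: (@diam_STC_P _ _ _ _ _ _ (fun k => \sum_(j < k) T j w)) => //.
  - by rewrite big_ord0.
  - by move=> k; rewrite big_ord_recr ltrDl /=.
  - by have [] := T_oo w.
  - by move=> t k; exact: XY.
have mE : event (fun w => (D%:R%:E <= diam_STC (X ^~ w) 0 (exit_time calD (X ^~ w)))%E).
  apply: (event_ext (fun w => iff_sym (EE w))).
  by apply: event_or; [exact: event_spread_ends|exact: event_spread_middle].
split=> //.
(* The marginal law of the jump chain: u = 0 is allowed and all holding times are positive. *)
have law0 m (y : nat -> config Q) : P [set w | forall k, (k <= m)%N -> Y k w = y k] =
    ((y 0%N == a)%:R * \prod_(k < m) (@jump_rate R d n h beta Q (y k) (y k.+1) /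
       \sum_s' @jump_rate R d n h beta Q (y k) s'))%:E.
  have := law m y (fun=> 0) (fun=> lexx _).
  under [X in _ * X]eq_bigr do rewrite mulr0 expR0.
  rewrite big1_eq mulr1 => <-; congr (P _); apply/seteqP; split=> w /= H k km.
    by split; [exact: H|exact: T0].
  by have [] := H k km.
have [mA PA] := chain_ever mY law0 (@jump_rate_ge0 R d n h beta Q)
  (@escapep_ge0 R d n h beta Q a v l V0 u0) (@escapep_ge1 R d n h beta Q a v l V0 u0)
  (@escapep_super R d n h beta Q a v l beta_ge0 V0 u0) (@escapes_cat R d n h Q a v l).
apply: le_trans (_ : _ <= (escapep a v l u0 [::] a)%:E)%E _; last first.
  rewrite lee_fin /escapep /= eqxx; apply: wildp_le => // k.
  by rewrite lazyp_sprawl.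
apply: le_trans PA; apply: le_measure; rewrite ?inE // => w /EE sp.
(* If no prefix escapes, all prefixes are legal and not wild, so [spread_bound] contradicts the
   choice of D. *)
apply: contrapT => /forallNP calm.
have leg m : legal a (mkseq (Y^~ w) m).
  by apply: contrapT => nl; apply: (calm m); left; apply/negP.
have y0 : Y 0%N w = a by have := leg 1%N; rewrite /= andbT => /eqP.
suff : (D <= (2 * v + 1) * reach_bound v l)%N by rewrite leqNgt Dl.
apply: spread_bound sp => //; first exact: safe_le.
- by rewrite y0.
- move=> k; have := leg k.+2; rewrite !mkseqS legal_rcons => /andP[_ /existsP[x /eqP ->]].
  by exists x.
move=> b lb; apply: contrapT => nb; apply: (calm b.+1); right; exists b.
rewrite size_mkseq; split=> // [i ib|bd].
  by rewrite nth_mkseq //; apply: safe_calD; exact: lb.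
apply: nb; apply: bounded_sub bd => r /and3P[_ rb rm].
by rewrite /pt rb nth_mkseq.
Qed.

End Assembly.

Theorem theorem5p7 (R : realType) (d n : nat) (h : R)
    (hd : (1 <= d)%N) (hn : (1 <= n <= d)%N)
    (h_gt0 : 0 < h) (h_irr : irrational h) :
  forall (v : nat) (K : R), 0 < K ->
  exists D : R,
  forall (Q : R -> {fset 'rV[int]_d})
    (calD : forall beta : R, {set config (Q beta)}),
    (forall beta, 0 < beta -> is_box (Q beta)) ->
    (ln (#|` Q beta|%:R : R) / ln beta) @[beta --> +oo] --> (0 : R) ->
    (* (a) *)
    (forall beta, 0 < beta ->
       forall sigma, sigma \in calD beta -> (#|sigma| <= v)%N) ->
    (* (b) *)
    (forall beta, 0 < beta ->
       forall sigma C : config (Q beta),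
         sigma \in calD beta -> is_component sigma C ->
         H_npm n h C > H_npm n h (finset.set0 : config (Q beta))) ->
    (* (c) *)
    (forall beta, 0 < beta ->
       forall sigma eta : config (Q beta),
         sigma \in calD beta -> eta \subset sigma ->
         H_npm n h eta <= H_npm n h sigma -> eta \in calD beta) ->
    \forall beta \near +oo,
      forall alpha : config (Q beta), alpha \in calD beta ->
      forall (disp : measure_display) (Omega : measurableType disp)
        (P : probability Omega R) (X : R -> Omega -> config (Q beta)),
        glauber_process n h beta alpha P X ->
        let E := [set w | (D%:E <=
          diam_STC (fun t => X t w) 0 (exit_time (calD beta) (fun t => X t w)))%E]
        in measurable E /\ (P E <= (expR (- beta * K))%:E)%E.
Proof.
move=> v K K0; have [l0 [b0 b00 tameP]] := tame_all (4 * d) h_irr v K0.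
(* The bound v.+1 on l makes it exceed the diameter of a cluster inside the exit slice. *)
pose l := maxn l0 v.+1.
exists ((2 * v + 1) * reach_bound v l).+1%:R => Q calD boxQ Qln card_le comp_pos down.
(* The quotient of logarithms is eventually below 1, which gives the bound #|Q| <= beta required by
   [tame]. *)
have Qsmall : \forall beta \near +oo, `|ln (#|` Q beta|%:R : R) / ln beta| < 1.
  have /cvgrPdist_lt/(_ 1 ltr01) := Qln; apply: filterS => beta.
  by rewrite sub0r normrN.
have large : \forall beta \near +oo, Num.max b0 1 < beta by apply: nbhs_pinfty_gt; exact: num_real.
apply: filterS2 Qsmall large => beta Qb; rewrite gt_max => /andP[bb b1] a aD disp Omega P X gX.
have b0' : 0 < beta by exact: lt_trans b1.
have cE : #|box_lattice n (Q beta)| = #|` Q beta| by rewrite -cardfE.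
have [lo [hi [lohi Qbox]]] := boxQ _ b0'.
have Q0 : (0 < #|` Q beta|)%N.
  by rewrite cardfs_gt0; apply/fset0Pn; exists lo; apply/Qbox => i; rewrite lexx lohi.
have Qle : (#|` Q beta|%:R : R) <= beta.
  have l1 : 0 < ln beta by rewrite ln_gt0.
  move: Qb; rewrite normrM normfV (gtr0_norm l1) ltr_pdivrMr // mul1r => /(le_lt_trans (ler_norm _)).
  by move/ltW; rewrite ler_ln // posrE // ltr0n.
have [u0 _] : exists _ : coin (@accept R h beta (4 * d) (box_lattice n (Q beta))), True.
  apply: coin_exists => i; rewrite expR_ge0 /= /accept -expR0 ler_expR mulNr oppr_le0.
  by rewrite mulr_ge0 ?(ltW b0') // le_max lexx.
apply: (@glauber_diam R d n h beta (Q beta) (calD beta) v l _ u0) aD _ gX => //.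
- exact: ltW.
- by rewrite cE.
- by rewrite /l leq_max leqnn orbT.
- move=> s; apply: metastable_safe => //; [exact: card_le|exact: comp_pos|exact: down].
move=> k s; apply: (@le_trans _ _ (prob (@weight R h beta _ _ u0) k
    (sprawl (h := h) v l0 [set: box_lattice n (Q beta)]%SET s))).
  apply: prob_le => [|ns _ [b [bn sf nb]]]; first exact: weight_ge0.
  by exists b; split=> // bd; apply: nb; apply: bounded_le bd; rewrite leq_maxl.
by apply: tameP; rewrite ?cE ?finset.subsetT //; exact: ltW.
Qed.
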